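(* Let $1<k\le n$, $a\in\mathbb{R}^{n+1}\setminus\{0\}$, $\tilde a=a/|a|$. A function $f\in C_a^+(\mathbb{S}^n)$ can be reconstructed from $g(\zeta)=(\Pi_af)(\zeta)$ by the formula $$f(x)\equiv(\Pi_a^{-1}g)(x)=\tfrac12\,|x\cdot\tilde a|\,(R^{-1}\Phi)(\mathrm{Q}_ax),$$ where $\mathrm{Q}_ax$ is the orthogonal projection of $x$ onto $a^\perp$, $$\Phi(\tau)\equiv\Phi(\tau_0,u)=(1-|u|^2)^{-1/2}\,g\big((\tau_0\oplus\mathbb{R}\tilde a)+u\big)$$ for the $(k-1)$-dimensional affine plane $\tau=\tau_0+u$ in $a^\perp$, with $\tau_0$ a $(k-1)$-dimensional linear subspace of $a^\perp$ and $u\in a^\perp\cap\tau_0^\perp$, $|u|<1$, and $R^{-1}\Phi$ is the inverse Radon–John transform of $\Phi$ on $a^\perp$.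
   Context: $\mathbb{S}^n$ is the unit sphere and $\mathbb{B}^{n+1}$ the open unit ball in $\mathbb{R}^{n+1}$; $a^\perp\cong\mathbb{R}^n$ is the linear hyperplane orthogonal to $a$. $\mathcal{Z}_a(n+1,k)$ is the set of all $k$-dimensional affine planes in $\mathbb{R}^{n+1}$ that are parallel to $a$ and meet $\mathbb{B}^{n+1}$. For $f\in C(\mathbb{S}^n)$, $$(\Pi_af)(\zeta)=\int_{\mathbb{S}^n\cap\zeta}f(x)\,d\sigma(x),\qquad\zeta\in\mathcal{Z}_a(n+1,k),$$ with $d\sigma$ the $(k-1)$-dimensional surface area measure. $C_a^+(\mathbb{S}^n)$ is the set of $f\in C(\mathbb{S}^n)$ with $f(x)=f(\mathrm{R}_ax)$ for all $x$, where $\mathrm{R}_ax=x-2\frac{x\cdot a}{|a|^2}a$. The operator $\Pi_a^{-1}:\Pi_a(C(\mathbb{S}^n))\to C_a^+(\mathbb{S}^n)$ is defined by $\Pi_a^{-1}g=\frac12(f+f\circ\mathrm{R}_a)$ for $g=\Pi_af$ (this does not depend on the choice of $f$); it is a left inverse of the restriction of $\Pi_a$ to $C_a^+(\mathbb{S}^n)$. Inverse Radon–John transform: put $d=k-1$. The Radon–John transform over $d$-planes of $a^\perp$ is $(R\psi)(\tau_0,u)=\int_{\tau_0}\psi(u+v)\,dv$, with $\tau_0$ a $d$-dimensional linear subspace of $a^\perp$ and $u\in a^\perp\cap\tau_0^\perp$. A function $\psi\in L^p(a^\perp)$, $1\le p<n/d$, is recovered from $\Phi=R\psi$ by $$\psi(y)=(R^{-1}\Phi)(y)=\lim_{t\to0}\pi^{-d/2}(\mathcal{D}^{d/2}_{-,2}R_y^*\Phi)(t)\quad\text{(limit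 in the }L^p\text{-norm)},$$ where $(R_y^*\Phi)(t)=\int_{SO(a^\perp)}\Phi(\gamma\tau_0+y+t\gamma e)\,d\gamma$, $t>0$, is the mean value of $\Phi$ over all $d$-planes at distance $t$ from $y$ ($d\gamma$ the Haar probability measure, $e\in a^\perp$ a fixed unit vector, $\tau_0$ a fixed $d$-dimensional linear subspace of $a^\perp$ orthogonal to $e$); and, with $m=[d/2]$ and $D=\frac1{2t}\frac{d}{dt}$, $$\mathcal{D}^{d/2}_{-,2}q=t^{2-d+2m}(-D)^{m+1}\,t^{d}\,I^{1-d/2+m}_{-,2}\,t^{-2m-2}q,\qquad (I^\alpha_{-,2}q)(t)=\frac{2}{\Gamma(\alpha)}\int_t^\infty\frac{q(s)\,s\,ds}{(s^2-t^2)^{1-\alpha}},$$ powers of $t$ acting as multiplication operators. Functions on the unit ball of $a^\perp$ are regarded as zero outside it, and correspondingly $\Phi(\tau_0,u)=0$ for $|u|\ge1$. *)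

(* Defs.v *)
From HB Require Import structures.
From mathcomp Require Import all_boot all_order all_algebra.
From mathcomp Require Import all_classical all_reals all_analysis.
From mathcomp Require Import measurable_realfun.

Set Implicit Arguments.
Unset Strict Implicit.
Unset Printing Implicit Defensive.

Import Order.TTheory GRing.Theory Num.Theory.
Import numFieldNormedType.Exports.

Local Open Scope classical_set_scope.
Local Open Scope ring_scope.

(* Matrices carry the sigma-algebra generated by the coordinates, which is   *)
(* the Borel sigma-algebra.                                                  *)
Section measurable_matrix.
Context {R : realType} {m n : nat}.

Definition mx_cylinder : set (set 'M[R]_(m, n)) :=
  [set C | exists (i : 'I_m) (j : 'I_n), exists2 A : set (measurableTypeR R),
     measurable A & C = [set M : 'M[R]_(m, n) | A (M i j)]].

Let mx_set0 : <<s mx_cylinder >> set0.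
Proof. exact: sigma_algebra0. Qed.

Let mx_setC A : <<s mx_cylinder >> A -> <<s mx_cylinder >> (~` A).
Proof. exact: sigma_algebraC. Qed.

Let mx_bigcup (F : (set 'M[R]_(m, n))^nat) :
  (forall i, <<s mx_cylinder >> (F i)) ->
  <<s mx_cylinder >> (\bigcup_i (F i)).
Proof. exact: sigma_algebra_bigcup. Qed.

HB.instance Definition _ := @isMeasurable.Build default_measure_display
  'M[R]_(m, n) <<s mx_cylinder >> mx_set0 mx_setC mx_bigcup.

Lemma measurable_coord (i : 'I_m) (j : 'I_n) :
  measurable_fun setT (fun M : 'M[R]_(m, n) => M i j : measurableTypeR R).
Proof.
move=> _ A mA; rewrite setTI; apply: sub_sigma_algebra.
by exists i, j, A.
Qed.

Lemma measurable_mxP d (T : measurableType d) (h : T -> 'M[R]_(m, n)) :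
  (forall i j, measurable_fun setT (fun x => h x i j : measurableTypeR R)) ->
  measurable_fun setT h.
Proof.
move=> mh; apply: (measurability mx_cylinder) => //.
move=> _ [_ [i [j [A mA ->]]] <-].
exact: mh.
Qed.

End measurable_matrix.

Section euclidean.
Context {R : realType} {N : nat}.
Implicit Types (u v x a : 'rV[R]_N) (W : {vspace 'rV[R]_N}).

Definition dot u v : R := (u *m v^T) 0 0.

(* `|u| is the sup norm on matrices; the Euclidean norm is enorm u. *)
Definition enorm u : R := Num.sqrt (dot u u).

Definition usphere : set 'rV[R]_N := [set x | enorm x = 1].

Definition uball : set 'rV[R]_N := [set x | enorm x < 1].

Definition orth_to u W : Prop := {in W, forall w, dot u w = 0}.

Definition hyperplane a : {vspace 'rV[R]_N} := lker (linfun (mulmxr a^T)).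

(* An orthonormal basis of W, as the rows of a matrix. *)
Definition onb W : 'M[R]_(\dim W, N) :=
  xget 0 [set B | B *m B^T = 1%:M /\ forall x, (x \in W) = (x <= B)%MS].

(* The orthogonal projection onto the orthogonal complement of W. *)
Definition perp W x : 'rV[R]_N := x - x *m (onb W)^T *m onb W.

Definition Qproj a x : 'rV[R]_N := x - (dot x a / dot a a) *: a.

Definition hrefl a x : 'rV[R]_N := x - (2 * (dot x a / dot a a)) *: a.

Definition unitv a : 'rV[R]_N := (enorm a)^-1 *: a.

Definition aplane W u : set 'rV[R]_N := [set x | x - u \in W].

End euclidean.

Section lebesgue_measures.
Context {R : realType}.

Lemma measurable_mulmxr m n p (B : 'M[R]_(n, p)) :
  measurable_fun setT (fun x : 'M[R]_(m, n) => x *m B).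
Proof.
apply: measurable_mxP => i j.
rewrite (_ : (fun _ => _) = (fun x : 'M[R]_(m, n) => \sum_k x i k * B k j));
  last by apply/funext => x; rewrite mxE.
apply: measurable_sum => k; apply: measurable_funM => //.
exact: measurable_coord.
Qed.

Lemma measurable_enorm N : measurable_fun setT (@enorm R N).
Proof.
have dE (x : 'rV[R]_N) : dot x x = \sum_k x 0 k * x 0 k.
  by rewrite /dot mxE; apply: eq_bigr => k _; rewrite mxE.
rewrite (_ : @enorm R N = (fun x => (\sum_k x 0 k * x 0 k) `^ 2^-1)).
  apply: (measurableT_comp (measurable_powR _)).
  by apply: measurable_sum => k; apply: measurable_funM;
    exact: measurable_coord.
apply/funext => x; rewrite powR12_sqrt ?/enorm ?dE//.
by apply: sumr_ge0 => k _; rewrite -expr2 sqr_ge0.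
Qed.

Lemma measurable_radial N :
  measurable_fun setT (fun x : 'rV[R]_N => (enorm x)^-1 *: x).
Proof.
apply: measurable_mxP => i j.
rewrite (_ : (fun _ => _) = (fun x : 'rV[R]_N => enorm x `^ (-1) * x i j)).
  apply: measurable_funM; last exact: measurable_coord.
  apply: (measurableT_comp (measurable_powR (-1))).
  exact: measurable_enorm.
by apply/funext => x; rewrite mxE powR_inv1// sqrtr_ge0.
Qed.

Definition cons_rV n (p : measurableTypeR R * 'rV[R]_n) : 'rV[R]_n.+1 :=
  (row_mx (p.1 : R)%:M p.2 : 'rV[R]_(1 + n)).

Definition uncons_rV n (v : 'rV[R]_n.+1) : measurableTypeR R * 'rV[R]_n :=
  (v 0 0, rsubmx (v : 'rV[R]_(1 + n))).

Lemma cons_rVK n : cancel (@cons_rV n) (@uncons_rV n).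
Proof.
case=> x v; rewrite /cons_rV /uncons_rV; congr pair; last exact: row_mxKr.
have e : (0 : 'I_n.+1) = lshift n (0 : 'I_1) by exact/val_inj.
by rewrite /= e (row_mxEl (x : R)%:M v 0 0) mxE mulr1n.
Qed.

Lemma measurable_cons_rV n : measurable_fun setT (@cons_rV n).
Proof.
apply: measurable_mxP => i j.
case: (split_ordP (j : 'I_(1 + n))) => l jl.
- rewrite (_ : (fun _ => _) = fst) //.
  apply/funext => p; rewrite /cons_rV jl (row_mxEl (p.1 : R)%:M p.2 i l) mxE.
  by rewrite !ord1 eqxx mulr1n.
- rewrite (_ : (fun _ => _) = (fun p => (p.2 : 'rV[R]_n) i l)).
    apply: (measurableT_comp (measurable_coord i l)).
    exact: measurable_snd.
  by apply/funext => p; rewrite /cons_rV jl (row_mxEr (p.1 : R)%:M p.2 i l).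
Qed.

HB.instance Definition _ n :=
  isMeasurableFun.Build _ _ _ _ (@cons_rV n) (@measurable_cons_rV n).

Lemma measurable_uncons_rV n : measurable_fun setT (@uncons_rV n).
Proof.
apply/measurable_fun_pairP; split => /=; first exact: measurable_coord.
apply: measurable_mxP => i j /=.
rewrite (_ : (fun _ => _) = fun x : 'rV[R]_n.+1 => x i (rshift 1 j)).
  exact: measurable_coord.
by apply/funext => x; rewrite mxE.
Qed.

Section cons_measure.
Context {n : nat} (mu : {sigma_finite_measure set 'rV[R]_n -> \bar R}).
Local Open Scope ereal_scope.

Definition cons_measure : set 'rV[R]_n.+1 -> \bar R :=
  pushforward (@lebesgue_measure R \x mu) (@cons_rV n).

Let cons_measure0 : cons_measure set0 = 0.
Proof. exact: measure0. Qed.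

Let cons_measure_ge0 A : 0 <= cons_measure A.
Proof. exact: measure_ge0. Qed.

Let cons_measure_sigma_additive : semi_sigma_additive cons_measure.
Proof. exact: measure_semi_sigma_additive. Qed.

HB.instance Definition _ := isMeasure.Build _ _ _ cons_measure
  cons_measure0 cons_measure_ge0 cons_measure_sigma_additive.

Let cons_measure_sigma_finite : sigma_finite setT cons_measure.
Proof.
have /sigma_finiteP[F [TF ndF Foo]] := sigma_finiteT (@lebesgue_measure R).
have /sigma_finiteP[G [TG ndG Goo]] := sigma_finiteT mu.
exists (fun i => @uncons_rV n @^-1` (F i `*` G i)) => [|i].
  rewrite -preimage_bigcup; apply/seteqP; split=> // v _ /=.
  have [i _ Fv] : (\bigcup_i F i) (uncons_rV v).1 by rewrite -TF.
  have [j _ Gv] : (\bigcup_j G j) (uncons_rV v).2 by rewrite -TG.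
  exists (maxn i j) => //; split.
    by move: Fv; exact/subsetPset/ndF/leq_maxl.
  by move: Gv; exact/subsetPset/ndG/leq_maxr.
have [mF Foo'] := Foo i; have [mG Goo'] := Goo i; split.
  rewrite -[X in measurable X]setTI; apply: measurable_uncons_rV => //.
  exact: measurableX.
rewrite /cons_measure /pushforward -comp_preimage.
rewrite (_ : _ \o _ = id); last by apply/funext => x; exact: cons_rVK.
by rewrite preimage_id product_measure1E// lte_mul_pinfty// ge0_fin_numE.
Qed.

HB.instance Definition _ := Measure_isSigmaFinite.Build _ _ _ cons_measure
  cons_measure_sigma_finite.

End cons_measure.

(* Lebesgue measure on R^n, as an iterated product measure. *)
Fixpoint leb n : {sigma_finite_measure set 'rV[R]_n -> \bar R} :=
  match n with
  | 0 => \d_(0 : 'rV[R]_0)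
  | n'.+1 => cons_measure (leb n')
  end.

Section subspace_measures.
Context {N : nat} (W : {vspace 'rV[R]_N}).
Local Open Scope ereal_scope.

Definition embed_onb (v : 'rV[R]_(\dim W)) : 'rV[R]_N := (v *m onb W)%R.

HB.instance Definition _ :=
  isMeasurableFun.Build _ _ _ _ embed_onb (measurable_mulmxr (onb W)).

(* Lebesgue measure of the subspace W, as a measure on the ambient space; it *)
(* does not depend on the orthonormal basis, by rotation invariance.         *)
Definition leb_on : set 'rV[R]_N -> \bar R :=
  pushforward (leb (\dim W)) embed_onb.

Let leb_on0 : leb_on set0 = 0.
Proof. exact: measure0. Qed.

Let leb_on_ge0 A : 0 <= leb_on A.
Proof. exact: measure_ge0. Qed.

Let leb_on_sigma_additive : semi_sigma_additive leb_on.
Proof. exact: measure_semi_sigma_additive. Qed.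

HB.instance Definition _ := isMeasure.Build _ _ _ leb_on
  leb_on0 leb_on_ge0 leb_on_sigma_additive.

(* The surface area measure of the unit sphere of W, in polar coordinates:   *)
(* the area of A is dim W times the volume of the cone with base A and apex  *)
(* 0.                                                                        *)
Definition sphere_measure (A : set 'rV[R]_N) : \bar R :=
  (\dim W)%:R%:E *
  leb_on [set x | (0 < enorm x <= 1)%R /\ A ((enorm x)^-1 *: x)%R].

Let pball : set 'rV[R]_N := [set x | (0 < enorm x <= 1)%R].

Let measurable_pball : measurable pball.
Proof.
rewrite (_ : pball = @enorm R N @^-1` `]0%R, 1%R]).
  by rewrite -[X in measurable X]setTI; exact: measurable_enorm.
by apply/seteqP; split=> x; rewrite /pball /= in_itv.
Qed.

Let radial (x : 'rV[R]_N) : 'rV[R]_N := ((enorm x)^-1 *: x)%R.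

HB.instance Definition _ :=
  isMeasurableFun.Build _ _ _ _ radial (@measurable_radial N).

Let sphere_measureE : sphere_measure =
  pushforward (mscale ((\dim W)%:R : R)%:nng%R (mrestr leb_on measurable_pball))
    radial.
Proof.
apply/funext => A; rewrite /sphere_measure /pushforward /mscale/= /mrestr.
by congr (_ * leb_on _); apply/seteqP; split=> x [].
Qed.

Let sphere_measure0 : sphere_measure set0 = 0.
Proof. rewrite sphere_measureE; exact: measure0. Qed.

Let sphere_measure_ge0 A : 0 <= sphere_measure A.
Proof. rewrite sphere_measureE; exact: measure_ge0. Qed.

Let sphere_measure_sigma_additive : semi_sigma_additive sphere_measure.
Proof. rewrite sphere_measureE; exact: measure_semi_sigma_additive. Qed.

HB.instance Definition _ := isMeasure.Build _ _ _ sphere_measure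
  sphere_measure0 sphere_measure_ge0 sphere_measure_sigma_additive.

End subspace_measures.

End lebesgue_measures.

Section parallel_slice_transform.
Context {R : realType} {N : nat}.
Implicit Types (a u x : 'rV[R]_N) (W : {vspace 'rV[R]_N}).
Implicit Types (zeta : set 'rV[R]_N) (f : 'rV[R]_N -> R).

Definition parallel_planes a (k : nat) : set (set 'rV[R]_N) :=
  [set zeta | exists W u, [/\ zeta = aplane W u, \dim W = k, a \in W &
    zeta `&` uball !=set0]].

(* The direction W of an affine plane and its point u closest to the origin. *)
Definition plane_rep zeta : {vspace 'rV[R]_N} * 'rV[R]_N :=
  xget (0%VS, 0) [set Wu | orth_to Wu.2 Wu.1 /\ zeta = aplane Wu.1 Wu.2].

(* For zeta = W + u meeting the open unit ball, with u orthogonal to W, the  *)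
(* section of the unit sphere by zeta is the sphere of centre u and radius   *)
(* (1 - |u|^2)^(1/2) in zeta, whose area measure is obtained from that of    *)
(* the unit sphere of W by translation and scaling.                          *)
Definition section_integral f zeta : R :=
  let: (W, u) := plane_rep zeta in
  let r := Num.sqrt (1 - dot u u) in
  r ^+ (\dim W).-1 * \int[sphere_measure W]_(x in usphere) f (u + r *: x).

(* Functions on the sphere are represented by functions on the ambient space *)
(* of which only the values on the sphere are used.                          *)
Definition csphere f : Prop := {within usphere, continuous f}.

Definition csphere_even a f : Prop :=
  csphere f /\ {in usphere, forall x, f x = f (hrefl a x)}.

Definition section_integral_inv a (k : nat) (g : set 'rV[R]_N -> R) :
    'rV[R]_N -> R :=
  let f := xget (fun=> 0) [set f | csphere f /\
    {in parallel_planes a k, forall zeta, section_integral f zeta = g zeta}] in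
  fun x => 2^-1 * (f x + f (hrefl a x)).

(* Planes of a^perp are given by their direction tau0 and their point u      *)
(* orthogonal to tau0.                                                       *)
Definition Phi a (g : set 'rV[R]_N -> R) (tau0 : {vspace 'rV[R]_N}) u : R :=
  if enorm u < 1 then
    (1 - dot u u) `^ (- 2^-1) * g (aplane (tau0 + <[unitv a]>)%VS u)
  else 0.

End parallel_slice_transform.

Section radon_john_inverse.
Context {R : realType}.

Definition Gamma (z : R) : R :=
  \int[lebesgue_measure]_(s in `]0, +oo[) (s `^ (z - 1) * expR (- s)).

Definition frac_I (alpha : R) (q : R -> R) (t : R) : R :=
  2 / Gamma alpha * \int[lebesgue_measure]_(s in `]t, +oo[)
    (q s * s * (s ^+ 2 - t ^+ 2) `^ (alpha - 1)).

(* - D with D = (2 t)^-1 d/dt. *)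
Definition negD (q : R -> R) (t : R) : R := - (derive1 q t / (2 * t)).

(* The Erdelyi-Kober type derivative of order d/2, a left inverse of         *)
(* frac_I (d/2).                                                             *)
Definition frac_D (d : nat) (q : R -> R) (t : R) : R :=
  let m := d./2 in
  t `^ (2 - d%:R + m.*2%:R) *
  iter m.+1 negD (fun s => s ^+ d *
    frac_I (1 - d%:R / 2 + m%:R) (fun w => w ^- (m.*2.+2) * q w) s) t.

Context {N : nat}.
Implicit Types (a e y : 'rV[R]_N).

(* SO(a^perp), extended to the ambient space by fixing a; matrices act on    *)
(* row vectors by multiplication on the right.                               *)
Definition SO_perp a : set 'M[R]_N :=
  [set gam | [/\ gam *m gam^T = 1%:M, \det gam = 1 & a *m gam = a]].

(* As operators, del *m gam is del followed by gam, so this is left          *)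
(* invariance; the group is compact, hence unimodular.                       *)
Definition is_haar a (mu : probability 'M[R]_N R) : Prop :=
  mu (SO_perp a) = 1%E /\
  forall gam, SO_perp a gam -> forall A : set 'M[R]_N, measurable A ->
    mu ((fun del => del *m gam) @^-1` A) = mu A.

(* The mean of Psi over the planes at distance t from y: the plane           *)
(* gam tau0 + y + t gam e is passed to Psi in the form tau0' + u with u      *)
(* orthogonal to tau0'.                                                      *)
Definition mean_dist a (mu : probability 'M[R]_N R)
    (tau0 : {vspace 'rV[R]_N}) e
    (Psi : {vspace 'rV[R]_N} -> 'rV[R]_N -> R) y (t : R) : R :=
  \int[mu]_(gam in SO_perp a)
    let gtau := (linfun (mulmxr gam) @: tau0)%VS in
    Psi gtau (perp gtau (y + t *: (e *m gam))).

Definition in_Lp a (p : R) (psi : 'rV[R]_N -> R) : Prop :=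
  measurable_fun setT psi /\
  (Lnorm (leb_on (hyperplane a)) p%:E (EFin \o psi) < +oo)%E.

(* psi is a representative of the inverse Radon-John transform of Psi; the   *)
(* functions of y inside the limit are taken up to almost everywhere         *)
(* equality.                                                                 *)
Definition is_radon_john_inv a (mu : probability 'M[R]_N R)
    (tau0 : {vspace 'rV[R]_N}) e (p : R)
    (Psi : {vspace 'rV[R]_N} -> 'rV[R]_N -> R) (psi : 'rV[R]_N -> R) : Prop :=
  let d := \dim tau0 in
  let lam := leb_on (hyperplane a) in
  in_Lp a p psi /\
  exists F : R -> 'rV[R]_N -> R,
    [/\ forall t, 0 < t -> in_Lp a p (F t),
        forall t, 0 < t -> {ae lam, forall y,
          F t y = pi `^ (- (d%:R / 2)) *
            frac_D d (mean_dist a mu tau0 e Psi y) t} &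
        Lnorm lam p%:E (EFin \o (F t \- psi)) @[t --> 0^'+] --> 0%E].

End radon_john_inverse.

(* Main.v *)
Require Import Defs.
From mathcomp Require Import all_boot all_order all_algebra.
From mathcomp Require Import all_classical all_reals all_analysis.
From mathcomp Require Import measurable_realfun ring lra.

(* Split x on the sphere as y + s a~ with y in a^perp. The section of the     *)
(* sphere by the plane (tau0 + R a~) + u projects two-to-one onto the part of *)
(* tau = tau0 + u inside the unit ball, and comparing the area of the section *)
(* with Lebesgue measure on tau shows that Phi is the Radon-John transform of *)
(*   psi y = (f (y + s a~) + f (y - s a~)) / s,   s = (1 - |y|^2)^(1/2),      *)
(* while f x + f (R_a x) = |x.a~| psi (Q_a x). The mean of Phi over the planes *)
(* at distance w from y is, in polar coordinates, a constant times            *)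
(*   int_w^oo M(s) (s^2 - w^2)^(d/2 - 1) 2s ds,                               *)
(* where M(s) is the mean of psi over the sphere of centre y and radius s. M  *)
(* is continuous at t unless that sphere is tangent to the unit sphere, which *)
(* for given t excludes a null set of y; so the fractional derivative at t is *)
(* M(t). Averaging is a contraction of L^p and M(t) tends to psi y pointwise  *)
(* where |y| <> 1, so by Fatou's lemma the convergence holds in L^p; and a    *)
(* second use of Fatou's lemma identifies any other L^p limit with psi.       *)

(** Everything is reduced to one explicit function on a^perp, [slice_pot a f], whose plane integrals
    are inverted by direct computation.

    Slices. [ge0_slice_link] projects the section of the sphere along a~ onto tau; both hemispheres
    have density (1 - |y|^2)^(-1/2), up to the factor (1 - |u|^2)^(1/2) that [Phi] divides out. So
    [Phi_slice] exhibits Phi as the Radon-John transform of [slice_pot a f], and [slice_pot_sphere]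
    recovers f x + f (R_a x) from it off the equator x.a = 0.

    Inversion. An average over rotations sees only the length of a vector of a^perp ([haar_orbit]),
    so [mean_distE] turns the mean over planes at distance w into a one-dimensional tail integral of
    spherical means. In [frac_D_tail] the fractional integral composes with this tail integral,
    through a Beta integral, into an ordinary (m+1)-fold integral, which (-D)^(m+1) undoes at every
    point of continuity. [sphere_mean_continuous] supplies the continuity away from tangency, and
    the constants cancel because |S^(d-1)| Gamma(d/2) = 2 pi^(d/2).

    Convergence. Jensen's inequality and translation invariance make the spherical means
    contractions of L^p ([powint_sphere_mean]); together with convergence almost everywhere,
    [powint_cvg] yields convergence in L^p.

    Uniqueness. Any other representative is an L^p limit of the same means, hence equals
    [slice_pot a f] almost everywhere ([radon_john_inv_unique]). For two functions with the same
    sections the potentials therefore agree almost everywhere, then off the unit sphere by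
    continuity, so their even parts agree on S^n ([sum_hrefl_unique]); this is why the preimage
    chosen in [section_integral_inv] does not matter.

    In the sections on spherical means and inversion, d = k - 1 is written [n.+1], k is [n.+2], and
    the dimension of a^perp is [m.+2]. *)

Set Implicit Arguments.
Unset Strict Implicit.
Unset Printing Implicit Defensive.

Import Order.TTheory GRing.Theory Num.Theory.
Import numFieldNormedType.Exports.

Local Open Scope classical_set_scope.
Local Open Scope ring_scope.

(** * Measurability and one-dimensional integrals *)

Section measurability.
Context d (T : measurableType d) (R : realType).
Implicit Types f g : T -> R.

Lemma measurable_fun_add f g : measurable_fun setT f -> measurable_fun setT g ->
  measurable_fun setT (fun x => f x + g x).
Proof. exact: measurable_funD. Qed.

Lemma measurable_fun_opp f : measurable_fun setT f ->
  measurable_fun setT (fun x => - f x).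
Proof. exact: measurable_funN. Qed.

Lemma measurable_fun_mul f g : measurable_fun setT f -> measurable_fun setT g ->
  measurable_fun setT (fun x => f x * g x).
Proof. exact: measurable_funM. Qed.

Lemma measurable_fun_pow f n : measurable_fun setT f ->
  measurable_fun setT (fun x => f x ^+ n).
Proof. exact: measurable_funX. Qed.

Lemma measurable_fun_powR f p : measurable_fun setT f ->
  measurable_fun setT (fun x => f x `^ p).
Proof. exact: (measurableT_comp (measurable_powR p)). Qed.

Lemma measurable_fun_inv f : measurable_fun setT f ->
  measurable_fun setT (fun x => (f x)^-1).
Proof.
(* Real powers need a nonnegative base, hence the square; the convention 0^-1 = 0 makes the identity
   hold at 0 as well. *)
move=> mf; rewrite (_ : (fun _ => _) = (fun x => f x * (f x ^+ 2) `^ (-1))).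
  by apply: measurable_fun_mul => //; exact/measurable_fun_powR/measurable_fun_pow.
apply/funext => x; rewrite powR_inv1 ?sqr_ge0//.
have [->|f0] := eqVneq (f x) 0; first by rewrite invr0 mul0r.
by rewrite expr2 invfM mulrA divff// mul1r.
Qed.

Lemma measurable_fun_sqrt f : measurable_fun setT f ->
  measurable_fun setT (fun x => Num.sqrt (f x)).
Proof.
move=> mf; rewrite (_ : (fun _ => _) = (fun x => (Num.max (f x) 0) `^ (2^-1))).
  exact/measurable_fun_powR/measurable_maxr.
apply/funext => x; case: (leP (f x) 0) => f0.
  by rewrite ler0_sqrtr// powR0.
by rewrite powR12_sqrt// ltW.
Qed.

Lemma measurable_fun_norm f : measurable_fun setT f ->
  measurable_fun setT (fun x => `|f x|).
Proof. exact: measurableT_comp. Qed.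

Lemma measurable_fun_expR f : measurable_fun setT f ->
  measurable_fun setT (fun x => expR (f x)).
Proof. exact: measurableT_comp. Qed.

Lemma measurable_fun_EFin f : measurable_fun setT f ->
  measurable_fun setT (fun x => (f x)%:E).
Proof. by move=> mf; exact/measurable_EFinP. Qed.

Lemma measurable_fun_mule (f g : T -> \bar R) :
  measurable_fun setT f -> measurable_fun setT g ->
  measurable_fun setT (fun x => f x * g x)%E.
Proof. exact: emeasurable_funM. Qed.

Lemma measurable_fun_adde (f g : T -> \bar R) :
  measurable_fun setT f -> measurable_fun setT g ->
  measurable_fun setT (fun x => f x + g x)%E.
Proof. exact: emeasurable_funD. Qed.

Lemma measurable_fun_abse (f : T -> \bar R) :
  measurable_fun setT f -> measurable_fun setT (fun x => `|f x|)%E.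
Proof. exact: measurableT_comp. Qed.

Lemma measurable_fun_fine (f : T -> \bar R) :
  measurable_fun setT f -> measurable_fun setT (fun x => fine (f x)).
Proof. by move=> mf; apply: (measurableT_comp (@fine_measurable R setT _)). Qed.

Lemma measurable_pred_indic (b : T -> bool) :
  measurable_fun setT b -> measurable_fun setT (fun x => (b x)%:R : R).
Proof.
move=> mb; rewrite (_ : (fun _ => _) = (fun x => if b x then 1 else 0)).
  exact: measurable_fun_ifT.
by apply/funext => x; case: (b x).
Qed.

Lemma measurable_fun_ltb f g : measurable_fun setT f -> measurable_fun setT g ->
  measurable_fun setT (fun x => f x < g x).
Proof. exact: measurable_fun_ltr. Qed.

Lemma measurable_fun_leb f g : measurable_fun setT f -> measurable_fun setT g ->
  measurable_fun setT (fun x => f x <= g x).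
Proof. exact: measurable_fun_ler. Qed.

Lemma measurable_fun_andb (f g : T -> bool) :
  measurable_fun setT f -> measurable_fun setT g ->
  measurable_fun setT (fun x => f x && g x).
Proof. exact: measurable_and. Qed.

Lemma measurable_fun_comp d1 (T1 : measurableType d1) (F : T1 -> \bar R)
    (h : T -> T1) :
  measurable_fun setT F -> measurable_fun setT h ->
  measurable_fun setT (fun x => F (h x)).
Proof. exact: measurableT_comp. Qed.

Lemma measurable_fun_compr d1 (T1 : measurableType d1) (F : T1 -> R)
    (h : T -> T1) :
  measurable_fun setT F -> measurable_fun setT h ->
  measurable_fun setT (fun x => F (h x)).
Proof. exact: measurableT_comp. Qed.

End measurability.

Section matrix_measurability.
Context d (T : measurableType d) (R : realType).

Lemma measurable_fun_coord m n (f : T -> 'M[R]_(m, n)) i j :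
  measurable_fun setT f ->
  measurable_fun setT (fun x => f x i j : measurableTypeR R).
Proof. exact: (measurableT_comp (measurable_coord i j)). Qed.

Lemma measurable_fun_mxD m n (f g : T -> 'M[R]_(m, n)) :
  measurable_fun setT f -> measurable_fun setT g ->
  measurable_fun setT (fun x => f x + g x).
Proof.
move=> mf mg; apply: measurable_mxP => i j.
under eq_fun do rewrite mxE.
by apply: measurable_fun_add; exact: measurable_fun_coord.
Qed.

Lemma measurable_fun_mxN m n (f : T -> 'M[R]_(m, n)) :
  measurable_fun setT f -> measurable_fun setT (fun x => - f x).
Proof.
move=> mf; apply: measurable_mxP => i j.
under eq_fun do rewrite mxE.
by apply: measurable_fun_opp; exact: measurable_fun_coord.
Qed.

Lemma measurable_fun_mxZ m n (c : T -> measurableTypeR R) (f : T -> 'M[R]_(m, n)) :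
  measurable_fun setT c -> measurable_fun setT f ->
  measurable_fun setT (fun x => (c x : R) *: f x).
Proof.
move=> mc mf; apply: measurable_mxP => i j.
under eq_fun do rewrite mxE.
by apply: measurable_fun_mul => //; exact: measurable_fun_coord.
Qed.

Lemma measurable_fun_mulmx m n p (f : T -> 'M[R]_(m, n)) (g : T -> 'M[R]_(n, p)) :
  measurable_fun setT f -> measurable_fun setT g ->
  measurable_fun setT (fun x => f x *m g x).
Proof.
move=> mf mg; apply: measurable_mxP => i j.
under eq_fun do rewrite mxE.
apply: measurable_sum => k.
by apply: measurable_fun_mul; exact: measurable_fun_coord.
Qed.

Lemma measurable_fun_trmx m n (f : T -> 'M[R]_(m, n)) :
  measurable_fun setT f -> measurable_fun setT (fun x => (f x)^T).
Proof.
move=> mf; apply: measurable_mxP => i j.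
by under eq_fun do rewrite mxE; exact: measurable_fun_coord.
Qed.

Lemma measurable_fun_dot n (f g : T -> 'rV[R]_n) :
  measurable_fun setT f -> measurable_fun setT g ->
  measurable_fun setT (fun x => dot (f x) (g x)).
Proof.
move=> mf mg; apply: measurable_fun_coord; apply: measurable_fun_mulmx => //.
exact: measurable_fun_trmx.
Qed.

Lemma measurable_fun_enorm n (f : T -> 'rV[R]_n) :
  measurable_fun setT f -> measurable_fun setT (fun x => enorm (f x)).
Proof. by move=> mf; exact/measurable_fun_sqrt/measurable_fun_dot. Qed.

Lemma measurable_fun_cons_rV n (f : T -> measurableTypeR R) (g : T -> 'rV[R]_n) :
  measurable_fun setT f -> measurable_fun setT g ->
  measurable_fun setT (fun x => cons_rV (f x, g x)).
Proof.
move=> mf mg; apply: (measurableT_comp (@measurable_cons_rV R n)).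
exact: measurable_fun_pair.
Qed.

Lemma measurable_fun_fst d1 (T1 : measurableType d1) d2 (T2 : measurableType d2)
    (f : T -> T1 * T2) : measurable_fun setT f ->
  measurable_fun setT (fun x => (f x).1).
Proof. exact: (measurableT_comp measurable_fst). Qed.

Lemma measurable_fun_snd d1 (T1 : measurableType d1) d2 (T2 : measurableType d2)
    (f : T -> T1 * T2) : measurable_fun setT f ->
  measurable_fun setT (fun x => (f x).2).
Proof. exact: (measurableT_comp measurable_snd). Qed.

Lemma measurable_fun_appl d1 (T1 : measurableType d1) d2 (T2 : measurableType d2)
    (F : T1 -> T2) (h : T -> T1) :
  measurable_fun setT F -> measurable_fun setT h ->
  measurable_fun setT (fun x => F (h x)).
Proof. exact: measurableT_comp. Qed.

End matrix_measurability.

Ltac meas_var := match goal with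
    | H : measurable_fun setT ?F |- measurable_fun setT (fun x => ?F _) =>
      first [ apply: (measurable_fun_comp H) | apply: (measurable_fun_compr H) |
              apply: (measurable_fun_appl H) ]
    end.

Ltac meas_head :=
  lazymatch goal with
    | |- measurable_fun _ (fun x => (_ + _)%R) =>
      first [apply: measurable_fun_add | apply: measurable_fun_adde |
             apply: measurable_fun_mxD]
    | |- measurable_fun _ (fun x => (- _)%R) =>
      first [apply: measurable_fun_opp | apply: measurable_fun_mxN]
    | |- measurable_fun _ (fun x => (_ * _)%R) => apply: measurable_fun_mul
    | |- measurable_fun _ (fun x => (_ ^+ _)%R) => apply: measurable_fun_pow
    | |- measurable_fun _ (fun x => @GRing.inv _ _) => apply: measurable_fun_inv
    | |- measurable_fun _ (fun x => (_ `^ _)%R) => apply: measurable_fun_powR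
    | |- measurable_fun _ (fun x => (_ %:R)%R) => apply: measurable_pred_indic
    | |- measurable_fun _ (fun x => (_ < _)%R) => apply: measurable_fun_ltb
    | |- measurable_fun _ (fun x => (_ <= _)%R) => apply: measurable_fun_leb
    | |- measurable_fun _ (fun x => _ && _) => apply: measurable_fun_andb
    | |- measurable_fun _ (fun x => (_ %:E)%E) => apply: measurable_fun_EFin
    | |- measurable_fun _ (fun x => (_ * _)%E) => apply: measurable_fun_mule
    | |- measurable_fun _ (fun x => (`| _ |)%E) => apply: measurable_fun_abse
    | |- measurable_fun _ (fun x => Num.sqrt _) => apply: measurable_fun_sqrt
    | |- measurable_fun _ (fun x => `| _ |%R) => apply: measurable_fun_norm
    | |- measurable_fun _ (fun x => expR _) => apply: measurable_fun_expR
    | |- measurable_fun _ (fun x => fine _) => apply: measurable_fun_fine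
    | |- measurable_fun _ (fun x => enorm _) => apply: measurable_fun_enorm
    | |- measurable_fun _ (fun x => dot _ _) => apply: measurable_fun_dot
    | |- measurable_fun _ (fun x => cons_rV _) => apply: measurable_fun_cons_rV
    | |- measurable_fun _ (fun x => (_ *: _)%R) => apply: measurable_fun_mxZ
    | |- measurable_fun _ (fun x => _ *m _) => apply: measurable_fun_mulmx
    | |- measurable_fun _ (fun x => (_ ^T)%R) => apply: measurable_fun_trmx
    | |- measurable_fun _ (fun x => fst _) => apply: measurable_fun_fst
    | |- measurable_fun _ (fun x => snd _) => apply: measurable_fun_snd
    | |- measurable_fun _ (fun x => (_, _)) => apply: measurable_fun_pair
    end.

Ltac meas_step := first
  [ assumption | exact: measurable_id | exact: measurable_cst
  | exact: measurable_fst | exact: measurable_snd | meas_var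
  | meas_head
  (* Eta-expansion exposes the head of a function given by a name or a partial application. *)
  | match goal with |- measurable_fun ?D ?f =>
      change (measurable_fun D (fun x => f x)); meas_head
    end
  | exact: measurable_coord ].
Ltac meas := repeat meas_step.

Section power_tools.
Context {R : realType}.
Implicit Types x r s : R.

Lemma gt0_powRD x r s : 0 < x -> x `^ (r + s) = x `^ r * x `^ s.
Proof. by move=> x0; rewrite powRD// (gt_eqF x0) implybT. Qed.

Lemma gt0_powRD1 x r : 0 < x -> x `^ (r + 1) = x `^ r * x.
Proof. by move=> x0; rewrite gt0_powRD// powRr1// ltW. Qed.

Lemma sqr_powR x r : 0 < x -> (x ^+ 2) `^ r = x `^ (2 * r).
Proof. by move=> x0; rewrite -powR_mulrn ?ltW// -powRrM. Qed.

Lemma inv_powR x r : 0 < x -> x^-1 `^ r = x `^ (- r).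
Proof. by move=> x0; rewrite -powR_inv1 ?ltW// -powRrM mulN1r. Qed.

Lemma muleKV (c : R) (x : \bar R) : c != 0 -> (c%:E * ((c^-1)%:E * x) = x)%E.
Proof. by move=> c0; rewrite muleA -EFinM mulfV// mul1e. Qed.

End power_tools.

Section integral_tools.
Local Open Scope ereal_scope.
Context {R : realType}.

(** Extension by zero outside D1 x D2 reduces this to Tonelli's theorem on the full product. *)
Lemma ge0_tonelli d1 d2 (T1 : measurableType d1) (T2 : measurableType d2)
    (m1 : {sigma_finite_measure set T1 -> \bar R})
    (m2 : {sigma_finite_measure set T2 -> \bar R})
    (D1 : set T1) (D2 : set T2) (F : T1 -> T2 -> \bar R) :
  measurable D1 -> measurable D2 ->
  measurable_fun setT (fun p => F p.1 p.2) ->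
  (forall x y, D1 x -> D2 y -> 0 <= F x y) ->
  \int[m1]_(x in D1) \int[m2]_(y in D2) F x y =
  \int[m2]_(y in D2) \int[m1]_(x in D1) F x y.
Proof.
move=> mD1 mD2 mF F0.
pose G := (fun p => F p.1 p.2) \_ (D1 `*` D2).
have mG : measurable_fun setT G.
  apply/(measurable_restrictT _ _).1; first exact: measurableX.
  exact: measurable_funTS.
have G0 p : 0 <= G p.
  rewrite /G patchE; case: ifPn => // /[!inE] -[? ?]; exact: F0.
have := @fubini_tonelli _ _ T1 T2 R m1 m2 G mG G0.
have GE x y : G (x, y) = if (x \in D1) && (y \in D2) then F x y else 0.
  by rewrite /G patchE in_setX.
have E1 x : \int[m2]_y G (x, y) = ((fun x => \int[m2]_(y in D2) F x y) \_ D1) x.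
  rewrite patchE; under eq_integral do rewrite GE; case: ifPn => xD /=.
    by rewrite [RHS]integral_mkcond; apply: eq_integral => y _; rewrite patchE.
  by rewrite integral0_eq.
have E2 y : \int[m1]_x G (x, y) = ((fun y => \int[m1]_(x in D1) F x y) \_ D2) y.
  rewrite patchE; under eq_integral do rewrite GE andbC; case: ifPn => xD /=.
    by rewrite [RHS]integral_mkcond; apply: eq_integral => x _; rewrite patchE.
  by rewrite integral0_eq.
under eq_integral do rewrite E1.
rewrite -integral_mkcond => ->.
by under eq_integral do rewrite E2; rewrite -integral_mkcond.
Qed.

Lemma measurable_fun_integral2 d1 d2 (T1 : measurableType d1)
    (T2 : measurableType d2)
    (m2 : {sigma_finite_measure set T2 -> \bar R})
    (D2 : set T2) (F : T1 -> T2 -> \bar R) :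
  measurable D2 -> measurable_fun setT (fun p => F p.1 p.2) ->
  (forall x y, D2 y -> 0 <= F x y) ->
  measurable_fun setT (fun x => \int[m2]_(y in D2) F x y).
Proof.
move=> mD2 mF F0.
pose G := (fun p => F p.1 p.2) \_ (setT `*` D2).
have mG : measurable_fun setT G.
  apply/(measurable_restrictT _ _).1; first exact: measurableX.
  exact: measurable_funTS.
have G0 p : 0 <= G p.
  rewrite /G patchE; case: ifPn => // /[!inE] -[? ?]; exact: F0.
have := @measurable_fun_fubini_tonelli_F _ _ T1 T2 R m2 G mG G0.
rewrite /fubini_F; congr (measurable_fun _ _); apply/funext => x.
rewrite [RHS]integral_mkcond; apply: eq_integral => y _.
by rewrite /G !patchE in_setX in_setT.
Qed.

Lemma ge0_integral_map d1 d2 (T1 : measurableType d1) (T2 : measurableType d2)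
    (m1 : {measure set T1 -> \bar R}) (m2 : {measure set T2 -> \bar R})
    (h : T1 -> T2) (F : T2 -> \bar R) :
  measurable_fun setT h ->
  (forall A, measurable A -> m2 A = m1 (h @^-1` A)) ->
  measurable_fun setT F -> (forall x, 0 <= F x) ->
  \int[m2]_x F x = \int[m1]_x F (h x).
Proof.
move=> mh m12 mF F0.
rewrite -[RHS]/(\int[m1]_(x in h @^-1` setT) (F \o h) x).
rewrite -ge0_integral_pushforward//.
by apply: eq_measure_integral => A mA _; rewrite m12.
Qed.

Let mu := @lebesgue_measure R.

(** Lebesgue measure is determined by its values on half-open intervals, where translation
    invariance is visible. *)
Lemma integral_shift (c : R) (F : measurableTypeR R -> \bar R) :
  measurable_fun setT F -> (forall x, 0 <= F x) ->
  \int[mu]_x F (x + c)%R = \int[mu]_x F x.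
Proof.
move=> mF F0.
have mh : measurable_fun setT
  (fun x : measurableTypeR R => (x + c)%R : measurableTypeR R).
  exact: measurable_fun_add.
apply/esym; apply: (ge0_integral_map mh) => //.
move=> A mA; rewrite -[RHS]/(pushforward mu _ A).
apply: (@lebesgue_measure_unique R (pushforward mu _)) => // _ [[a b]] _ <-.
rewrite /= /pushforward.
rewrite (_ : _ @^-1` _ = `](a - c)%R, (b - c)%R]%classic); last first.
  by apply/seteqP; split => x /=; rewrite !in_itv/= ltrBlDr lerBrDr.
rewrite !lebesgue_measure_itv/= !lte_fin ltrD2r.
by case: ifP => // _; rewrite -!EFinB; congr (_%:E); ring.
Qed.

Lemma integral_scale (c : R) (F : measurableTypeR R -> \bar R) : (0 < c)%R ->
  measurable_fun setT F -> (forall x, 0 <= F x) ->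
  \int[mu]_x F (c * x)%R = (c^-1)%:E * \int[mu]_x F x.
Proof.
move=> c0 mF F0.
have mh : measurable_fun setT
  (fun x : measurableTypeR R => (c * x)%R : measurableTypeR R).
  exact: measurable_fun_mul.
have c0' : (0 <= c)%R by exact: ltW.
suff : \int[mu]_x F x = c%:E * \int[mu]_x F (c * x)%R.
  by move=> ->; rewrite muleA -EFinM mulVf ?gt_eqF// mul1e.
rewrite (_ : c%:E * _ = \int[mscale (NngNum c0') mu]_x F (c * x)%R); last first.
  rewrite ge0_integral_mscale//; exact: (measurable_fun_comp mF mh).
apply: (ge0_integral_map mh) => // A mA.
rewrite -[RHS]/(pushforward (mscale (NngNum c0') mu) _ A).
apply: (@lebesgue_measure_unique R (pushforward (mscale _ mu) _)) => // _ [[a b]] _ <-.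
rewrite /= /pushforward /mscale/=.
rewrite (_ : _ @^-1` _ = `](a / c)%R, (b / c)%R]%classic); last first.
  by apply/seteqP; split => x /=; rewrite !in_itv/= ltr_pdivrMr// ler_pdivlMr// ![(x * c)%R]mulrC.
rewrite !lebesgue_measure_itv/= !lte_fin ltr_pM2r ?invr_gt0//.
case: ifP => _; last by rewrite mule0.
rewrite -!EFinD -EFinM.
by congr (_%:E); field; rewrite gt_eqF.
Qed.

End integral_tools.

Ltac pos := repeat first
  [ done | exact: ltW | exact: powR_ge0 | exact: sqr_ge0 | exact: ler0n
  | exact: sqrtr_ge0 | exact: normr_ge0 | exact: expR_ge0
  | lazymatch goal with
    | |- is_true (0 <= _ * _)%R => apply: mulr_ge0
    | |- is_true (0 <= _ + _)%R => first [apply: addr_ge0 | apply: adde_ge0]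
    | |- is_true (0 <= _ ^+ _)%R => apply: exprn_ge0
    | |- is_true (0 <= @GRing.inv _ _)%R => rewrite invr_ge0
    | |- is_true (@Order.le _ _ _ (EFin _)) => rewrite lee_fin
    | |- is_true (@Order.le _ _ _ (mule _ _)) => apply: mule_ge0
    | |- is_true (@Order.le _ _ _ (_ + _)%E) => apply: adde_ge0
    | |- is_true (0 < _ * _)%R => apply: mulr_gt0
    | |- is_true (0 < _ ^+ _)%R => apply: exprn_gt0
    | |- is_true (0 < @GRing.inv _ _)%R => rewrite invr_gt0
    | |- is_true (0 < Num.sqrt _)%R => rewrite sqrtr_gt0
    | |- is_true (0 < _ `^ _)%R => apply: powR_gt0
    end
  | match goal with H : forall x, is_true (0 < x)%R -> is_true (@Order.le _ _ _ (?F x))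
      |- is_true (@Order.le _ _ _ (?F _)) => apply: H end
  | match goal with H : forall x, is_true (@Order.le _ _ _ (?F x))
      |- is_true (@Order.le _ _ _ (?F _)) => apply: H end
  | apply: adde_ge0 ].

Section one_dimensional.
Local Open Scope ereal_scope.
Context {R : realType}.
Let mu := @lebesgue_measure R.

Lemma gt0_itvP (x : R) : (`]0%R, +oo[%classic x) = (0 < x)%R.
Proof. by rewrite /= in_itv/= andbT. Qed.

Lemma integral0Zl (c : R) (F : measurableTypeR R -> \bar R) : (0 <= c)%R ->
  measurable_fun setT F -> (forall x, (0 < x)%R -> 0 <= F x) ->
  \int[mu]_(x in `]0%R, +oo[) (c%:E * F x) =
  c%:E * \int[mu]_(x in `]0%R, +oo[) F x.
Proof.
move=> c0 mF F0; rewrite ge0_integralZl//; first exact: measurable_funTS.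
by move=> x; rewrite gt0_itvP; exact: F0.
Qed.

Lemma integral_scale0 (c : R) (F : measurableTypeR R -> \bar R) : (0 < c)%R ->
  measurable_fun setT F -> (forall x, (0 < x)%R -> 0 <= F x) ->
  \int[mu]_(x in `]0%R, +oo[) F (c * x)%R =
  (c^-1)%:E * \int[mu]_(x in `]0%R, +oo[) F x.
Proof.
move=> c0 mF F0; rewrite integral_mkcond [in RHS]integral_mkcond.
rewrite -integral_scale//; last 2 first.
- apply/(measurable_restrictT _ _).1 => //; exact: measurable_funTS.
- move=> x; apply: erestrict_ge0 => y; rewrite gt0_itvP; exact: F0.
apply: eq_integral => x _; rewrite !patchE; congr (if _ then _ else _).
by apply/idP/idP; rewrite !inE/= !in_itv/= !andbT pmulr_rgt0.
Qed.

Lemma continuous_powR (p x : R) : (0 < x)%R ->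
  {for x, continuous (fun y : R => y `^ p)%R}.
Proof.
move=> x0; apply: differentiable_continuous; apply/derivable1_diffP.
by apply: derivable_powR; rewrite in_itv/= andbT.
Qed.

Lemma integral_pow_tail (k a : R) : (1 < k)%R -> (0 < a)%R ->
  \int[mu]_(x in `]a, +oo[) (x `^ (- k))%:E = (a `^ (1 - k) / (k - 1))%:E.
Proof.
move=> k1 a0.
have k10 : (k - 1 != 0)%R by rewrite gt_eqF// subr_gt0.
pose F (x : R) := (- (k - 1)^-1 * x `^ (1 - k))%R.
have dF (x : R) : (0 < x)%R -> is_derive x 1%R F (x `^ (- k))%R.
  move=> x0; have xin : x \in `]0%R, +oo[ by rewrite in_itv/= x0.
  have dx : derivable (fun y : R => y `^ (1 - k))%R x 1 by exact: derivable_powR.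
  have := powR_derive1 (1 - k) xin; rewrite derive1E => dE.
  have idx : is_derive x 1%R (fun y : R => y `^ (1 - k))%R
      ((1 - k) * x `^ (1 - k - 1))%R by apply: DeriveDef.
  rewrite (_ : x `^ (- k) = (- (k - 1)^-1) *: ((1 - k) * x `^ (1 - k - 1)))%R.
    exact: is_deriveZ.
  rewrite (_ : 1 - k - 1 = - k)%R; last by ring.
  by rewrite scalerA -[LHS]mul1r; congr (_ * _)%R; field.
rewrite integral_itv_obnd_cbnd; last first.
  by apply: measurable_funTS; meas.
rewrite (@ge0_continuous_FTC2y _ _ F a 0%R).
- by rewrite /F sub0e -EFinN; congr EFin; rewrite mulNr opprK mulrC.
- by move=> x _; exact: powR_ge0.
- apply/continuous_within_itvcyP; split.
    move=> x; rewrite in_itv/= andbT => ax.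
    by apply: continuous_powR; exact: lt_trans ax.
  by apply: cvg_at_right_filter; exact: continuous_powR.
- rewrite -(mulr0 (- (k - 1)^-1)%R); apply: cvgMr.
  apply/cvgrPdist_lt => e e0.
  have [q q0 eq] : exists2 q, (0 < q)%R & e = (q `^ (- (k - 1)))%R.
    exists (e `^ (- (k - 1)^-1))%R; first exact: powR_gt0.
    by rewrite -powRrM mulrNN mulVf// powRr1// ltW.
  near=> x.
  rewrite sub0r normrN ger0_norm ?powR_ge0//.
  have x0 : (0 < x)%R by near: x; exact: nbhs_pinfty_gt.
  have qx : (q < x)%R by near: x; apply: nbhs_pinfty_gt; rewrite num_real.
  rewrite (_ : 1 - k = - (k - 1))%R; last by ring.
  rewrite eq !powRN ltf_pV2 ?posrE ?powR_gt0//.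
  by apply: gt0_ltr_powR; rewrite ?subr_gt0// ?nnegrE ltW.
- by move=> x ax; have [] := dF x (lt_trans a0 ax).
- apply: cvg_at_right_filter; apply: cvgMr; exact: continuous_powR.
- move=> x; rewrite in_itv/= andbT => ax.
  by rewrite derive1E; have [_ ->] := dF x (lt_trans a0 ax).
Unshelve. all: by end_near. Qed.

(** The substitution u = x^2 for measurable F, by Tonelli alone. The integral is averaged over b in
    (0,1) after the scaling u = b^2 s; for fixed s, b = x s^(-1/2) brings in x, and integrating
    s^(-3/2) over s > x^2 leaves the Jacobian 2 x. *)
Lemma integral_sqr (F : measurableTypeR R -> \bar R) :
  measurable_fun setT F -> (forall x, (0 < x)%R -> 0 <= F x) ->
  \int[mu]_(u in `]0%R, +oo[) F u =
  \int[mu]_(x in `]0%R, +oo[) (F (x ^+ 2)%R * (2 * x)%:E).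
Proof.
move=> mF F0; set I := LHS.
have I0 : 0 <= I.
  by apply: integral_ge0 => x; rewrite gt0_itvP; exact: F0.
have -> : I = \int[mu]_(b in `]0%R, 1%R[)
    \int[mu]_(s in `]0%R, +oo[) (F (b ^+ 2 * s)%R * (b ^+ 2)%:E).
  transitivity (\int[mu]_(b in `]0%R, 1%R[) I).
    by rewrite integral_cst//= /mu lebesgue_measure_itv/= lte01 sube0 mule1.
  apply: eq_integral => b; rewrite inE/= in_itv/= => /andP[b0 b1].
  have b20 : (0 < b ^+ 2)%R by rewrite exprn_gt0.
  rewrite ge0_integralZr//=; last 3 first.
  - by apply: measurable_funTS; meas.
  - by move=> x; rewrite in_itv/= andbT => x0; apply: F0; rewrite mulr_gt0.
  - by rewrite lee_fin ltW.
  rewrite integral_scale0// muleC muleA -EFinM mulfV ?mul1e//.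
  by rewrite gt_eqF.
rewrite (@ge0_tonelli R _ _ _ _ lebesgue_measure lebesgue_measure)//; last 2 first.
- by meas.
- move=> x y; rewrite /= !in_itv/= andbT => /andP[x0 _] y0.
  rewrite mule_ge0 ?lee_fin ?sqr_ge0//.
  by apply: F0; rewrite mulr_gt0// exprn_gt0.
transitivity (\int[mu]_(s in `]0%R, +oo[) \int[mu]_(x in `]0%R, +oo[)
    (F (x ^+ 2)%R * (x ^+ 2 * (s `^ (- (3 / 2))) * (x ^+ 2 < s)%R%:R)%:E)).
  apply: eq_integral => s; rewrite inE/= in_itv/= andbT => s0.
  have r0 : (0 < Num.sqrt s)%R by rewrite sqrtr_gt0.
  pose G : measurableTypeR R -> \bar R :=
    fun x => F (x ^+ 2)%R * (x ^+ 2 / s * (x ^+ 2 < s)%R%:R)%:E.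
  transitivity (\int[mu]_(b in `]0%R, +oo[) G (Num.sqrt s * b)%R).
    rewrite /G.
    rewrite integral_mkcond [RHS]integral_mkcond; apply: eq_integral => b _.
    rewrite !patchE !mem_setE !in_itv/= andbT.
    rewrite exprMn sqr_sqrtr; last exact: ltW.
    case: ltP => //= b0.
    have -> : (s * b ^+ 2 < s)%R = (b < 1)%R.
      by rewrite -[X in (_ < X)%R]mulr1 ltr_pM2l// expr_lt1// ltW.
    rewrite [(s * _)%R]mulrC mulfK ?gt_eqF//.
    by case: ifP => _; rewrite ?mulr1 ?mulr0 ?mule0.
  have mG : measurable_fun setT G by rewrite /G; meas.
  have G0 x : (0 < x)%R -> 0 <= G x.
    move=> x0; apply: mule_ge0; first by apply: F0; rewrite exprn_gt0.
    by rewrite lee_fin !mulr_ge0 ?sqr_ge0 ?invr_ge0// ltW.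
  rewrite integral_scale0// -integral0Zl// ?invr_ge0//.
  apply: eq_integral => x _; rewrite /G muleCA -EFinM; congr (_ * _%:E).
  rewrite mulrA; congr (_ * _)%R; rewrite mulrCA; congr (_ * _)%R.
  rewrite -invfM powRN; congr (_^-1)%R.
  rewrite (_ : 3 / 2 = 2^-1 + 1 :> R)%R; last by field.
  by rewrite powRD ?gt_eqF ?implybT// powR12_sqrt ?powRr1// ltW.
rewrite (@ge0_tonelli R _ _ _ _ lebesgue_measure lebesgue_measure)//; last 2 first.
- by meas.
- move=> x y; rewrite /= !in_itv/= !andbT => x0 y0.
  by pos.
apply: eq_integral => x; rewrite inE/= in_itv/= andbT => x0.
have x20 : (0 < x ^+ 2)%R by rewrite exprn_gt0.
rewrite ge0_integralZl//=; last 3 first.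
- by apply: measurable_funTS; meas.
- by move=> s _; pos.
- exact: F0.
congr (_ * _).
transitivity ((x ^+ 2)%:E * \int[mu]_(s in `](x ^+ 2)%R, +oo[) (s `^ (- (3 / 2)))%:E).
  rewrite -ge0_integralZl//=; last 3 first.
  - by apply: measurable_funTS; meas.
  - by move=> s _; rewrite lee_fin powR_ge0.
  - by rewrite lee_fin ltW.
  rewrite integral_mkcond [RHS]integral_mkcond; apply: eq_integral => s _.
  rewrite !patchE !mem_setE !in_itv/= !andbT.
  have [xs|xs] := ltP (x ^+ 2)%R s; first by rewrite (lt_trans x20 xs) mulr1 EFinM.
  by rewrite mulr0; case: ifP.
rewrite integral_pow_tail//; last lra.
rewrite -EFinM; congr EFin.
rewrite (_ : 1 - 3 / 2 = - 2^-1 :> R)%R; last by field.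
rewrite powRN powR12_sqrt; last exact: ltW.
rewrite sqrtr_sqr gtr0_norm//.
by field; rewrite gt_eqF.
Qed.

(** The same averaging, now with the scaling u = s / b and then b = s x; integrating over 0 < s <
    1/x leaves the Jacobian x^(-2). *)
Lemma integral_inversion (F : measurableTypeR R -> \bar R) :
  measurable_fun setT F -> (forall x, (0 < x)%R -> 0 <= F x) ->
  \int[mu]_(u in `]0%R, +oo[) F u =
  \int[mu]_(x in `]0%R, +oo[) (F (x^-1)%R * (x ^- 2)%:E).
Proof.
move=> mF F0; set I := LHS.
have I0 : 0 <= I.
  by apply: integral_ge0 => x; rewrite gt0_itvP; exact: F0.
have -> : I = \int[mu]_(b in `]0%R, 1%R[)
    \int[mu]_(s in `]0%R, +oo[) (F (b^-1 * s)%R * (b^-1)%:E).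
  transitivity (\int[mu]_(b in `]0%R, 1%R[) I).
    by rewrite integral_cst//= /mu lebesgue_measure_itv/= lte01 sube0 mule1.
  apply: eq_integral => b; rewrite inE/= in_itv/= => /andP[b0 b1].
  have b20 : (0 < b^-1)%R by rewrite invr_gt0.
  rewrite ge0_integralZr//=; last 3 first.
  - by apply: measurable_funTS; meas.
  - by move=> x; rewrite in_itv/= andbT => x0; apply: F0; rewrite mulr_gt0.
  - by rewrite lee_fin ltW.
  rewrite integral_scale0// muleC muleA -EFinM mulfV ?mul1e//.
  by rewrite gt_eqF.
rewrite (@ge0_tonelli R _ _ _ _ lebesgue_measure lebesgue_measure)//; last 2 first.
- by meas.
- move=> x y; rewrite /= !in_itv/= andbT => /andP[x0 _] y0.
  rewrite mule_ge0 ?lee_fin ?invr_ge0 ?(ltW x0)//.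
  by apply: F0; rewrite mulr_gt0// invr_gt0.
transitivity (\int[mu]_(s in `]0%R, +oo[) \int[mu]_(x in `]0%R, +oo[)
    (F (x^-1)%R * (x^-1 * (s * x < 1)%R%:R)%:E)).
  apply: eq_integral => s; rewrite inE/= in_itv/= andbT => s0.
  pose G : measurableTypeR R -> \bar R :=
    fun x => F (x^-1)%R * (x^-1 / s * (s * x < 1)%R%:R)%:E.
  transitivity (\int[mu]_(b in `]0%R, +oo[) G (s^-1 * b)%R).
    rewrite /G.
    rewrite integral_mkcond [RHS]integral_mkcond; apply: eq_integral => b _.
    rewrite !patchE !mem_setE !in_itv/= andbT.
    case: ltP => //= b0.
    rewrite mulrA mulfV ?gt_eqF// mul1r invfM invrK mulrC.
    rewrite (_ : s * b^-1 / s = b^-1)%R; last by field; rewrite !gt_eqF.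
    by case: ifP => _; rewrite ?mulr1 ?mulr0 ?mule0.
  have mG : measurable_fun setT G by rewrite /G; meas.
  have G0 x : (0 < x)%R -> 0 <= G x.
    move=> x0; apply: mule_ge0; first by apply: F0; rewrite invr_gt0.
    by rewrite lee_fin !mulr_ge0 ?invr_ge0// ltW.
  rewrite integral_scale0// ?invr_gt0// invrK -integral0Zl//; last exact: ltW.
  apply: eq_integral => x _; rewrite /G muleCA -EFinM; congr (_ * _%:E).
  by rewrite mulrA mulrCA mulfV ?mulr1// gt_eqF.
rewrite (@ge0_tonelli R _ _ _ _ lebesgue_measure lebesgue_measure)//; last 2 first.
- by meas.
- move=> x y; rewrite /= !in_itv/= !andbT => x0 y0.
  by pos.
apply: eq_integral => x; rewrite inE/= in_itv/= andbT => x0.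
rewrite ge0_integralZl//=; last 3 first.
- by apply: measurable_funTS; meas.
- by move=> s _; rewrite lee_fin !mulr_ge0 ?invr_ge0// ltW.
- by apply: F0; rewrite invr_gt0.
congr (_ * _).
transitivity ((x^-1)%:E * \int[mu]_(s in `]0%R, x^-1%R[) (cst 1 s)).
  rewrite -ge0_integralZl//=; last by rewrite lee_fin invr_ge0 ltW.
  rewrite integral_mkcond [RHS]integral_mkcond; apply: eq_integral => s _.
  rewrite !patchE !mem_setE !in_itv/= !andbT.
  rewrite -[X in (s < X)%R]mul1r ltr_pdivlMr//.
  by case: ltP => //= s0; case: ifP => _; rewrite ?mulr1 ?mulr0// mule1.
rewrite integral_cst// mul1e /= /mu lebesgue_measure_itv/= lte_fin invr_gt0 x0 sube0.
by rewrite -EFinM -invfM expr2.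
Qed.

Lemma integral_shift0 (c : R) (F : measurableTypeR R -> \bar R) :
  measurable_fun setT F -> (forall x, (0 < x)%R -> 0 <= F x) ->
  \int[mu]_(x in `]c, +oo[) F (x - c)%R = \int[mu]_(x in `]0%R, +oo[) F x.
Proof.
move=> mF F0; rewrite integral_mkcond [in RHS]integral_mkcond.
rewrite -[RHS](integral_shift (- c)%R); last 2 first.
- apply/(measurable_restrictT _ _).1 => //; exact: measurable_funTS.
- move=> x; apply: erestrict_ge0 => y; rewrite gt0_itvP; exact: F0.
apply: eq_integral => x _; rewrite !patchE; congr (if _ then _ else _).
by apply/idP/idP; rewrite !inE/= !in_itv/= !andbT subr_gt0.
Qed.

(* the radius of a sphere centred at distance t from a plane, in terms of the
   distance r inside the plane *)
Lemma integral_pythagoras (t : R) (H : measurableTypeR R -> \bar R) : (0 <= t)%R ->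
  measurable_fun setT H -> (forall x, (0 < x)%R -> 0 <= H x) ->
  \int[mu]_(r in `]0%R, +oo[) H r =
  \int[mu]_(s in `]t, +oo[) (H (Num.sqrt (s ^+ 2 - t ^+ 2)) *
     (s / Num.sqrt (s ^+ 2 - t ^+ 2))%:E).
Proof.
move=> t0 mH H0.
pose h : measurableTypeR R -> \bar R := fun u => (H (Num.sqrt u) * ((2 * Num.sqrt u)^-1)%:E).
have mh : measurable_fun setT h by rewrite /h; meas.
have h0 x : (0 < x)%R -> 0 <= h x.
  move=> x0; rewrite /h; apply: mule_ge0; first by apply: H0; rewrite sqrtr_gt0.
  by rewrite lee_fin invr_ge0 mulr_ge0// sqrtr_ge0.
transitivity (\int[mu]_(u in `]0%R, +oo[) h u).
  rewrite [RHS]integral_sqr//; apply: eq_integral => x; rewrite inE/= in_itv/= andbT => x0.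
  rewrite /h sqrtr_sqr gtr0_norm// -muleA -EFinM mulVf ?mule1//.
  by rewrite gt_eqF// mulr_gt0.
rewrite -(integral_shift0 (t ^+ 2) mh h0).
pose h' : measurableTypeR R -> \bar R :=
  fun u => h (u - t ^+ 2)%R * ((t ^+ 2 < u)%R%:R)%:E.
have -> : \int[mu]_(x in `](t ^+ 2)%R, +oo[) h (x - t ^+ 2)%R =
    \int[mu]_(x in `]0%R, +oo[) h' x.
  rewrite integral_mkcond [RHS]integral_mkcond; apply: eq_integral => s _.
  rewrite !patchE !mem_setE !in_itv/= !andbT /h'.
  have [ts|ts] := ltP (t ^+ 2)%R s; last by rewrite mule0 if_same.
  by rewrite mule1 (le_lt_trans _ ts)// sqr_ge0.
rewrite integral_sqr; last 2 first.
- by rewrite /h'; meas.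
- move=> x x0; rewrite /h'; have [ts|ts] := ltP (t ^+ 2)%R x; rewrite ?mule0// mule1.
  by rewrite h0// subr_gt0.
rewrite integral_mkcond [RHS]integral_mkcond; apply: eq_integral => s _.
rewrite !patchE !mem_setE !in_itv/= !andbT /h' /h.
have [s0|s0] := ltP 0%R s; last first.
  by rewrite ltNge (le_trans s0 t0).
rewrite ltr_pXn2r ?nnegrE ?(ltW s0)//.
case: ltP => ts; rewrite ?mule0 ?mul0e// mule1 -muleA -EFinM.
congr (_ * _%:E); field.
by rewrite gt_eqF// sqrtr_gt0 subr_gt0 ltr_pXn2r ?nnegrE ?(ltW s0).
Qed.

End one_dimensional.

(** * Lebesgue measure in Euclidean coordinates *)

Section dot_product.
Context {R : realType} {n : nat}.
Implicit Types (u v w x y : 'rV[R]_n) (c : R).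

Lemma dotE u v : dot u v = \sum_i u 0 i * v 0 i.
Proof. by rewrite /dot mxE; apply: eq_bigr => k _; rewrite mxE. Qed.

Lemma dotC u v : dot u v = dot v u.
Proof. by rewrite !dotE; apply: eq_bigr => i _; rewrite mulrC. Qed.

Lemma dotDl u v w : dot (u + v) w = dot u w + dot v w.
Proof. by rewrite /dot mulmxDl mxE. Qed.

Lemma dotDr u v w : dot w (u + v) = dot w u + dot w v.
Proof. by rewrite dotC dotDl !(dotC w). Qed.

Lemma dotZl c u v : dot (c *: u) v = c * dot u v.
Proof. by rewrite /dot -scalemxAl mxE. Qed.

Lemma dotZr c u v : dot u (c *: v) = c * dot u v.
Proof. by rewrite dotC dotZl dotC. Qed.

Lemma dotNl u v : dot (- u) v = - dot u v.
Proof. by rewrite -scaleN1r dotZl mulN1r. Qed.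

Lemma dotNr u v : dot u (- v) = - dot u v.
Proof. by rewrite dotC dotNl dotC. Qed.

Lemma dotBl u v w : dot (u - v) w = dot u w - dot v w.
Proof. by rewrite dotDl dotNl. Qed.

Lemma dotBr u v w : dot w (u - v) = dot w u - dot w v.
Proof. by rewrite dotDr dotNr. Qed.

Lemma dot0l u : dot 0 u = 0.
Proof. by rewrite /dot mul0mx mxE. Qed.

Lemma dot0r u : dot u 0 = 0.
Proof. by rewrite dotC dot0l. Qed.

Lemma dot_ge0 u : 0 <= dot u u.
Proof. by rewrite dotE sumr_ge0// => i _; rewrite -expr2 sqr_ge0. Qed.

Lemma dot_eq0 u : (dot u u == 0) = (u == 0).
Proof.
apply/idP/eqP => [|->]; last by rewrite dot0l.
rewrite dotE psumr_eq0; last by move=> i _; rewrite -expr2 sqr_ge0.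
move=> /allP u0; apply/rowP => i; rewrite mxE.
by have := u0 i (mem_index_enum i); rewrite -expr2 sqrf_eq0 => /eqP.
Qed.

Lemma enorm_ge0 u : 0 <= enorm u.
Proof. exact: sqrtr_ge0. Qed.

Lemma sqr_enorm u : enorm u ^+ 2 = dot u u.
Proof. by rewrite sqr_sqrtr// dot_ge0. Qed.

Lemma enorm_eq0 u : (enorm u == 0) = (u == 0).
Proof. by rewrite -dot_eq0 -sqr_enorm sqrf_eq0. Qed.

Lemma enorm_gt0 u : (0 < enorm u) = (u != 0).
Proof. by rewrite lt0r enorm_eq0 enorm_ge0 andbT. Qed.

Lemma enormZ c u : 0 <= c -> enorm (c *: u) = c * enorm u.
Proof.
move=> c0; rewrite /enorm dotZl dotZr mulrA -expr2 sqrtrM ?sqr_ge0//.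
by rewrite sqrtr_sqr ger0_norm.
Qed.

Lemma enorm0 : enorm (0 : 'rV[R]_n) = 0.
Proof. by rewrite /enorm dot0l sqrtr0. Qed.

Lemma enorm_le u c : 0 <= c -> (enorm u <= c) = (dot u u <= c ^+ 2).
Proof.
by move=> c0; rewrite -sqr_enorm ler_pXn2r// nnegrE enorm_ge0.
Qed.

Lemma enorm_lt u c : 0 <= c -> (enorm u < c) = (dot u u < c ^+ 2).
Proof.
by move=> c0; rewrite -sqr_enorm ltr_pXn2r// nnegrE enorm_ge0.
Qed.

Lemma enorm_le1 u : (enorm u <= 1) = (dot u u <= 1).
Proof. by rewrite enorm_le// expr1n. Qed.

Lemma enorm_lt1 u : (enorm u < 1) = (dot u u < 1).
Proof. by rewrite enorm_lt// expr1n. Qed.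

Lemma dot_mulmx_orth m (B : 'M[R]_(n, m)) u v : B *m B^T = 1%:M ->
  dot (u *m B) (v *m B) = dot u v.
Proof. by move=> BB; rewrite /dot trmx_mul mulmxA -(mulmxA u) BB mulmx1. Qed.

Lemma enorm_mulmx_orth m (B : 'M[R]_(n, m)) u : B *m B^T = 1%:M ->
  enorm (u *m B) = enorm u.
Proof. by move=> BB; rewrite /enorm dot_mulmx_orth. Qed.

Lemma dot_cons (s t : R) u v :
  dot (cons_rV (s, u)) (cons_rV (t, v)) = s * t + dot u v.
Proof.
transitivity ((row_mx (s%:M : 'M[R]_1) u *m (row_mx (t%:M : 'M[R]_1) v)^T) 0 0).
  by [].
rewrite tr_row_mx mul_row_col mxE; congr (_ + _).
by rewrite tr_scalar_mx -scalar_mxM mxE mulr1n.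
Qed.

Lemma cons_rVD (s t : R) u v :
  cons_rV (s, u) + cons_rV (t, v) = cons_rV (s + t, u + v).
Proof.
transitivity (row_mx (s%:M : 'M[R]_1) u + row_mx (t%:M : 'M[R]_1) v); first by [].
by rewrite add_row_mx -raddfD.
Qed.

Lemma cons_rVZ (c s : R) u : c *: cons_rV (s, u) = cons_rV (c * s, c *: u).
Proof.
transitivity (c *: row_mx (s%:M : 'M[R]_1) u); first by [].
by rewrite scale_row_mx scale_scalar_mx.
Qed.

Lemma cons_rVP (x : 'rV[R]_n.+1) : exists s u, x = cons_rV (s, u).
Proof.
exists (lsubmx (x : 'rV_(1 + n)) 0 0), (rsubmx (x : 'rV_(1 + n))).
by rewrite /cons_rV/= -mx11_scalar hsubmxK.
Qed.

Lemma cons_rV_mul m (B : 'M[R]_(n, m)) (b : 'rV[R]_m) (s : R) u :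
  cons_rV (s, u) *m (col_mx b B : 'M[R]_(1 + n, m)) = s *: b + u *m B.
Proof.
transitivity (row_mx (s%:M : 'M[R]_1) u *m col_mx b B); first by [].
by rewrite mul_row_col mul_scalar_mx.
Qed.

End dot_product.

Section lebesgue_measure_rV.
Local Open Scope ereal_scope.
Context {R : realType}.
Let mu := @lebesgue_measure R.

Lemma integralZl_nneg d (T : measurableType d) (m : {measure set T -> \bar R})
    (c : R) (F : T -> \bar R) :
  (0 <= c)%R -> measurable_fun setT F -> (forall x, 0 <= F x) ->
  \int[m]_x (c%:E * F x) = c%:E * \int[m]_x F x.
Proof. by move=> c0 mF F0; apply: ge0_integralZl. Qed.

Lemma integral_leb0 (F : 'rV[R]_0 -> \bar R) : measurable_fun setT F ->
  \int[leb 0]_x F x = F 0%R.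
Proof. by move=> mF; rewrite /leb/= integral_dirac//= diracT mul1e. Qed.

Lemma integral_leb_cons n (F : 'rV[R]_n.+1 -> \bar R) :
  measurable_fun setT F -> (forall x, 0 <= F x) ->
  \int[leb n.+1]_x F x = \int[mu]_s \int[leb n]_v F (cons_rV (s, v)).
Proof.
move=> mF F0.
have mc : measurable_fun setT (@cons_rV R n) by exact: measurable_cons_rV.
rewrite (ge0_integral_map (m1 := (mu \x leb n)%E) mc)//.
rewrite fubini_tonelli1//.
exact: (measurable_fun_comp mF mc).
Qed.

Lemma integral_leb_shift n (c : 'rV[R]_n) (F : 'rV[R]_n -> \bar R) :
  measurable_fun setT F -> (forall x, 0 <= F x) ->
  \int[leb n]_x F (x + c)%R = \int[leb n]_x F x.
Proof.
elim: n => [|n IH] in c F *; move=> mF F0.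
  by apply: eq_integral => x _; rewrite [c]thinmx0 addr0.
have [s [u ->]] := cons_rVP c.
rewrite [in LHS]integral_leb_cons; [|by meas|by []].
rewrite [in RHS]integral_leb_cons; [|by []|by []].
under eq_integral => x _.
  under eq_integral => v _ do rewrite cons_rVD.
  rewrite (IH u (fun v => F (cons_rV ((x + s)%R, v)))); [|by meas|by []].
  over.
apply: (integral_shift s (F := fun x => \int[leb n]_v F (cons_rV (x, v)))).
  by apply: measurable_fun_integral2; [by []|meas|by []].
by move=> x; apply: integral_ge0 => ? _.
Qed.

Lemma integral_leb_scale n (c : R) (F : 'rV[R]_n -> \bar R) : (0 < c)%R ->
  measurable_fun setT F -> (forall x, 0 <= F x) ->
  \int[leb n]_x F (c *: x)%R = (c ^- n)%:E * \int[leb n]_x F x.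
Proof.
move=> c0; elim: n => [|n IH] in F *; move=> mF F0.
  rewrite expr0 invr1 mul1e; apply: eq_integral => x _.
  by rewrite [x]thinmx0 scaler0.
rewrite [in LHS]integral_leb_cons; [|by meas|by []].
rewrite [in RHS]integral_leb_cons; [|by []|by []].
have mI : measurable_fun setT (fun x : measurableTypeR R => \int[leb n]_v F (cons_rV (x, v))).
  by apply: measurable_fun_integral2 => //; meas.
have I0 (x : R) : 0 <= \int[leb n]_v F (cons_rV (x, v)) by exact: integral_ge0.
under eq_integral => x _.
  under eq_integral => v _ do rewrite cons_rVZ.
  rewrite (IH (fun v => F (cons_rV ((c * x)%R, v)))); [|by meas|by []].
  over.
pose G (x : measurableTypeR R) := \int[leb n]_v F (cons_rV (x, v)).
rewrite -[LHS]/(\int[mu]_x ((c ^- n)%:E * G (c * x)%R)).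
have mG : measurable_fun setT (fun x : measurableTypeR R => G (c * x)%R).
  apply: (measurable_fun_comp mI (h := fun x : measurableTypeR R => (c * x)%R)).
  by meas.
rewrite (integralZl_nneg mu _ mG); [|by pos|by move=> x; exact: I0].
rewrite (integral_scale c0 mI)// muleA -EFinM; congr (_%:E * _).
by rewrite -invfM exprS mulrC.
Qed.

Definition ball_volume n : \bar R := \int[leb n]_x ((dot x x <= 1)%R%:R)%:E.

(** The ball lies in the cylinder with base the lower-dimensional unit ball and height [-1, 1]. *)
Lemma ball_volume_lty n : ball_volume n < +oo.
Proof.
elim: n => [|n IH]; first by rewrite /ball_volume integral_leb0; [rewrite ltry|meas].
rewrite /ball_volume integral_leb_cons; [|by meas|by move=> x; pos].
apply: (@le_lt_trans _ _ (\int[mu]_s ((\1_(`[(-1)%R, 1%R]%classic) s)%:E * ball_volume n))).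
  apply: ge0_le_integral => //.
  - by move=> s _; apply: integral_ge0 => v _; pos.
  - apply: measurable_fun_integral2; [by []|by meas|by move=> *; pos].
  - apply: emeasurable_funM => //; apply/measurable_EFinP.
    exact: measurable_indic.
  - move=> s _; rewrite /ball_volume -integralZl_nneg; [|by rewrite indicE|by meas|by move=> v; pos].
    apply: ge0_le_integral; [by []|by move=> v _; pos|by meas|by meas|].
    move=> v _; rewrite dot_cons -EFinM lee_fin indicE mem_setE/= in_itv/=.
    have [sv|_] := leP (s * s + dot v v)%R 1%R; last by apply: mulr_ge0.
    have -> : (dot v v <= 1)%R.
      by rewrite (le_trans _ sv)// lerDr -expr2 sqr_ge0.
    rewrite -ler_norml mulr1.
    have -> : (`|s| <= 1)%R; last by [].
    rewrite -(@ler_pXn2r _ 2)// ?nnegrE// expr1n -normrX ger0_norm ?sqr_ge0//.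
    by rewrite expr2 (le_trans _ sv)// lerDl dot_ge0.
rewrite ge0_integralZr; [|by []|exact/measurable_EFinP/measurable_indic|by move=> s _; rewrite lee_fin indicE|by apply: integral_ge0 => ? _; pos].
rewrite integral_indic//= setIT /mu lebesgue_measure_itv/= lte_fin.
by case: ifP => _; rewrite ?mul0e ?ltry// lte_mul_pinfty// -?EFinB ?lee_fin; lra.
Qed.

(** The ball contains the cylinder of height [-1/2, 1/2] over the ball of radius 1/2. *)
Lemma ball_volume_gt0 n : 0 < ball_volume n.
Proof.
elim: n => [|n IH].
  rewrite /ball_volume integral_leb0; last by meas.
  by rewrite dot0l ler01 lte_fin.
rewrite /ball_volume integral_leb_cons; [|by meas|by move=> x; pos].
have c0 : (0 < (2^-1 : R))%R by rewrite invr_gt0.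
pose h : \bar R := \int[leb n]_v ((dot v v <= (4^-1 : R))%R%:R)%:E.
have h0 : 0 < h.
  have -> : h = (2^-1 ^+ n)%:E * ball_volume n.
    have -> : ball_volume n = \int[leb n]_v ((dot ((2^-1 : R) *: v) ((2^-1 : R) *: v) <= 4^-1)%R%:R)%:E.
      apply: eq_integral => v _; rewrite dotZl dotZr mulrA.
      by rewrite -[in RHS](ler_pM2l (x := 4))// mulrA (_ : 4 * (_ * _) = 1)%R ?mul1r ?mulfV//; field.
    rewrite (integral_leb_scale (F := fun v => ((dot v v <= 4^-1)%R%:R)%:E)); [|by []|by meas|by move=> v; pos].
    by rewrite muleA -EFinM mulfV ?mul1e// expf_neq0// gt_eqF.
  by rewrite mule_gt0// lte_fin exprn_gt0.
apply: (@lt_le_trans _ _ (\int[mu]_s ((\1_(`[(- 2^-1)%R, (2^-1)%R]%classic) s)%:E * h))).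
  rewrite ge0_integralZr; [|by []|exact/measurable_EFinP/measurable_indic|by move=> s _; rewrite lee_fin indicE|exact: ltW].
  rewrite integral_indic//= setIT mule_gt0// /mu lebesgue_measure_itv/= lte_fin.
  by rewrite ifT -?EFinB ?lte_fin; lra.
apply: ge0_le_integral => //.
- by move=> s _; rewrite mule_ge0 ?(ltW h0)// lee_fin indicE.
- by apply: emeasurable_funM => //; apply/measurable_EFinP.
- apply: measurable_fun_integral2; [by []|by meas|by move=> *; pos].
- move=> s _; rewrite /h -integralZl_nneg; [|by rewrite indicE|by meas|by move=> v; pos].
  apply: ge0_le_integral; [by []| |by meas|by meas|].
    by move=> v _; rewrite mule_ge0// ?lee_fin// indicE.
  move=> v _; rewrite dot_cons -EFinM lee_fin indicE mem_setE/= in_itv/=.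
  case: (boolP (_ <= s <= _)%R) => [sv|_]; last by rewrite mul0r.
  have [vv|_] := leP (dot v v) (4^-1)%R; last by rewrite mulr0.
  have s4 : (s * s <= 4^-1)%R.
    have : (`|s| <= 2^-1)%R by rewrite ler_norml.
    move=> s2; rewrite -expr2 -(ger0_norm (sqr_ge0 s)) normrX.
    by rewrite (_ : 4^-1 = 2^-1 ^+ 2 :> R)%R ?ler_pXn2r ?nnegrE//; field.
  have -> : (s * s + dot v v <= 1)%R by lra.
  by rewrite mulr1.
Qed.

Lemma ball_volume_fin n : ball_volume n \is a fin_num.
Proof. by rewrite ge0_fin_numE ?ball_volume_lty// ltW// ball_volume_gt0. Qed.

(* Both sides of [vol * int F (x *m O)] = [vol * int F] are equal to the double
   integral of [B y * F (x *m O + y)], B the indicator of the unit ball. *)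
Lemma integral_leb_orth n (O : 'M[R]_n) (F : 'rV[R]_n -> \bar R) :
  O *m O^T = 1%:M -> measurable_fun setT F -> (forall x, 0 <= F x) ->
  \int[leb n]_x F (x *m O) = \int[leb n]_x F x.
Proof.
move=> OO mF F0.
have OTO : O^T *m O = 1%:M by exact: mulmx1C.
pose B (x : 'rV[R]_n) : \bar R := ((dot x x <= 1)%R%:R)%:E.
have mB : measurable_fun setT B by rewrite /B; meas.
have B0 x : 0 <= B x by rewrite /B; pos.
have mO : measurable_fun setT (fun x : 'rV[R]_n => F (x *m O)) by meas.
have IO0 : 0 <= \int[leb n]_x F (x *m O) by exact: integral_ge0.
have I0 : 0 <= \int[leb n]_x F x by exact: integral_ge0.
suff E : ball_volume n * \int[leb n]_x F (x *m O) = ball_volume n * \int[leb n]_x F x.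
  have := ball_volume_gt0 n; have := ball_volume_fin n.
  move: (ball_volume n) E => [v| |]// E _; rewrite lte_fin => v0.
  rewrite -[LHS]mul1e -[RHS]mul1e -(mulVf (lt0r_neq0 v0)).
  by rewrite EFinM -!muleA E.
have vB c : \int[leb n]_x B (c - x)%R = ball_volume n.
  rewrite -[RHS](integral_leb_shift (- c) mB B0); apply: eq_integral => x _.
  by rewrite /B -opprB dotNl dotNr opprK.
have Bfin x : B x = ((dot x x <= 1)%R%:R)%:E by [].
transitivity (\int[leb n]_y \int[leb n]_x (B y * F (x *m O + y)%R)).
  rewrite muleC -ge0_integralZl; [|by []|by []|by []|by []].
  apply: eq_integral => y _; rewrite Bfin integralZl_nneg; [|by pos|by meas|by []].
  rewrite muleC; congr (_ * _).
  rewrite -(integral_leb_shift (y *m O^T) mO)//; apply: eq_integral => x _.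
  by rewrite mulmxDl -mulmxA OTO mulmx1.
rewrite (@ge0_tonelli R _ _ _ _ (leb n) (leb n)); [|by []|by []|by meas|by move=> *; pos].
transitivity (\int[leb n]_x \int[leb n]_y (B (y - x *m O)%R * F y)).
  apply: eq_integral => x _.
  rewrite -[RHS](integral_leb_shift (x *m O)); [|by meas|by move=> *; pos].
  by apply: eq_integral => y _; rewrite addrK addrC.
rewrite (@ge0_tonelli R _ _ _ _ (leb n) (leb n)); [|by []|by []|by meas|by move=> *; pos].
rewrite -ge0_integralZl; [|by []|by []|by []|exact/ltW/ball_volume_gt0].
apply: eq_integral => y _.
rewrite -(vB (y *m O^T)).
rewrite -ge0_integralZr; [|by []|by meas|by []|by []].
apply: eq_integral => x _; congr (_ * _).
rewrite /B (_ : y - x *m O = (y *m O^T - x) *m O)%R ?dot_mulmx_orth//.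
by rewrite mulmxBl -mulmxA OTO mulmx1.
Qed.

End lebesgue_measure_rV.

(** * Orthonormal bases of subspaces *)

Section orthonormal_bases.
Context {R : realType}.

Lemma orthonormal_row_free m N (B : 'M[R]_(m, N)) : B *m B^T = 1%:M -> row_free B.
Proof. by move=> BB; apply/row_freeP; exists B^T. Qed.

Lemma gram_schmidt m N (A : 'M[R]_(m, N)) : row_free A ->
  exists2 B : 'M[R]_(m, N), B *m B^T = 1%:M & (B == A)%MS.
Proof.
elim: m => [|m IH] in A *.
  by move=> _; exists A; rewrite ?submx_refl//; apply/matrixP => -[].
rewrite -(@vsubmxK _ 1 m N A).
set b := @usubmx _ 1 m N A; set A' := @dsubmx _ 1 m N A => fA.
have fA' : row_free A'.
  move: fA; rewrite -!kermx_eq0 => /eqP kA; apply/eqP/row_matrixP => i.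
  rewrite row0; have := mulmx_ker A'; move/(congr1 (row i)).
  rewrite row_mul row0 => rA.
  have : (row_mx 0 (row i (kermx A')) <= kermx (col_mx b A'))%MS.
    by apply/sub_kermxP; rewrite mul_row_col mul0mx add0r.
  rewrite kA submx0 => /eqP; rewrite -[0 in RHS]row_mx0.
  by move/eq_row_mx => [_ ->].
have [B' BB' BA'] := IH _ fA'.
have BAE := eqmxP BA'.
pose v := b - b *m B'^T *m B'.
have vB : v *m B'^T = 0 by rewrite mulmxBl -!mulmxA BB' mulmx1 subrr.
(* A zero remainder would put the first row in the span of the others, against the independence of
   the rows. *)
have v0 : v != 0.
  apply/negP => /eqP /subr0_eq bE.
  have : (b <= A')%MS by rewrite bE -BAE submxMl.
  move=> /submxP[c bc].
  have : row_mx 1%:M (- c) = 0.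
    apply: (row_free_inj fA); rewrite mul0mx.
    have E := mul_row_col (1%:M : 'M[R]_1) (- c) b A'; apply: (etrans E).
    by rewrite mul1mx mulNmx bc subrr.
  rewrite -[0 in RHS]row_mx0 => /eq_row_mx[/matrixP/(_ 0 0)].
  by rewrite !mxE => /eqP; rewrite oner_eq0.
have d0 : dot v v != 0 by rewrite dot_eq0.
have e0 : enorm v != 0 by rewrite enorm_eq0.
pose C : 'M[R]_(1 + m, N) := col_mx ((enorm v)^-1 *: v) B'.
have CC : C *m C^T = 1%:M.
  have E1 : ((enorm v)^-1 *: v) *m B'^T = 0 by rewrite -scalemxAl vB scaler0.
  have E2 : B' *m ((enorm v)^-1 *: v)^T = 0.
    by rewrite -[LHS]trmxK trmx_mul trmxK E1 trmx0.
  have E3 : ((enorm v)^-1 *: v) *m ((enorm v)^-1 *: v)^T = 1%:M.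
    apply/matrixP => i j; rewrite !ord1.
    transitivity (dot ((enorm v)^-1 *: v) ((enorm v)^-1 *: v)); first by [].
    by rewrite dotZl dotZr -sqr_enorm mxE mulr1n; field.
  by rewrite /C tr_col_mx mul_col_row E1 E2 E3 BB' -scalar_mx_block.
exists C; first exact: CC.
have vE : b = v + b *m B'^T *m B' by rewrite /v subrK.
suff CA : (C <= col_mx b A')%MS && (col_mx b A' <= C)%MS by exact: CA.
apply/andP; split; rewrite /C col_mx_sub; apply/andP; split.
- rewrite scalemx_sub// /v addmx_sub//.
    by rewrite -(addsmxE b A') addsmxSl.
  rewrite -mulNmx (submx_trans (submxMl _ _))// -(addsmxE b A').
  by rewrite (submx_trans _ (addsmxSr _ _))// BAE.
- by rewrite -(addsmxE b A') (submx_trans _ (addsmxSr _ _))// BAE.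
- rewrite vE -addsmxE addmx_sub//.
    rewrite (submx_trans _ (addsmxSl _ _))// -{1}[v]scale1r -(mulfV e0) -scalerA.
    by rewrite scalemx_sub.
  by rewrite (submx_trans (submxMl _ _))// addsmxSr.
- by rewrite -addsmxE (submx_trans _ (addsmxSr _ _))// -BAE.
Qed.

(** Gram-Schmidt applied to a basis of W shows that the choice in [onb] never falls back on its
    default value. *)
Lemma onbP N (W : {vspace 'rV[R]_N}) :
  onb W *m (onb W)^T = 1%:M /\ forall x, (x \in W) = (x <= onb W)%MS.
Proof.
suff [B BP] : exists B : 'M[R]_(\dim W, N),
    B *m B^T = 1%:M /\ forall x, (x \in W) = (x <= B)%MS.
  by have := @xgetPex _ 0 [set B : 'M[R]_(\dim W, N) |
    B *m B^T = 1%:M /\ forall x, (x \in W) = (x <= B)%MS] (ex_intro _ B BP).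
pose A : 'M[R]_(\dim W, N) := \matrix_i (vbasis W)`_i.
have mulA c : c *m A = \sum_i c 0 i *: (vbasis W)`_i.
  by rewrite mulmx_sum_row; apply: eq_bigr => i _; rewrite rowK.
have fA : row_free A.
  rewrite -kermx_eq0; apply/eqP/row_matrixP => i; rewrite row0.
  apply/rowP => j; rewrite [RHS]mxE.
  have /freeP := basis_free (vbasisP W); apply.
  by rewrite -mulA -row_mul mulmx_ker row0.
have [B BB BA] := gram_schmidt fA.
exists B; split=> // x; rewrite (eqmxP BA); apply/idP/submxP => [xW|[c ->]].
  exists (\row_i coord (vbasis W) i x).
  by rewrite mulA {1}(coord_vbasis xW); apply: eq_bigr => i _; rewrite mxE.
by rewrite mulA memv_suml// => i _; rewrite memvZ// vbasis_mem// mem_nth// size_tuple.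
Qed.

Lemma onb_orth N (W : {vspace 'rV[R]_N}) : onb W *m (onb W)^T = 1%:M.
Proof. by have [] := onbP W. Qed.

Lemma mem_onb N (W : {vspace 'rV[R]_N}) x : (x \in W) = (x <= onb W)%MS.
Proof. by have [_] := onbP W. Qed.

(** The number of rows is a free m, tied to [\dim W] only by [is_onb_dim], so that block matrices
    and rotated bases can serve as bases. *)
Definition is_onb N m (W : {vspace 'rV[R]_N}) (B : 'M[R]_(m, N)) :=
  B *m B^T = 1%:M /\ forall x, (x \in W) = (x <= B)%MS.

Lemma is_onb_dim N m (W : {vspace 'rV[R]_N}) (B : 'M[R]_(m, N)) :
  is_onb W B -> \dim W = m.
Proof.
move=> [BB WB].
have /eqP <- := orthonormal_row_free BB.
have /eqP <- := orthonormal_row_free (onb_orth W).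
apply/eqP; rewrite eqn_leq; apply/andP; split; apply: mxrankS.
  by apply/row_subP => i; rewrite -WB mem_onb row_sub.
by apply/row_subP => i; rewrite -mem_onb WB row_sub.
Qed.

(** Two orthonormal bases of W differ by an orthogonal matrix, under which [leb m] is invariant. *)
Lemma integral_leb_on N m (W : {vspace 'rV[R]_N}) (B : 'M[R]_(m, N))
    (F : 'rV[R]_N -> \bar R) :
  is_onb W B -> measurable_fun setT F -> (forall x, 0 <= F x)%E ->
  (\int[leb_on W]_x F x = \int[leb m]_v F (v *m B))%E.
Proof.
move=> WB; have [BB WBE] := WB; have dW := is_onb_dim WB.
clear WB; case: m / dW in B BB WBE *; move=> mF F0.
have mon : measurable_fun setT (@embed_onb R N W) by exact: measurable_mulmxr.
rewrite (ge0_integral_map (m1 := leb (\dim W)) mon)//.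
rewrite /embed_onb; set O := onb W *m B^T.
have onE : onb W = O *m B.
  suff /submxP[C onC] : (onb W <= B)%MS.
    by rewrite /O onC -(mulmxA C) BB mulmx1.
  by apply/row_subP => i; rewrite -WBE mem_onb row_sub.
have OO : O *m O^T = 1%:M.
  have := onb_orth W; rewrite {1 2}onE trmx_mul mulmxA -(mulmxA O) BB mulmx1.
  by [].
rewrite -[RHS](integral_leb_orth OO); [|by meas|by []].
by under eq_integral do rewrite onE mulmxA.
Qed.

Lemma is_onb_onb N (W : {vspace 'rV[R]_N}) : is_onb W (onb W).
Proof. exact: onbP. Qed.

Lemma integral_leb_on_shift N (W : {vspace 'rV[R]_N}) w (F : 'rV[R]_N -> \bar R) :
  w \in W -> measurable_fun setT F -> (forall x, 0 <= F x)%E ->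
  (\int[leb_on W]_x F (x + w)%R = \int[leb_on W]_x F x)%E.
Proof.
rewrite mem_onb => /submxP[c ->] mF F0.
rewrite (integral_leb_on (is_onb_onb W) mF F0).
rewrite (@integral_leb_on _ _ W _ (fun x => F (x + c *m onb W))%R (is_onb_onb W)); [|by meas|by []].
rewrite -[RHS](integral_leb_shift c); [|by meas|by []].
by under eq_integral do rewrite -mulmxDl.
Qed.

End orthonormal_bases.

Section one_dimensional_powers.
Local Open Scope ereal_scope.
Context {R : realType}.
Let mu := @lebesgue_measure R.

Lemma integral_pow_tail_closed (k a : R) : (1 < k)%R -> (0 < a)%R ->
  \int[mu]_(x in `]0%R, +oo[) (x `^ (- k) * (a <= x)%R%:R)%:E =
  (a `^ (1 - k) / (k - 1))%:E.
Proof.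
move=> k1 a0; rewrite -integral_pow_tail// integral_itv_obnd_cbnd; last first.
  by apply: measurable_funTS; meas.
rewrite integral_mkcond [RHS]integral_mkcond; apply: eq_integral => s _.
rewrite !patchE !mem_setE !in_itv/= !andbT.
have [xs|xs] := leP a s; first by rewrite (lt_le_trans a0 xs) mulr1.
by rewrite mulr0; case: ifP.
Qed.

(** Inversion x -> 1/x turns the head into a tail with exponent 2 - k. *)
Lemma integral_pow_head (k a : R) : (k < 1)%R -> (0 < a)%R ->
  \int[mu]_(x in `]0%R, +oo[) (x `^ (- k) * (x <= a)%R%:R)%:E =
  (a `^ (1 - k) / (1 - k))%:E.
Proof.
move=> k1 a0; rewrite integral_inversion; [|by meas|by move=> x x0; pos].
transitivity (\int[mu]_(x in `]0%R, +oo[) (x `^ (- (2 - k)) * (a^-1 <= x)%R%:R)%:E).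
  apply: eq_integral => x; rewrite inE/= in_itv/= andbT => x0.
  rewrite -EFinM; congr EFin; rewrite mulrAC; congr (_ * _%:R)%R; last first.
    by congr nat_of_bool; rewrite -[in RHS]lef_pV2 ?posrE ?invr_gt0// invrK.
  rewrite -powR_invn; last exact: ltW.
  rewrite -{1}(powR_inv1 (ltW x0)) -powRrM -powRD; last by rewrite (gt_eqF x0) implybT.
  by congr (_ `^ _)%R; lra.
rewrite integral_pow_tail_closed; [|lra|by rewrite invr_gt0].
congr EFin; rewrite -powR_inv1; last exact: ltW.
by rewrite -powRrM; congr (_ `^ _ / _)%R; lra.
Qed.

Lemma integral_line_split (F : measurableTypeR R -> \bar R) :
  measurable_fun setT F -> (forall x, 0 <= F x) ->
  \int[mu]_x F x = \int[mu]_(x in `]0%R, +oo[) (F x + F (- x)%R).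
Proof.
move=> mF F0.
have mF' : measurable_fun setT (fun x : measurableTypeR R => F (- x)%R) by meas.
rewrite ge0_integralD; [|by []|by []|exact: measurable_funTS|by []|exact: measurable_funTS].
rewrite (integral_itv_obnd_cbnd (f := F)); last exact: measurable_funTS.
rewrite (integral_itv_obnd_cbnd (f := fun x => F (- x)%R)); last exact: measurable_funTS.
have -> : \int[mu]_(x in `[0%R, +oo[) F (- x)%R = \int[mu]_(x in `]-oo, 0%R[) F x.
  rewrite integral_itv_bndo_bndc; last exact: measurable_funTS.
  rewrite (ge0_integration_by_substitution0 mF'); last by [].
  by apply: eq_integral => x _; rewrite opprK.
rewrite -ge0_integral_setU; [|by []|by []|exact: measurable_funTS|by []|].
  congr (integral _ _ _); apply/seteqP; split => // x _ /=.
  by rewrite !in_itv/= andbT; case: (leP 0%R x) => _; [left|right].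
apply/disj_setPS => x /= []; rewrite !in_itv/= andbT => x0.
by rewrite ltNge x0.
Qed.

End one_dimensional_powers.

Section polar_coordinates.
Local Open Scope ereal_scope.
Context {R : realType}.
Let mu := @lebesgue_measure R.

(** The origin is negligible, because on the half-lines of [integral_line_split] the first
    coordinate is already nonzero. *)
Lemma integral_leb_neq0 n (F : 'rV[R]_n.+1 -> \bar R) :
  measurable_fun setT F -> (forall x, 0 <= F x) ->
  \int[leb n.+1]_x F x = \int[leb n.+1]_x (F x * (0 < enorm x)%R%:R%:E).
Proof.
move=> mF F0; rewrite [in LHS]integral_leb_cons; [|by []|by []].
rewrite [in RHS]integral_leb_cons; [|by meas|by move=> x; pos].
rewrite !integral_line_split; [|by apply: measurable_fun_integral2; [by []|meas|by move=> *; pos]|by move=> x; apply: integral_ge0 => *; pos|by apply: measurable_fun_integral2; [by []|meas|by move=> *; pos]|by move=> x; apply: integral_ge0 => *; pos].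
apply: eq_integral => s; rewrite inE/= in_itv/= andbT => s0.
have E (t : R) : (t != 0)%R -> \int[leb n]_v F (cons_rV (t, v)) =
    \int[leb n]_v (F (cons_rV (t, v)) * (0 < enorm (cons_rV (t, v)))%R%:R%:E).
  move=> t0; apply: eq_integral => v _.
  rewrite /enorm sqrtr_gt0 dot_cons (_ : (0 < _)%R) ?mule1//.
  by rewrite ltr_pwDl ?dot_ge0// -expr2 lt0r sqrf_eq0 t0 sqr_ge0.
by rewrite -!E// ?oppr_eq0 gt_eqF.
Qed.

Lemma leb_unit_ball n : \int[leb n.+1]_x ((0 < enorm x <= 1)%R%:R)%:E = ball_volume n.+1 :> \bar R.
Proof.
rewrite /ball_volume [in RHS]integral_leb_neq0; [|by meas|by move=> x; pos].
apply: eq_integral => x _; rewrite -EFinM enorm_le1.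
by case: (_ < _)%R; case: (_ <= _)%R; rewrite /= ?mulr0 ?mulr1.
Qed.

(** Polar coordinates by Tonelli. Writing 1 as (n+1) |x|^(n+1) times the integral of s^(-n-2) over s
    >= |x| adds a variable s; the scaling x = s b confines b to the unit ball, and rescaling s by
    |b| then gives the same radial integral for every b, which leaves the volume of the ball. *)
Lemma integral_leb_radial n (F : measurableTypeR R -> \bar R) :
  measurable_fun setT F -> (forall x, 0 <= F x) ->
  \int[leb n.+1]_x F (enorm x) =
  n.+1%:R%:E * ball_volume n.+1 *
  \int[mu]_(r in `]0%R, +oo[) (F r * (r ^+ n)%:E).
Proof.
move=> mF F0; pose I := \int[mu]_(r in `]0%R, +oo[) (F r * (r ^+ n)%:E); rewrite -/I.
have I0 : 0 <= I.
  by apply: integral_ge0 => r; rewrite /= in_itv/= andbT => r0; pos.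
rewrite integral_leb_neq0; [|by meas|by []].
pose K (x : 'rV[R]_n.+1) (s : measurableTypeR R) : \bar R :=
  F (enorm x) * (n.+1%:R * enorm x ^+ n.+1 * (0 < enorm x)%R%:R *
                 (s `^ (- (n.+2%:R)) * (enorm x <= s)%R%:R))%:E.
have mK : measurable_fun setT (fun p => K p.1 p.2) by rewrite /K; meas.
have K0 x s : 0 <= K x s by rewrite /K; pos.
transitivity (\int[leb n.+1]_x \int[mu]_(s in `]0%R, +oo[) K x s).
  apply: eq_integral => x _; rewrite /K ge0_integralZl; [|by []|by apply: measurable_funTS; meas|by move=> s _; pos|by []].
  congr (_ * _).
  under eq_integral do rewrite EFinM.
  rewrite integral0Zl; [|by pos|by meas|by move=> s s0; pos].
  have [x0|x0] := ltP 0%R (enorm x); last by rewrite mulr0 mul0e.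
  rewrite integral_pow_tail_closed//; last by rewrite ltr1n.
  rewrite -EFinM; congr EFin; rewrite mulr1.
  rewrite (_ : 1 - n.+2%:R = - (n.+1%:R))%R; last by rewrite (natrD _ 1 n.+1); ring.
  rewrite (_ : n.+2%:R - 1 = n.+1%:R)%R; last by rewrite (natrD _ 1 n.+1); ring.
  rewrite powR_invn; last exact: ltW.
  rewrite (_ : true%:R = 1)%R// -invfM [(_ * n.+1%:R)%R]mulrC mulfV//.
  by rewrite mulf_neq0 ?pnatr_eq0// expf_neq0// gt_eqF.
rewrite (@ge0_tonelli R _ _ _ _ (leb n.+1) (@lebesgue_measure R)); [|by []|by []|by []|by move=> *; exact: K0].
pose K' (x : 'rV[R]_n.+1) (s : measurableTypeR R) : \bar R :=
  (F (enorm x * s)%R * ((enorm x * s) ^+ n)%:E) * (enorm x * n.+1%:R * (0 < enorm x <= 1)%R%:R)%:E.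
have mK' : measurable_fun setT (fun p => K' p.1 p.2) by rewrite /K'; meas.
transitivity (\int[mu]_(s in `]0%R, +oo[) \int[leb n.+1]_x K' x s).
  apply: eq_integral => s; rewrite inE/= in_itv/= andbT => s0.
  have mKs : measurable_fun setT (K^~ s).
    exact: (measurableT_comp mK (pair2_measurable s)).
  have := @integral_leb_scale R n.+1 s (K^~ s) s0 mKs (fun x => K0 x s).
  move/(congr1 (fun z => (s ^+ n.+1)%:E * z)).
  rewrite muleA -EFinM mulfV ?mul1e; last by rewrite gt_eqF// exprn_gt0.
  move=> <-; rewrite -integralZl_nneg; [|by pos|by apply: (measurable_fun_comp mKs); meas|by move=> x; exact: K0].
  apply: eq_integral => b _; rewrite /K /K' enormZ ?(ltW s0)// [(s * _)%R]mulrC.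
  rewrite muleCA -muleA -!EFinM; congr (_ * _%:E).
  rewrite pmulr_lgt0//.
  have -> : (enorm b * s <= s)%R = (enorm b <= 1)%R.
    by rewrite -[X in (_ <= X)%R]mul1r ler_pM2r.
  rewrite powR_invn; last exact: ltW.
  case: (ltP 0%R (enorm b)) => _; last by rewrite !(mulr0, mul0r).
  rewrite /= mulr1; case: (_ <= _)%R; last by rewrite !mulr0.
  rewrite !mulr1 !exprMn; rewrite [(s ^+ n.+2)%R]exprS [(s ^+ n.+1)%R]exprS [(enorm b ^+ n.+1)%R]exprS.
  by field; rewrite !gt_eqF// exprn_gt0.
rewrite -(@ge0_tonelli R _ _ _ _ (leb n.+1) (@lebesgue_measure R)); [|by []|by []|by []|]; last first.
  by move=> x s _; rewrite /= in_itv/= andbT => s0; rewrite /K'; have := enorm_ge0 x => ?; pos.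
rewrite -leb_unit_ball muleAC [in RHS]muleC.
rewrite -ge0_integralZr; [|by []|by meas|by move=> x _; rewrite lee_fin|by apply: mule_ge0].
apply: eq_integral => x _; rewrite /K'.
have [x0|x0] := ltP 0%R (enorm x); last first.
  by rewrite /= mul0e integral0_eq// => s _; rewrite mulr0 mule0.
rewrite /=.
under eq_integral do rewrite muleC.
have mG : measurable_fun setT (fun s : measurableTypeR R => F s * (s ^+ n)%:E) by meas.
have G0 s : (0 < s)%R -> 0 <= F s * (s ^+ n)%:E by move=> s0; pos.
rewrite integral0Zl; [|by pos|by meas|by move=> s s0; apply: G0; pos].
rewrite (integral_scale0 x0 mG G0) -/I !muleA -!EFinM; congr (_%:E * _).
by field; exact: lt0r_neq0.
Qed.

Lemma integral_leb_gauss n :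
  \int[leb n]_x (expR (- (dot x x)))%:E = (pi `^ (n%:R / 2))%:E :> \bar R.
Proof.
elim: n => [|n IH].
  by rewrite integral_leb0; [rewrite dot0l oppr0 expR0 mul0r powRr0|meas].
rewrite integral_leb_cons; [|by meas|by move=> x; pos].
transitivity (\int[mu]_s ((gauss_fun s)%:E * (pi `^ (n%:R / 2))%:E)).
  apply: eq_integral => s _; rewrite -IH -integralZl_nneg; [|exact: gauss_fun_ge0|by meas|by move=> x; pos].
  by apply: eq_integral => v _; rewrite dot_cons opprD expRD -EFinM -expr2.
rewrite ge0_integralZr; [|by []|by apply/measurable_EFinP; exact: measurable_gauss_fun|by move=> s _; exact: gauss_fun_ge0|by rewrite lee_fin powR_ge0].
rewrite integralT_gauss -EFinM; congr EFin.
rewrite -powR12_sqrt ?pi_ge0// -powRD; last by rewrite gt_eqF ?implybT// pi_gt0.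
by congr (_ `^ _)%R; rewrite -natr1; field.
Qed.

(** The extended real behind [Gamma]: identities hold for it before finiteness is known, and
    [Gamma_half] then passes to real values. *)
Definition eGamma (z : R) : \bar R :=
  \int[mu]_(s in `]0%R, +oo[) (s `^ (z - 1) * expR (- s))%:E.

Lemma eGamma_ge0 z : 0 <= eGamma z.
Proof. by apply: integral_ge0 => s _; pos. Qed.

Lemma eGamma_sqr z : eGamma z =
  2%:E * \int[mu]_(x in `]0%R, +oo[) (x `^ (2 * z - 1) * expR (- (x ^+ 2)))%:E.
Proof.
rewrite /eGamma integral_sqr; [|by meas|by move=> s s0; pos].
rewrite -integral0Zl; [|by []|by meas|by move=> s s0; pos].
apply: eq_integral => x; rewrite inE/= in_itv/= andbT => x0.
rewrite -!EFinM; congr EFin.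
have E : (x `^ (2 * z - 1) = x `^ (2 * (z - 1)) * x)%R.
  rewrite (_ : 2 * z - 1 = 2 * (z - 1) + 1)%R; last by ring.
  by rewrite powRD ?(gt_eqF x0) ?implybT// powRr1// ltW.
have E2 : ((x ^+ 2) `^ (z - 1) = x `^ (2 * (z - 1)))%R.
  by rewrite -powR_mulrn ?(ltW x0)// -powRrM.
by rewrite E E2; ring.
Qed.

(** The Gaussian integral over R^(n+1), computed as a product and in polar coordinates. *)
Lemma ball_volume_eGamma n :
  n.+1%:R%:E * ball_volume n.+1 * eGamma (n.+1%:R / 2) = (2 * pi `^ (n.+1%:R / 2))%:E.
Proof.
rewrite EFinM -integral_leb_gauss eGamma_sqr.
under [in RHS]eq_integral do rewrite -sqr_enorm.
rewrite (@integral_leb_radial n (fun r => (expR (- (r ^+ 2)))%:E)); [|by meas|by move=> x; pos].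
rewrite muleCA; congr (_ * (_ * _)).
apply: eq_integral => x; rewrite inE/= in_itv/= andbT => x0.
rewrite -EFinM mulrC; congr (_ * _)%:E.
by rewrite mulrCA mulfV// mulr1 -natr1 addrK powR_mulrn// ltW.
Qed.

(** In [ball_volume_eGamma] the product is finite and nonzero while the volume is finite and
    positive, so the Gamma factor can be neither infinite nor zero. *)
Lemma Gamma_half n : eGamma (n.+1%:R / 2) = (Gamma (n.+1%:R / 2))%:E /\
  (0 < Gamma (n.+1%:R / 2 : R))%R.
Proof.
have := ball_volume_eGamma n; have := ball_volume_gt0 (R := R) n.+1.
have := ball_volume_fin (R := R) n.+1.
have := eGamma_ge0 (n.+1%:R / 2).
rewrite -[Gamma _]/(fine (eGamma (n.+1%:R / 2))).
move: (eGamma _) (ball_volume _) => [g| |] [v| |]// g0 _; rewrite lte_fin => v0.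
  rewrite -!EFinM => -[E]; split=> //=; rewrite lt0r; apply/andP; split=> //.
  apply/negP => /eqP g00; move: E; rewrite g00 mulr0 => /esym/eqP.
  by rewrite mulf_eq0 pnatr_eq0/= gt_eqF// powR_gt0// pi_gt0.
by rewrite -EFinM gt0_muley// lte_fin mulr_gt0.
Qed.

End polar_coordinates.

(** * Surface area and polar coordinates *)

Section spheres.
Local Open Scope ereal_scope.
Context {R : realType}.
Let mu := @lebesgue_measure R.

Lemma ge0_integral_mrestr d (T : measurableType d) (m : {measure set T -> \bar R})
    (D : set T) (mD : measurable D) (F : T -> \bar R) :
  measurable_fun setT F -> (forall x, 0 <= F x) ->
  \int[mrestr m mD]_x F x = \int[m]_(x in D) F x.
Proof.
move=> mF F0.
rewrite (@ge0_negligible_integral _ _ _ (mrestr m mD) setT (~` D) F) => //; last 2 first.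
  exact: measurableC.
  by apply: (etrans (y := m (~` D `&` D))); [|rewrite setICl measure0].
rewrite setTD setCK; apply: eq_measure_integral => A mA AD.
by rewrite /= /mrestr setIidl.
Qed.

(* The integral over the unit sphere of R^n, in polar coordinates. *)
Definition sphere_int n (F : 'rV[R]_n -> \bar R) : \bar R :=
  n%:R%:E * \int[leb n]_v (F ((enorm v)^-1 *: v)%R * (0 < enorm v <= 1)%R%:R%:E).

Lemma integral_usphere N m (W : {vspace 'rV[R]_N}) (B : 'M[R]_(m, N))
    (F : 'rV[R]_N -> \bar R) :
  is_onb W B -> measurable_fun setT F -> (forall x, 0 <= F x) ->
  \int[sphere_measure W]_(x in usphere) F x = sphere_int (fun v : 'rV[R]_m => F (v *m B)).
Proof.
move=> WB mF F0.
have mS : measurable (@usphere R N).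
  rewrite (_ : usphere = (fun x => enorm x) @^-1` [set 1%R]); last by apply/seteqP; split.
  rewrite -[X in measurable X]setTI.
  have mN : measurable_fun setT (fun x : 'rV[R]_N => enorm x) by exact: measurable_enorm.
  exact: (mN measurableT).
have mB : measurable [set x : 'rV[R]_N | (0 < enorm x <= 1)%R].
  rewrite (_ : mkset _ = (fun x => enorm x) @^-1` `]0%R, 1%R]); last first.
    by apply/seteqP; split => x; rewrite /= in_itv/=.
  rewrite -[X in measurable X]setTI.
  have mN : measurable_fun setT (fun x : 'rV[R]_N => enorm x) by exact: measurable_enorm.
  exact: (mN measurableT).
have mr : measurable_fun setT (fun x : 'rV[R]_N => (enorm x)^-1 *: x)%R by exact: measurable_radial.
rewrite integral_mkcond.
pose G := F \_ usphere.
have mG : measurable_fun setT G by apply/(measurable_restrictT _ _).1 => //; exact: measurable_funTS.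
have G0 x : 0 <= G x by rewrite /G patchE; case: ifP.
rewrite -/G (ge0_integral_map (m1 := mscale ((\dim W)%:R : R)%:nng%R (mrestr (leb_on W) mB)) mr); [| |by []|by []]; last first.
  move=> A mA; rewrite /= /sphere_measure /mscale/= /mrestr.
  by congr (_ * leb_on W _); apply/seteqP; split => x [].
rewrite ge0_integral_mscale; [|by []|by meas|by []].
rewrite ge0_integral_mrestr; [|by meas|by []].
rewrite /sphere_int (is_onb_dim WB); congr (_ * _).
transitivity (\int[leb_on W]_x (F ((enorm x)^-1 *: x)%R * (0 < enorm x <= 1)%R%:R%:E)).
  rewrite integral_mkcond; apply: eq_integral => x _.
  rewrite patchE mem_setE; case: ifPn => [x1|/negbTE x1]; last first.
    by rewrite [(0 < enorm x <= 1)%R]x1 mule0.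
  rewrite [(0 < enorm x <= 1)%R]x1 mule1 /G patchE mem_set// /usphere/=.
  have /andP[x0 _] := x1.
  by rewrite enormZ ?invr_ge0 ?enorm_ge0// mulVf// gt_eqF.
rewrite (integral_leb_on WB); [|by meas|by move=> x; pos].
have [BB _] := WB.
by apply: eq_integral => v _; rewrite enorm_mulmx_orth// scalemxAl.
Qed.

Lemma sphere_int_orth n (O : 'M[R]_n) (F : 'rV[R]_n -> \bar R) :
  O *m O^T = 1%:M -> measurable_fun setT F -> (forall x, 0 <= F x) ->
  sphere_int (fun v => F (v *m O)) = sphere_int F.
Proof.
move=> OO mF F0; rewrite /sphere_int; congr (_ * _).
rewrite -[RHS](integral_leb_orth OO); [|by meas|by move=> x; pos].
by apply: eq_integral => v _; rewrite enorm_mulmx_orth// scalemxAl.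
Qed.

Lemma sphere_int_cst n : sphere_int (fun _ : 'rV[R]_n.+1 => 1) = n.+1%:R%:E * ball_volume n.+1 :> \bar R.
Proof.
rewrite /sphere_int -leb_unit_ball; congr (_ * _).
by apply: eq_integral => v _; rewrite mul1e.
Qed.

Lemma enorm_cons (s : R) n (v : 'rV[R]_n) :
  enorm (cons_rV (s, v)) = Num.sqrt (s ^+ 2 + dot v v).
Proof. by rewrite /enorm dot_cons -expr2. Qed.

(* Projecting the two open hemispheres of S^n onto the unit ball of R^n. *)
Lemma sphere_int_proj n (F : 'rV[R]_n.+1 -> \bar R) :
  measurable_fun setT F -> (forall x, 0 <= F x) ->
  sphere_int F = \int[leb n]_v
   ((F (cons_rV (Num.sqrt (1 - dot v v), v)) + F (cons_rV (- Num.sqrt (1 - dot v v), v))%R) *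
    ((Num.sqrt (1 - dot v v))^-1 * (enorm v < 1)%R%:R)%:E).
Proof.
move=> mF F0; rewrite /sphere_int.
set J := RHS.
have J0 : 0 <= J.
  by apply: integral_ge0 => v _; pos.
pose S r (v : 'rV[R]_n) (s : R) : \bar R :=
  F (r *: cons_rV (s, v))%R + F (r *: cons_rV (- s, v))%R.
have S0 r v s : 0 <= S r v s by rewrite /S; pos.
have mS : measurable_fun setT (fun p : (measurableTypeR R * 'rV[R]_n) * measurableTypeR R => S p.1.1 p.1.2 p.2).
  rewrite /S; meas.
transitivity (n.+1%:R%:E * \int[leb n]_v \int[mu]_(s in `]0%R, +oo[)
    (S (Num.sqrt (s ^+ 2 + dot v v))^-1%R v s * (s ^+ 2 + dot v v <= 1)%R%:R%:E)).
  apply: (congr1 (mule n.+1%:R%:E)); rewrite integral_leb_cons; [|by meas|by move=> x; pos].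
  rewrite integral_line_split; [|by apply: measurable_fun_integral2; [by []|meas|by move=> *; pos]|by move=> x; apply: integral_ge0 => *; pos].
  rewrite [RHS](@ge0_tonelli R _ _ _ _ (leb n) (@lebesgue_measure R)); [|by []|by []|by rewrite /S; meas|by move=> *; pos].
  apply: eq_integral => s; rewrite inE/= in_itv/= andbT => s0.
  rewrite -ge0_integralD; [|by []|by move=> *; pos|by meas|by move=> *; pos|by meas].
  apply: eq_integral => v _; rewrite !enorm_cons sqrrN /S.
  have v0 := dot_ge0 v.
  have sv0 : (0 < s ^+ 2 + dot v v)%R by rewrite ltr_pwDl// exprn_gt0.
  rewrite sqrtr_gt0 sv0/= -[X in (_ <= X)%R]sqrtr1 ler_sqrt//.
  by rewrite -ge0_muleDl; [|by []|by []].
(* For fixed v the height s is replaced by the radius r = (s^2 + |v|^2)^(1/2). *)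
transitivity (n.+1%:R%:E * \int[leb n]_v \int[mu]_(r in `]0%R, +oo[)
    (S (r^-1)%R v (Num.sqrt (r ^+ 2 - dot v v)) *
     ((r <= 1)%R%:R * (enorm v < r)%R%:R * (r / Num.sqrt (r ^+ 2 - dot v v)))%:E)).
  apply: (congr1 (mule n.+1%:R%:E)); apply: eq_integral => v _.
  rewrite (integral_pythagoras (enorm_ge0 v)); [|by rewrite /S; meas|by move=> *; pos].
  rewrite integral_mkcond [RHS]integral_mkcond; apply: eq_integral => r _.
  rewrite !patchE !mem_setE !in_itv/= !andbT.
  have [vr|vr] := ltP (enorm v) r; last by rewrite mulr0 mul0r mule0 if_same.
  have r0 : (0 < r)%R by rewrite (le_lt_trans _ vr)// enorm_ge0.
  rewrite r0 mulr1 sqr_sqrtr ?sqr_enorm; last first.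
    by rewrite subr_ge0 -sqr_enorm ler_pXn2r ?nnegrE ?enorm_ge0 ?ltW.
  rewrite subrK sqrtr_sqr gtr0_norm// -muleA -EFinM.
  by rewrite expr_le1// ltW.
rewrite (@ge0_tonelli R _ _ _ _ (leb n) (@lebesgue_measure R)); [|by []|by []| |]; last 2 first.
- by rewrite /S; meas.
- by move=> v r _; rewrite /= in_itv/= andbT => r0; pos.
(* Scaling v by r shows that radius r contributes r^n J; integrating r^n over (0,1] cancels the
   factor n + 1. *)
transitivity (n.+1%:R%:E * \int[mu]_(r in `]0%R, +oo[) ((r `^ (- - n%:R) * (r <= 1)%R%:R)%:E * J)).
  apply: (congr1 (mule n.+1%:R%:E)); apply: eq_integral => r; rewrite inE/= in_itv/= andbT => r0.
  rewrite EFinM -muleA opprK powR_mulrn; last exact: ltW.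
  pose K (v : 'rV[R]_n) : \bar R := S (r^-1)%R v (Num.sqrt (r ^+ 2 - dot v v)) *
     ((r <= 1)%R%:R * (enorm v < r)%R%:R * (r / Num.sqrt (r ^+ 2 - dot v v)))%:E.
  have mK : measurable_fun setT K by rewrite /K /S; meas.
  have K0 v : 0 <= K v by rewrite /K; pos.
  have := integral_leb_scale r0 mK K0.
  move/(congr1 (fun z => (r ^+ n)%:E * z)).
  rewrite muleKV; last by rewrite gt_eqF// exprn_gt0.
  move=> <-; apply: (congr1 (mule (r ^+ n)%:E)).
  rewrite /J -integralZl_nneg; [|by pos|by meas|by move=> v; pos].
  apply: eq_integral => v _; rewrite /K enormZ ?(ltW r0)// dotZl dotZr.
  rewrite -[X in (_ < X)%R]mulr1 ltr_pM2l//.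
  have -> : (r ^+ 2 - r * (r * dot v v) = r ^+ 2 * (1 - dot v v))%R by ring.
  rewrite sqrtrM ?sqr_ge0// sqrtr_sqr gtr0_norm// /S.
  rewrite -mulrN !cons_rVZ !mulrA !mulVf ?gt_eqF// !mul1r scalerA mulVf ?gt_eqF// scale1r.
  rewrite muleCA -EFinM; congr (_ * _%:E).
  rewrite invfM; set q := (Num.sqrt (1 - dot v v))^-1%R.
  by field; rewrite gt_eqF.
rewrite ge0_integralZr; [|by []|by apply: measurable_funTS; meas|by move=> r _; pos|by []].
have n1 : (- n%:R < 1 :> R)%R by rewrite (@le_lt_trans _ _ 0%R)// oppr_le0.
rewrite (integral_pow_head n1 ltr01).
by rewrite powR1 muleA -EFinM div1r opprK nat1r mulfV ?mul1e// pnatr_eq0.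
Qed.

End spheres.

(** * Beta integrals *)

Section beta_integral.
Local Open Scope ereal_scope.
Context {R : realType}.
Let mu := @lebesgue_measure R.
Implicit Types a b s t : R.

(** The upper limit 1 is an indicator on the half-line, so that the scaling and Tonelli lemmas for
    the half-line apply. *)
Definition eBeta a b : \bar R :=
  \int[mu]_(x in `]0%R, +oo[) (x `^ (a - 1) * (1 - x) `^ (b - 1) * (x < 1)%R%:R)%:E.

Lemma eBeta_ge0 a b : 0 <= eBeta a b.
Proof. by apply: integral_ge0 => x _; pos. Qed.

Lemma eBeta_scale a b (L : R) : (0 < L)%R ->
  \int[mu]_(x in `]0%R, +oo[) (x `^ (a - 1) * (L - x) `^ (b - 1) * (x < L)%R%:R)%:E =
  (L `^ (a + b - 1))%:E * eBeta a b.
Proof.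
move=> L0.
pose F (x : measurableTypeR R) : \bar R :=
  (x `^ (a - 1) * (L - x) `^ (b - 1) * (x < L)%R%:R)%:E.
have mF : measurable_fun setT F by rewrite /F; meas.
have F0 x : (0 < x)%R -> 0 <= F x by move=> x0; rewrite /F; pos.
have := integral_scale0 L0 mF F0; move/(congr1 (fun z => L%:E * z)).
rewrite muleA -EFinM mulfV ?gt_eqF// mul1e => <-.
rewrite /eBeta -!integral0Zl; [|by pos|by meas|by move=> x x0; pos|by exact: ltW|by meas|by move=> x x0; apply: F0; pos].
apply: eq_integral => x; rewrite inE/= in_itv/= andbT => x0.
rewrite /F -!EFinM; congr EFin.
rewrite -[X in (_ < X)%R]mulr1 ltr_pM2l//.
case: (ltP x 1%R) => x1; last by rewrite !mulr0.
rewrite (_ : L - L * x = L * (1 - x))%R; last by ring.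
rewrite !powRM ?(ltW L0) ?(ltW x0) ?subr_ge0 ?(ltW x1)//.
rewrite (_ : a + b - 1 = (a - 1) + (b - 1) + 1)%R; last by ring.
by rewrite gt0_powRD1// (gt0_powRD (a - 1) (b - 1) L0); ring.
Qed.

(** Euler's argument: in the double integral put z = x + y, and integrate over 0 < x < z first. *)
Lemma eGammaM a b : eGamma a * eGamma b = eBeta a b * eGamma (a + b).
Proof.
rewrite {1}/eGamma -ge0_integralZr; [|by []|by apply: measurable_funTS; meas|by move=> *; pos|exact: eGamma_ge0].
pose K (x z : measurableTypeR R) : \bar R :=
  (x `^ (a - 1) * (z - x) `^ (b - 1) * (x < z)%R%:R * expR (- z))%:E.
transitivity (\int[mu]_(x in `]0%R, +oo[) \int[mu]_(z in `]0%R, +oo[) K x z).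
  apply: eq_integral => x; rewrite inE/= in_itv/= andbT => x0.
  rewrite /eGamma -integral0Zl; [|by pos|by meas|by move=> z z0; pos].
  rewrite -(integral_shift0 x); [|by meas|by move=> z z0; pos].
  rewrite integral_mkcond [RHS]integral_mkcond; apply: eq_integral => z _.
  rewrite !patchE !mem_setE !in_itv/= !andbT /K.
  have [xz|xz] := ltP x z; last by rewrite mulr0 mul0r if_same.
  rewrite (lt_trans x0 xz) mulr1 -EFinM; congr EFin.
  rewrite mulrACA -expRD (_ : - x + - (z - x) = - z)%R; last by ring.
  by [].
rewrite (@ge0_tonelli R _ _ _ _ (@lebesgue_measure R) (@lebesgue_measure R)); [|by []|by []|by rewrite /K; meas|by move=> *; rewrite /K; pos].
rewrite /eGamma -ge0_integralZl; [|by []|by apply: measurable_funTS; meas|by move=> *; pos|exact: eBeta_ge0].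
apply: eq_integral => z; rewrite inE/= in_itv/= andbT => z0.
rewrite EFinM muleCA muleA -eBeta_scale//.
rewrite -ge0_integralZr; [|by []|by apply: measurable_funTS; meas|by move=> *; pos|by pos].
by apply: eq_integral => x _; rewrite /K EFinM.
Qed.

Lemma eGamma1 : eGamma 1 = 1 :> \bar R.
Proof.
rewrite /eGamma.
transitivity (\int[mu]_(x in `]0%R, +oo[) (expR (- x))%:E).
  by apply: eq_integral => x _; rewrite subrr powRr0 mul1r.
rewrite integral_itv_obnd_cbnd; last by apply: measurable_funTS; meas.
rewrite -(@integral_exponential_pdf R 1 ltr01) integral_mkcond.
apply: eq_integral => x _; rewrite /exponential_pdf !patchE.
by case: ifP => // _; rewrite mul1r mulN1r.
Qed.

Lemma eBeta_n1 m : eBeta m.+1%:R 1 = (m.+1%:R^-1)%:E.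
Proof.
rewrite /eBeta.
transitivity (\int[mu]_(x in `]0%R, +oo[) (x `^ (- - m%:R) * (x <= 1)%R%:R)%:E).
  transitivity (\int[mu]_(x in `]0%R, 1%R[) (x ^+ m)%:E).
    rewrite integral_mkcond [RHS]integral_mkcond; apply: eq_integral => x _.
    rewrite !patchE !mem_setE !in_itv/= !andbT.
    case: (ltP 0%R x) => //= x0; case: ifP => _; rewrite ?mulr0//.
    by rewrite subrr powRr0 !mulr1 -natr1 addrK powR_mulrn// ltW.
  rewrite integral_itv_bndo_bndc; last by apply: measurable_funTS; meas.
  rewrite integral_mkcond [RHS]integral_mkcond; apply: eq_integral => x _.
  rewrite !patchE !mem_setE !in_itv/= !andbT.
  case: (ltP 0%R x) => //= x0; case: ifP => _; rewrite ?mulr0//.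
  by rewrite opprK mulr1 powR_mulrn// ltW.
rewrite (integral_pow_head (k := - m%:R)); [|by rewrite (@le_lt_trans _ _ 0%R)// oppr_le0|by []].
by rewrite powR1 opprK div1r addrC natr1.
Qed.

Lemma eGamma_nat m : eGamma m.+1%:R = (m`!%:R)%:E :> \bar R.
Proof.
elim: m => [|m IH]; first by rewrite eGamma1.
have := eGammaM m.+1%:R 1; rewrite IH eGamma1 mule1 eBeta_n1 natr1 => /(congr1 (fun z => m.+1%:R%:E * z)).
rewrite muleKV ?pnatr_eq0// => <-.
by rewrite -EFinM -natrM factS.
Qed.

(* The substitution w = v^(-1/2) turns the left-hand side into a Beta integral. *)
Lemma radial_kernel a b t s : (0 < t)%R -> (t < s)%R ->
  \int[mu]_(w in `]0%R, +oo[)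
    (w `^ (1 - 2 * (a + b)) * (w ^+ 2 - t ^+ 2) `^ (b - 1) *
     (s ^+ 2 - w ^+ 2) `^ (a - 1) * (t < w < s)%R%:R)%:E =
  (2^-1 * t `^ (- (2 * a)) * s `^ (- (2 * b)) * (s ^+ 2 - t ^+ 2) `^ (a + b - 1))%:E *
    eBeta a b.
Proof.
move=> t0 ts; have s0 := lt_trans t0 ts.
set T := (t ^+ 2)%R; set S := (s ^+ 2)%R.
have T0 : (0 < T)%R by rewrite exprn_gt0.
have S0 : (0 < S)%R by rewrite exprn_gt0.
have TS : (T < S)%R by rewrite ltr_pXn2r ?nnegrE ?(ltW t0) ?(ltW s0).
have TE : T = (t ^+ 2)%R by [].
have SE : S = (s ^+ 2)%R by [].
clearbody T S.
pose g (u : measurableTypeR R) : \bar R :=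
  (2^-1 * (u `^ (- (a + b)) * (u - T) `^ (b - 1) * (S - u) `^ (a - 1) * (T < u < S)%R%:R))%:E.
have mg : measurable_fun setT g by rewrite /g; meas.
have g0 x : (0 < x)%R -> 0 <= g x by move=> x0; rewrite /g; pos.
transitivity (\int[mu]_(u in `]0%R, +oo[) g u).
  rewrite [RHS]integral_sqr//; apply: eq_integral => w; rewrite inE/= in_itv/= andbT => w0.
  rewrite /g -EFinM; congr EFin.
  have -> : (T < w ^+ 2 < S)%R = (t < w < s)%R.
    by rewrite TE SE !ltr_pXn2r ?nnegrE ?(ltW t0) ?(ltW s0) ?(ltW w0).
  rewrite sqr_powR// (_ : 1 - 2 * (a + b) = 2 * (- (a + b)) + 1)%R; last by ring.
  by rewrite gt0_powRD1//; field.
rewrite integral_inversion//.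
have L0 : (0 < T^-1 - S^-1)%R by rewrite subr_gt0 ltf_pV2.
pose h (v : measurableTypeR R) : \bar R :=
  (2^-1 * T `^ (b - 1) * S `^ (a - 1))%:E *
  (v `^ (a - 1) * (T^-1 - S^-1 - v) `^ (b - 1) * (v < T^-1 - S^-1)%R%:R)%:E.
have mh : measurable_fun setT h by rewrite /h; meas.
have h0 x : (0 < x)%R -> 0 <= h x by move=> x0; rewrite /h; pos.
transitivity (\int[mu]_(v in `]S^-1%R, +oo[) h (v - S^-1)%R).
  rewrite integral_mkcond [RHS]integral_mkcond; apply: eq_integral => v _.
  rewrite !patchE !mem_setE !in_itv/= !andbT.
  have Si0 : (0 < S^-1)%R by rewrite invr_gt0.
  have [v0|v0] := ltP 0%R v; last first.
    by rewrite ltNge (le_trans v0) ?(ltW Si0).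
  rewrite /g /h -!EFinM ltrD2r.
  have -> : (T < v^-1)%R = (v < T^-1)%R by rewrite -[in RHS]ltf_pV2 ?posrE ?invr_gt0// invrK.
  have -> : (v^-1 < S)%R = (S^-1 < v)%R by rewrite -[in RHS]ltf_pV2 ?posrE ?invr_gt0// invrK.
  have [Sv|Sv] := ltP (S^-1)%R v; last by rewrite andbF !(mulr0, mul0r).
  rewrite andbT; case: (ltP v (T^-1)%R) => vT; last by rewrite !(mulr0, mul0r).
  congr EFin; rewrite !mulr1.
  rewrite (_ : v^-1 - T = v^-1 * (T * (T^-1 - S^-1 - (v - S^-1))))%R; last first.
    by field; rewrite !gt_eqF.
  rewrite (_ : S - v^-1 = v^-1 * (S * (v - S^-1)))%R; last first.
    by field; rewrite !gt_eqF.
  have vS0 : (0 <= v - S^-1)%R by rewrite subr_ge0 ltW.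
  have Tv0 : (0 <= T^-1 - S^-1 - (v - S^-1))%R by rewrite opprB addrA subrK subr_ge0 ltW.
  have vi0 : (0 <= v^-1)%R by rewrite invr_ge0 ltW.
  rewrite !powRM ?mulr_ge0 ?(ltW T0) ?(ltW S0)//.
  have -> : (v ^- 2 = v `^ (- 2))%R by rewrite powR_invn ?(ltW v0).
  rewrite !inv_powR// opprK.
  (* The powers of v, including v^(-2) from the inversion, have total exponent zero; this is why the
     kernel carries the weight w^(1 - 2(a + b)). *)
  have E : (v `^ (a + b) * v `^ (- (b - 1)) * v `^ (- (a - 1)) * v `^ (- 2) = 1)%R.
    by rewrite -!gt0_powRD// (_ : _ + _ = 0)%R ?powRr0//; ring.
  set p := (T^-1 - S^-1 - (v - S^-1))%R; set q := (v - S^-1)%R.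
  by rewrite -[RHS]mulr1 -[X in _ = (_ * X)%R]E; ring.
rewrite (integral_shift0 _ mh h0) integral0Zl; [|by pos|by meas|by move=> x x0; pos].
rewrite eBeta_scale// muleA -EFinM; congr (_%:E * _).
rewrite (_ : T^-1 - S^-1 = (S - T) * (T^-1 * S^-1))%R; last by field; rewrite !gt_eqF.
rewrite !powRM ?subr_ge0 ?invr_ge0 ?mulr_ge0 ?invr_ge0 ?(ltW T0) ?(ltW S0) ?(ltW TS)//.
rewrite !inv_powR//.
have -> : (t `^ (- (2 * a)) = T `^ (b - 1) * T `^ (- (a + b - 1)))%R.
  by rewrite -gt0_powRD// ?TE ?SE sqr_powR//; congr (_ `^ _)%R; ring.
have -> : (s `^ (- (2 * b)) = S `^ (a - 1) * S `^ (- (a + b - 1)))%R.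
  by rewrite -gt0_powRD// ?TE ?SE sqr_powR//; congr (_ `^ _)%R; ring.
ring.
Qed.

End beta_integral.

(** * Inversion of fractional integrals *)

Section signed_fubini.
Context {R : realType}.

(** Partial integrals in Fubini's theorem may be infinite on a null set; there [fine] puts 0, which
    affects neither integrability nor the integral. *)
Lemma integrable_fine d (T : measurableType d) (m : {measure set T -> \bar R})
    (F : T -> \bar R) : m.-integrable setT F ->
  m.-integrable setT (EFin \o (fine \o F)) /\
  (\int[m]_x (fine (F x))%:E = \int[m]_x F x)%E.
Proof.
move=> iF; have mF := measurable_int m iF.
have mfF : measurable_fun setT (EFin \o (fine \o F)).
  by apply/measurable_EFinP; exact: measurable_fun_fine.
have aeF : ae_eq m setT (EFin \o (fine \o F)) F.
  by apply: filterS (integrable_ae measurableT iF) => x /[apply] /= ?; rewrite fineK.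
split; last exact: ae_eq_integral.
apply/integrableP; split => //; have /integrableP[_] := iF; apply: le_lt_trans.
rewrite le_eqVlt; apply/orP; left; apply/eqP; apply: ge0_ae_eq_integral => //.
- exact: measurable_fun_abse.
- exact: measurable_fun_abse.
by apply: filterS aeF => x /(_ I) E _; apply: (congr1 abse); exact: E.
Qed.

Lemma Rintegral_fubini d1 d2 (T1 : measurableType d1) (T2 : measurableType d2)
    (m1 : {sigma_finite_measure set T1 -> \bar R})
    (m2 : {sigma_finite_measure set T2 -> \bar R})
    (D1 : set T1) (D2 : set T2) (F : T1 -> T2 -> R) :
  measurable D1 -> measurable D2 ->
  measurable_fun setT (fun p => F p.1 p.2) ->
  (\int[m1]_(x in D1) \int[m2]_(y in D2) `|F x y|%:E < +oo)%E ->
  [/\ m1.-integrable D1 (EFin \o (fun x => \int[m2]_(y in D2) F x y)),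
      m2.-integrable D2 (EFin \o (fun y => \int[m1]_(x in D1) F x y)) &
      \int[m1]_(x in D1) \int[m2]_(y in D2) F x y =
      \int[m2]_(y in D2) \int[m1]_(x in D1) F x y].
Proof.
move=> mD1 mD2 mF Foo.
pose G := (EFin \o (fun p => F p.1 p.2)) \_ (D1 `*` D2).
have mG : measurable_fun setT G.
  apply/(measurable_restrictT _ _).1; first exact: measurableX.
  by apply: measurable_funTS; apply: measurable_fun_EFin.
have GE x y : G (x, y) = if (x \in D1) && (y \in D2) then (F x y)%:E else 0%E.
  by rewrite /G patchE in_setX.
have iG : (m1 \x m2)%E.-integrable setT G.
  apply/(integrable12ltyP _ _ mG).
  rewrite [X in (X < _)%E](_ : _ = \int[m1]_(x in D1) \int[m2]_(y in D2) `|F x y|%:E)%E//.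
  rewrite [RHS]integral_mkcond; apply: eq_integral => x _; rewrite patchE.
  under eq_integral do rewrite GE; case: ifPn => xD /=.
    rewrite [RHS]integral_mkcond; apply: eq_integral => y _; rewrite patchE.
    by case: ifP => _; rewrite ?abse0.
  by rewrite integral0_eq// => y _; rewrite /= normr0.
have [i1 E1] := integrable_fine (integrable_fubini_F iG).
have iG2 : m2.-integrable setT (fubini_G m1 G).
  apply/integrableP; split; first exact: (measurable_fubini_G iG).
  have /(integrable21ltyP _ _ mG) := iG; apply: le_lt_trans.
  apply: ge0_le_integral => //.
  - by apply: measurable_fun_abse; exact: (measurable_fubini_G iG).
  - have mG' : measurable_fun setT (fun p : T2 * T1 => `|G (p.2, p.1)|%E).
      by apply: measurable_fun_abse; apply: (measurable_fun_comp mG); meas.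
    exact: (measurable_fun_integral2 m1 (F := fun y x => `|G (x, y)|%E)).
  - move=> y _; apply: le_abse_integral => //.
    exact: (measurableT_comp mG (pair2_measurable y)).
have [i2 E2] := integrable_fine iG2.
have F1 : (fine \o fubini_F m2 G) = (fun x => \int[m2]_(y in D2) F x y) \_ D1.
  apply/funext => x /=; rewrite /fubini_F patchE.
  under eq_integral do rewrite GE; case: ifPn => xD /=; last by rewrite integral0.
  rewrite /Rintegral [in RHS]integral_mkcond; apply: (congr1 fine).
  by apply: eq_integral => y _; rewrite patchE.
have F2 : (fine \o fubini_G m1 G) = (fun y => \int[m1]_(x in D1) F x y) \_ D2.
  apply/funext => y /=; rewrite /fubini_G patchE.
  under eq_integral do rewrite GE andbC; case: ifPn => xD /=; last by rewrite integral0.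
  rewrite /Rintegral [in RHS]integral_mkcond; apply: (congr1 fine).
  by apply: eq_integral => x _; rewrite patchE.
split.
- apply/(integrable_mkcond _ _).2 => //; rewrite restrict_EFin.
  by rewrite -F1.
- apply/(integrable_mkcond _ _).2 => //; rewrite restrict_EFin.
  by rewrite -F2.
rewrite [LHS]Rintegral_mkcond [RHS]Rintegral_mkcond -F1 -F2 /Rintegral /=.
by rewrite E1 E2; congr fine; exact: (Fubini iG).
Qed.

End signed_fubini.

Section tail_integrals.
Context {R : realType}.
Let mu := @lebesgue_measure R.

(** Near t the tail is a constant minus an integral over a compact interval, to which continuity and
    the fundamental theorem of calculus apply. The left end b lies halfway between a and t. *)
Lemma tail_integral_near (a : R) (g : R -> R) (t : R) : a < t ->
  mu.-integrable `]a, +oo[ (EFin \o g) ->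
  let b := (a + t) / 2 in let u := t + 1 in
  [/\ b < t, t < u, mu.-integrable `[b, u] (EFin \o g) &
   \forall x \near t, \int[mu]_(s in `]x, +oo[) g s =
     \int[mu]_(s in `[b, +oo[) g s - \int[mu]_(s in `[b, x]) g s].
Proof.
move=> at0 ig b u.
have ab : a < b by rewrite /b; lra.
have bt : b < t by rewrite /b; lra.
have ib : mu.-integrable `[b, +oo[ (EFin \o g).
  apply: integrableS ig => //; apply: subset_itvr; by rewrite bnd_simp.
split => //; first by rewrite /u; lra.
  by apply: integrableS ib => //; exact: subset_itvl.
near=> x.
rewrite -(@Rintegral_itvB _ _ (BLeft b) +oo%O x)//; rewrite bnd_simp.
by apply/ltW; near: x; exact: lt_nbhsr.
Unshelve. all: by end_near. Qed.

Lemma tail_integral_continuous (a : R) (g : R -> R) (t : R) : a < t ->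
  mu.-integrable `]a, +oo[ (EFin \o g) ->
  {for t, continuous (fun x => \int[mu]_(s in `]x, +oo[) g s)}.
Proof.
move=> at0 ig; have [bt tu iu nE] := tail_integral_near at0 ig.
have bu := ltW (lt_trans bt tu).
have := parameterized_integral_continuous bu iu.
move/(continuous_within_itvP _ (lt_trans bt tu)) => [/(_ t) + _ _].
rewrite in_itv/= bt tu => /(_ isT) ct.
have cE : {for t, continuous (fun x => \int[mu]_(s in `[(a + t) / 2, +oo[) g s -
    \int[mu]_(s in `[(a + t) / 2, x]) g s)}.
  by apply: continuousB; [exact: cst_continuous|exact: ct].
have E0 := nbhs_singleton nE.
have {}cE : (\int[mu]_(s in `[(a + t) / 2, +oo[) g s -
    \int[mu]_(s in `[(a + t) / 2, x]) g s) @[x --> t] --> \int[mu]_(s in `]t, +oo[) g s.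
  by rewrite E0; exact: cE.
suff : \int[mu]_(s in `]x, +oo[) g s @[x --> t] --> \int[mu]_(s in `]t, +oo[) g s by [].
apply: cvg_trans cE; apply: near_eq_cvg.
by apply: filterS nE => x ->.
Qed.

Lemma tail_integral_derive (a : R) (g : R -> R) (t : R) : a < t ->
  mu.-integrable `]a, +oo[ (EFin \o g) -> {for t, continuous g} ->
  is_derive t 1 (fun x => \int[mu]_(s in `]x, +oo[) g s) (- g t).
Proof.
move=> at0 ig cg; have [bt tu iu nE] := tail_integral_near at0 ig.
have [dF F'] := continuous_FTC1_closed tu iu bt cg.
set I := \int[mu]_(s in `[_, +oo[) g s in nE.
have nE' : \forall x \near t, (cst I - (fun x => \int[mu]_(s in `[(a + t) / 2, x]) g s)) x =
    \int[mu]_(s in `]x, +oo[) g s.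
  by apply: filterS nE => x ->.
have dB : is_derive t 1 (cst I - (fun x => \int[mu]_(s in `[(a + t) / 2, x]) g s)) (0 - g t).
  apply: is_deriveB; apply: DeriveDef; first exact: dF.
  by rewrite -derive1E.
rewrite sub0r in dB.
have [dBd dBE] := dB.
apply: DeriveDef; first exact: near_eq_derivable nE' dBd.
by rewrite -(near_eq_derive _ nE').
Qed.

Lemma negD_ext (f g : R -> R) : (forall s, 0 < s -> f s = g s) ->
  forall t, 0 < t -> negD f t = negD g t.
Proof.
move=> fg t t0; rewrite /negD !derive1E; congr (- (_ / _)).
apply: near_eq_derive => //; near=> s; apply: fg.
by near: s; exact: lt_nbhsr.
Unshelve. all: by end_near. Qed.

Lemma iter_negD_ext k (f g : R -> R) : (forall s, 0 < s -> f s = g s) ->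
  forall t, 0 < t -> iter k (@negD R) f t = iter k (@negD R) g t.
Proof. by elim: k => // k IH fg t t0 /=; apply: negD_ext => // s s0; exact: IH. Qed.

End tail_integrals.

Section kernel_composition.
Context {R : realType}.
Let mu := @lebesgue_measure R.

Lemma integrable_mul_bounded d (T : measurableType d) (m : {measure set T -> \bar R})
    (D : set T) (f v : T -> R) (M : R) : measurable D ->
  measurable_fun setT f -> measurable_fun setT v ->
  (forall x, D x -> f x != 0 -> `|v x| <= M) ->
  m.-integrable D (EFin \o f) -> m.-integrable D (EFin \o (fun x => f x * v x)).
Proof.
move=> mD mf mv vM fi.
apply: (le_integrable mD _ _ (integrableZl mD M fi)).
  by apply: measurable_funTS; apply: measurable_fun_EFin; meas.
move=> x Dx; rewrite /= lee_fin normrM.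
have [->|f0] := eqVneq (f x) 0; first by rewrite normr0 mul0r.
rewrite normrM mulrC ler_wpM2r// (le_trans (vM x Dx f0))// ler_norm//.
Qed.

(** A power is monotone in one direction or the other, so the sum of the end values is a bound for
    either sign of p. *)
Lemma powR_le_ends (lo hi y p : R) : 0 < lo -> lo <= y -> y <= hi ->
  y `^ p <= lo `^ p + hi `^ p.
Proof.
move=> lo0 loy yhi; have y0 := lt_le_trans lo0 loy; have hi0 := lt_le_trans y0 yhi.
have [p0|p0] := leP 0 p.
  rewrite ler_wpDl ?powR_ge0//; apply: ge0_ler_powR => //; rewrite nnegrE ltW//.
have q0 : 0 <= - p by rewrite oppr_ge0 ltW.
have E z : 0 < z -> z `^ p = z^-1 `^ (- p) by move=> z0; rewrite inv_powR// opprK.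
rewrite ler_wpDr ?powR_ge0// E// (E lo)//.
apply: ge0_ler_powR => //; rewrite ?nnegrE ?invr_ge0 ?(ltW lo0) ?(ltW y0)//.
by rewrite lef_pV2 ?posrE.
Qed.

Lemma Rintegral_tail_indic (s w : R) (G : R -> R) : s <= w ->
  \int[mu]_(x in `]w, +oo[) G x = \int[mu]_(x in `]s, +oo[) (G x * (w < x)%R%:R).
Proof.
move=> sw; rewrite [LHS]Rintegral_mkcond [RHS]Rintegral_mkcond.
apply: eq_Rintegral => x _; rewrite !patchE !mem_setE !in_itv/= !andbT.
have [wx|wx] := ltP w x; last by rewrite mulr0 if_same.
by rewrite (le_lt_trans sw wx) mulr1.
Qed.

(** Since K is nonnegative, the absolute double integral is that of |A| kappa, so the hypothesis on
    A kappa is exactly absolute convergence. *)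
Lemma fubini_kernel (s : R) (A : R -> R) (K : R -> R -> R) (kappa : R -> R) :
  measurable_fun setT (A : measurableTypeR R -> measurableTypeR R) ->
  measurable_fun setT (fun p : measurableTypeR R * measurableTypeR R => K p.1 p.2) ->
  (forall r x, s < r -> s < x -> 0 <= K r x) ->
  (forall x, s < x -> (\int[mu]_(r in `]s, +oo[) (K r x)%:E = (kappa x)%:E)%E) ->
  mu.-integrable `]s, +oo[ (EFin \o (fun x => A x * kappa x)) ->
  mu.-integrable `]s, +oo[ (EFin \o (fun r => \int[mu]_(x in `]s, +oo[) (A x * K r x))) /\
  \int[mu]_(r in `]s, +oo[) \int[mu]_(x in `]s, +oo[) (A x * K r x) =
  \int[mu]_(x in `]s, +oo[) (A x * kappa x).
Proof.
move=> mA mK K0 KE iAk.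
have Dx x : (`]s, +oo[%classic x) = (s < x) by rewrite /= in_itv/= andbT.
have mKx x : measurable_fun setT (fun r : measurableTypeR R => K r x).
  by apply: (measurable_fun_compr mK (h := fun r => (r, x))); apply/measurable_fun_pairP; split; meas.
have k0 x : s < x -> 0 <= kappa x.
  move=> sx; rewrite -lee_fin -KE//; apply: integral_ge0 => r; rewrite Dx => sr.
  by rewrite lee_fin K0.
have iK x : s < x -> mu.-integrable `]s, +oo[ (EFin \o (K ^~ x)).
  move=> sx; apply/integrableP; split.
    by apply: measurable_funTS; apply: measurable_fun_EFin; exact: mKx.
  rewrite (_ : (\int[mu]_(_ in _) _)%E = (kappa x)%:E) ?ltry// -KE//.
  apply: eq_integral => r; rewrite inE Dx => sr /=; rewrite ger0_norm//; exact: K0.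
have [] := @Rintegral_fubini R _ _ _ _ mu mu `]s, +oo[ `]s, +oo[ (fun r x => A x * K r x).
- exact: measurable_itv.
- exact: measurable_itv.
- by apply: measurable_fun_mul => //; apply: (measurable_fun_compr mA); meas.
- rewrite (@ge0_tonelli R _ _ _ _ mu mu _ _ (fun r x => `|A x * K r x|%:E)).
  + have /integrableP[_] := iAk; apply: le_lt_trans.
    rewrite le_eqVlt; apply/orP; left; apply/eqP.
    apply: eq_integral => x; rewrite inE Dx => sx.
    transitivity (\int[mu]_(r in `]s, +oo[) (`|A x|%:E * (K r x)%:E))%E.
      apply: eq_integral => r; rewrite inE Dx => sr.
      by rewrite normrM (ger0_norm (K0 _ _ sr sx)) EFinM.
    rewrite ge0_integralZl_EFin//.
    * by rewrite KE// /= normrM (ger0_norm (k0 _ sx)) EFinM.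
    * by move=> r; rewrite Dx => sr; rewrite lee_fin K0.
    * by apply: measurable_funTS; apply: measurable_fun_EFin; exact: mKx.
  + exact: measurable_itv.
  + exact: measurable_itv.
  + apply: measurable_fun_EFin; apply: measurable_fun_norm; apply: measurable_fun_mul => //.
    by apply: (measurable_fun_compr mA); meas.
  + by move=> *; rewrite lee_fin.
move=> i1 _ ->; split=> //.
apply: eq_Rintegral => x; rewrite inE Dx => sx.
rewrite RintegralZl//; last exact: iK.
by congr (_ * _); rewrite /Rintegral KE.
Qed.

Lemma integral_tail_pow (j : nat) (s x : R) : 0 < s -> s < x ->
  (\int[mu]_(r in `]s, +oo[) (2 * r * (x ^+ 2 - r ^+ 2) ^+ j * (r < x)%R%:R)%:E =
   ((x ^+ 2 - s ^+ 2) ^+ j.+1 / j.+1%:R)%:E)%E.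
Proof.
move=> s0 sx; have x0 := lt_trans s0 sx.
have s2 : 0 < s ^+ 2 by rewrite exprn_gt0.
have L0 : 0 < x ^+ 2 - s ^+ 2 by rewrite subr_gt0 ltr_pXn2r ?nnegrE ?(ltW s0) ?(ltW x0).
pose G (v : measurableTypeR R) : \bar R :=
  ((x ^+ 2 - s ^+ 2 - v) ^+ j * (v < x ^+ 2 - s ^+ 2)%R%:R)%:E.
have mG : measurable_fun setT G by rewrite /G; meas.
have G0 v : (0 <= G v)%E.
  rewrite /G lee_fin; case: (ltP v (x ^+ 2 - s ^+ 2)) => h; last by rewrite mulr0.
  by rewrite mulr1 exprn_ge0// subr_ge0 ltW.
pose F (u : measurableTypeR R) : \bar R := (G (u - s ^+ 2)%R * ((s ^+ 2 < u)%R%:R)%:E)%E.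
have mF : measurable_fun setT F by rewrite /F /G; meas.
have F0 u : (0 <= F u)%E by rewrite /F mule_ge0// lee_fin.
transitivity (\int[mu]_(u in `]0%R, +oo[) F u)%E.
  rewrite [RHS]integral_sqr// [LHS]integral_mkcond [RHS]integral_mkcond.
  apply: eq_integral => r _; rewrite !patchE !mem_setE !in_itv/= !andbT.
  have [r0|r0] := ltP 0 r; last by rewrite ifN// -leNgt (le_trans r0)// ltW.
  rewrite /F /G ltr_pXn2r ?nnegrE ?(ltW s0) ?(ltW r0)//.
  have [sr|sr] := ltP s r; last by rewrite mule0 mul0e.
  rewrite mule1 -EFinM; congr EFin.
  rewrite ltrD2r ltr_pXn2r ?nnegrE ?(ltW x0) ?(ltW r0)//.
  by rewrite (_ : x ^+ 2 - s ^+ 2 - (r ^+ 2 - s ^+ 2) = x ^+ 2 - r ^+ 2); [ring|ring].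
transitivity (\int[mu]_(u in `](s ^+ 2)%R, +oo[) G (u - s ^+ 2)%R)%E.
  rewrite [LHS]integral_mkcond [RHS]integral_mkcond.
  apply: eq_integral => u _; rewrite !patchE !mem_setE !in_itv/= !andbT /F.
  have [su|su] := ltP (s ^+ 2) u; first by rewrite (lt_trans s2 su) mule1.
  by rewrite mule0 if_same.
rewrite integral_shift0//.
transitivity (\int[mu]_(v in `]0%R, +oo[) (v `^ (1 - 1) *
   (x ^+ 2 - s ^+ 2 - v) `^ (j.+1%:R - 1) * (v < x ^+ 2 - s ^+ 2)%R%:R)%:E)%E.
  apply: eq_integral => v; rewrite inE gt0_itvP => v0; rewrite /G subrr powRr0 mul1r.
  rewrite -natr1 addrK; case: (ltP v (x ^+ 2 - s ^+ 2)) => h; last by rewrite !mulr0.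
  by rewrite powR_mulrn// subr_ge0 ltW.
rewrite eBeta_scale// /eBeta.
transitivity (((x ^+ 2 - s ^+ 2) ^+ j.+1)%:E * \int[mu]_(v in `]0%R, +oo[) (v `^ (1 - 1) *
   (1 - v) `^ (j.+1%:R - 1) * (v < 1)%R%:R)%:E)%E.
  have PE : (x ^+ 2 - s ^+ 2) `^ (1 + j.+1%:R - 1) = (x ^+ 2 - s ^+ 2) ^+ j.+1.
    by rewrite addrAC subrr add0r powR_mulrn// ltW.
  by apply: (congr1 (fun z : R => z%:E * _)%E PE).
have := @eGammaM R 1 j.+1%:R; rewrite eGamma1 mul1e eGamma_nat.
rewrite addrC natr1 eGamma_nat /eBeta => E.
have f0 : (j.+1)`!%:R != 0 :> R by rewrite pnatr_eq0 -lt0n fact_gt0.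
move: E; set B := integral _ _ _ => E.
have -> : B = (j.+1%:R^-1)%:E.
  have fV : ((j.+1)`!%:R^-1)^-1 = (j.+1)`!%:R :> R by rewrite invrK.
  rewrite -(@muleKV R ((j.+1)`!%:R^-1) B) ?invr_eq0// fV [X in (_ * X)%E]muleC -E.
  rewrite -EFinM factS natrM; congr EFin; field.
  by rewrite nat1r !pnatr_eq0 -!lt0n fact_gt0.
by rewrite -EFinM.
Qed.

End kernel_composition.

Section frac_D_inversion.
Context {R : realType}.
Let mu := @lebesgue_measure R.
Variables (phi : R -> R) (T : R).
Hypothesis mphi : measurable_fun setT (phi : measurableTypeR R -> measurableTypeR R).
Hypothesis phi0 : forall s, T <= s -> phi s = 0.

(** The kernel is taken from the smaller base point w/2: for w < s < T it is then bounded away from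
    0 and can be divided out, and phi vanishes from T on. *)
Lemma tail_integrable (p : R) :
  (forall w : R, 0 < w -> (\int[mu]_(s in `]w, +oo[)
     (`|phi s| * (s ^+ 2 - w ^+ 2) `^ p * s)%:E < +oo)%E) ->
  forall w : R, 0 < w -> mu.-integrable `]w, +oo[ (EFin \o phi).
Proof.
move=> iphi w w0.
have h0 : 0 < w / 2 by rewrite divr_gt0.
have hw : w / 2 < w by rewrite gtr_pMr// invf_lt1 ?ltr1n.
have lo0 : 0 < w ^+ 2 - (w / 2) ^+ 2 by rewrite subr_gt0 ltr_pXn2r ?nnegrE ?(ltW w0) ?(ltW h0).
pose W s := (s ^+ 2 - (w / 2) ^+ 2) `^ p * s.
pose V s := (s ^+ 2 - (w / 2) ^+ 2) `^ (- p) * s^-1.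
have mW : measurable_fun setT (W : measurableTypeR R -> measurableTypeR R) by rewrite /W; meas.
have mV : measurable_fun setT (V : measurableTypeR R -> measurableTypeR R) by rewrite /V; meas.
have mpW : measurable_fun setT (fun s : measurableTypeR R => phi s * W s) by exact: measurable_fun_mul.
have iW : mu.-integrable `]w, +oo[ (EFin \o (fun s => phi s * W s)).
  apply: (@integrableS _ _ R mu `](w / 2), +oo[%classic `]w, +oo[%classic) => //.
    by apply: subset_itvr; rewrite bnd_simp ltW.
  apply/integrableP; split.
    by apply: measurable_funTS; apply: measurable_fun_EFin; exact: mpW.
  apply: le_lt_trans (iphi _ h0); rewrite le_eqVlt; apply/orP; left; apply/eqP.
  apply: eq_integral => s; rewrite inE/= in_itv/= andbT => ws.
  rewrite /= /W !normrM (ger0_norm (powR_ge0 _ _)) mulrA.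
  by rewrite [`|s|]gtr0_norm ?(lt_trans h0 ws).
have := @integrable_mul_bounded R _ _ mu `]w, +oo[ (fun s => phi s * W s) V
  (((w ^+ 2 - (w / 2) ^+ 2) `^ (- p) + (T ^+ 2) `^ (- p)) / w) _ mpW mV _ iW.
move=> H; apply: eq_integrable (H _ _) => //.
- move=> s; rewrite inE/= in_itv/= andbT => ws; rewrite /V /W.
  have s0 := lt_trans w0 ws.
  have d0 : 0 < s ^+ 2 - (w / 2) ^+ 2.
    by rewrite subr_gt0 ltr_pXn2r ?nnegrE ?(ltW s0) ?(ltW h0)// (lt_trans hw).
  have := powR_gt0 p d0; rewrite powRN; set X := _ `^ p => X0.
  by congr EFin; field; rewrite !gt_eqF.
- move=> s; rewrite /= in_itv/= andbT => ws nz.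
  have s0 := lt_trans w0 ws.
  have sT : s < T by rewrite ltNge; apply: contraNN nz => /phi0 ->; rewrite mul0r.
  rewrite /V normrM (ger0_norm (powR_ge0 _ _)) gtr0_norm ?invr_gt0//.
  apply: ler_pM; rewrite ?powR_ge0 ?invr_ge0 ?(ltW s0)//.
    apply: powR_le_ends => //.
      by rewrite lerD2r ler_pXn2r ?nnegrE ?(ltW s0) ?(ltW w0) ?(ltW ws).
    rewrite lerBlDr (@le_trans _ _ (T ^+ 2))// ?ler_wpDr ?sqr_ge0//.
    by rewrite ler_pXn2r ?nnegrE ?(ltW s0) ?(ltW sT)// ltW// (lt_trans s0).
  by rewrite lef_pV2 ?posrE// ltW.
Qed.

Hypothesis iphi : forall w : R, 0 < w -> mu.-integrable `]w, +oo[ (EFin \o phi).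

Lemma weighted_tail_integrable (w : R) (v : R -> R) (M : R) : 0 < w ->
  measurable_fun setT (v : measurableTypeR R -> measurableTypeR R) ->
  (forall s, w < s -> s < T -> `|v s| <= M) ->
  mu.-integrable `]w, +oo[ (EFin \o (fun s => phi s * v s)).
Proof.
move=> w0 mv vM; apply: (@integrable_mul_bounded _ _ _ _ _ _ _ M) => //; last exact: iphi.
move=> s; rewrite /= in_itv/= andbT => ws nz; apply: vM => //.
by rewrite ltNge; apply: contraNN nz => /phi0 ->.
Qed.

(* The iterated tail integrals of chi, chi s = phi s * s^(-q), with respect to 2 s ds. *)
Definition tail_iter (q : R) (j : nat) (t : R) : R :=
  \int[mu]_(s in `]t, +oo[) (phi s * (2 / j`!%:R * s `^ (- q) * s * (s ^+ 2 - t ^+ 2) ^+ j)).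

Lemma tail_iter_bound q j w t s : 0 < w -> 0 <= t -> w < s -> t <= s -> s < T ->
  `|2 / j`!%:R * s `^ (- q) * s * (s ^+ 2 - t ^+ 2) ^+ j| <=
  2 / j`!%:R * (w `^ (- q) + T `^ (- q)) * T * (T ^+ 2) ^+ j.
Proof.
move=> w0 t0 ws ts sT; have s0 := lt_trans w0 ws.
have T0 := lt_trans s0 sT.
have d0 : 0 <= s ^+ 2 - t ^+ 2 by rewrite subr_ge0 ler_pXn2r ?nnegrE// ltW.
rewrite ger0_norm; last first.
  by rewrite !mulr_ge0 ?invr_ge0 ?ler0n ?powR_ge0 ?exprn_ge0// ltW.
rewrite ler_pM ?mulr_ge0 ?invr_ge0 ?ler0n ?powR_ge0 ?exprn_ge0 ?(ltW s0)//.
  rewrite ler_pM ?mulr_ge0 ?invr_ge0 ?ler0n ?powR_ge0 ?exprn_ge0 ?(ltW s0) ?(ltW sT)//.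
  rewrite ler_wpM2l ?mulr_ge0 ?invr_ge0 ?ler0n//.
  by apply: powR_le_ends => //; exact: ltW.
apply: lerXn2r; rewrite ?nnegrE ?sqr_ge0//.
rewrite lerBlDr ler_wpDr ?sqr_ge0// ler_pXn2r ?nnegrE ?(ltW s0) ?(ltW T0) ?(ltW sT)//.
Qed.

Lemma tail_iter_integrable q j (w : R) : 0 < w ->
  mu.-integrable `]w, +oo[ (EFin \o
    (fun s => phi s * (2 / j`!%:R * s `^ (- q) * s * (s ^+ 2 - w ^+ 2) ^+ j))).
Proof.
move=> w0; apply: (weighted_tail_integrable w0 (M := 2 / j`!%:R * (w `^ (- q) + T `^ (- q)) * T * (T ^+ 2) ^+ j)).
  by meas.
by move=> s ws sT; apply: tail_iter_bound => //; exact: ltW.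
Qed.

(** Cauchy's formula for repeated integration with respect to 2 r dr: Fubini, and then the inner
    integral is [integral_tail_pow]. *)
Lemma tail_iterS q j (w : R) : 0 < w ->
  mu.-integrable `]w, +oo[ (EFin \o (fun r => 2 * r * tail_iter q j r)) /\
  tail_iter q j.+1 w = \int[mu]_(r in `]w, +oo[) (2 * r * tail_iter q j r).
Proof.
move=> w0.
pose A (x : R) := phi x * (2 / j`!%:R * x `^ (- q) * x).
pose K (r x : R) : R := 2 * r * (x ^+ 2 - r ^+ 2) ^+ j * (r < x)%R%:R.
pose kappa (x : R) := (x ^+ 2 - w ^+ 2) ^+ j.+1 / j.+1%:R.
have mA : measurable_fun setT (A : measurableTypeR R -> measurableTypeR R).
  by rewrite /A; meas.
have mK : measurable_fun setT (fun p : measurableTypeR R * measurableTypeR R => K p.1 p.2).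
  by rewrite /K; meas.
have E x : A x * kappa x = phi x * (2 / (j.+1)`!%:R * x `^ (- q) * x * (x ^+ 2 - w ^+ 2) ^+ j.+1).
  rewrite /A /kappa factS natrM; field.
  by rewrite nat1r !pnatr_eq0 -!lt0n fact_gt0.
have [] := @fubini_kernel R w A K kappa mA mK.
- move=> r x wr wx; rewrite /K; case: (ltP r x) => rx; last by rewrite mulr0.
  have r0 := lt_trans w0 wr; have x0 := lt_trans w0 wx.
  rewrite mulr1 !mulr_ge0 ?(ltW r0)// exprn_ge0//.
  by rewrite subr_ge0 ler_pXn2r ?nnegrE ?(ltW r0) ?(ltW x0) ?(ltW rx).
- by move=> x wx; rewrite -integral_tail_pow.
- by apply: eq_integrable (tail_iter_integrable q j.+1 w0) => // x _ /=; rewrite E.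
have E2 r : w < r -> \int[mu]_(x in `]w, +oo[) (A x * K r x) = 2 * r * tail_iter q j r.
  move=> wr; have r0 := lt_trans w0 wr.
  rewrite /tail_iter -RintegralZl//; last exact: tail_iter_integrable.
  rewrite (Rintegral_tail_indic _ (ltW wr)); apply: eq_Rintegral => x _.
  by rewrite /A /K; ring.
move=> i1 E3; split.
  by apply: eq_integrable i1 => // r; rewrite inE/= in_itv/= andbT => wr; rewrite E2.
rewrite /tail_iter; under eq_Rintegral do rewrite -E.
by rewrite -E3; apply: eq_Rintegral => r; rewrite inE/= in_itv/= andbT => wr; rewrite E2.
Qed.

Lemma tail_iter0E q t : tail_iter q 0 t = \int[mu]_(s in `]t, +oo[) (2 * s * (phi s * s `^ (- q))).
Proof. by apply: eq_Rintegral => s _; rewrite expr0 fact0; field. Qed.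

Lemma tail_iter0_integrable q w : 0 < w ->
  mu.-integrable `]w, +oo[ (EFin \o (fun s => 2 * s * (phi s * s `^ (- q)))).
Proof.
move=> w0; apply: eq_integrable (tail_iter_integrable q 0 w0) => // s _ /=.
by rewrite expr0 fact0; congr EFin; field.
Qed.

Lemma tail_iter_continuous q j (t : R) : 0 < t -> {for t, continuous (tail_iter q j)}.
Proof.
move=> t0; have h0 : 0 < t / 2 by rewrite divr_gt0.
have ht : t / 2 < t by rewrite gtr_pMr// invf_lt1 ?ltr1n.
case: j => [|j].
  have := tail_integral_continuous ht (tail_iter0_integrable q h0).
  by rewrite (_ : tail_iter q 0 = fun x => \int[mu]_(s in `]x, +oo[) (2 * s * (phi s * s `^ (- q))))//;
    apply/funext => x; exact: tail_iter0E.
have [ij _] := tail_iterS q j h0.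
have := tail_integral_continuous ht ij.
rewrite /prop_for /continuous_at -(tail_iterS q j t0).2; apply: cvg_trans.
apply: near_eq_cvg; near=> x; rewrite (tail_iterS q j _).2//.
by near: x; exact: lt_nbhsr.
Unshelve. all: by end_near. Qed.

Lemma tail_derive (g : R -> R) (w t : R) : w < t ->
  mu.-integrable `]w, +oo[ (EFin \o (fun r => 2 * r * g r)) -> {for t, continuous g} ->
  is_derive t 1 (fun x => \int[mu]_(r in `]x, +oo[) (2 * r * g r)) (- (2 * t * g t)).
Proof.
move=> wt ig cg; apply: tail_integral_derive wt ig _.
apply: continuousM => //; apply: continuousM; first exact: cst_continuous.
exact: cvg_id.
Qed.

Lemma tail_iter_derive q j (t : R) : 0 < t ->
  is_derive t 1 (tail_iter q j.+1) (- (2 * t * tail_iter q j t)).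
Proof.
move=> t0; have h0 : 0 < t / 2 by rewrite divr_gt0.
have ht : t / 2 < t by rewrite gtr_pMr// invf_lt1 ?ltr1n.
have [dF F'] := tail_derive ht (tail_iterS q j h0).1 (tail_iter_continuous t0).
have nE : \forall x \near t, \int[mu]_(r in `]x, +oo[) (2 * r * tail_iter q j r) = tail_iter q j.+1 x.
  by near=> x; rewrite (tail_iterS q j _).2//; near: x; exact: lt_nbhsr.
apply: DeriveDef; first exact: near_eq_derivable nE dF.
by rewrite -(near_eq_derive _ nE).
Unshelve. all: by end_near. Qed.

Lemma tail_iter0_derive q (t : R) : 0 < t -> {for t, continuous phi} ->
  is_derive t 1 (tail_iter q 0) (- (2 * t * (phi t * t `^ (- q)))).
Proof.
move=> t0 cphi; have h0 : 0 < t / 2 by rewrite divr_gt0.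
have ht : t / 2 < t by rewrite gtr_pMr// invf_lt1 ?ltr1n.
rewrite (_ : tail_iter q 0 = fun x => \int[mu]_(s in `]x, +oo[) (2 * s * (phi s * s `^ (- q))));
  last by apply/funext => x; exact: tail_iter0E.
apply: tail_derive ht (tail_iter0_integrable q h0) _.
by apply: continuousM => //; exact: continuous_powR.
Qed.

Lemma negD_derive (c : R) (h : R -> R) (t b : R) : 0 < t ->
  is_derive t 1 h (- (2 * t * b)) -> negD (fun x => c * h x) t = c * b.
Proof.
move=> t0 dh; have [_ E] := is_deriveZ c dh.
rewrite /negD derive1E (_ : (fun x => c * h x) = c \*: h)// E.
by rewrite scalerN /GRing.scale/=; field; rewrite gt_eqF.
Qed.

(** Each -D lowers j by one at every positive s; only the last derivative, at j = 0, evaluates phi,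
    and so continuity at the single point t suffices. *)
Lemma iter_negD_tail q m (c t : R) : 0 < t -> {for t, continuous phi} ->
  iter m.+1 (@negD R) (fun s => c * tail_iter q m s) t = c * (phi t * t `^ (- q)).
Proof.
move=> t0 cphi; elim: m => [|m IH].
  by apply: negD_derive => //; exact: tail_iter0_derive.
rewrite iterSr -IH; apply: iter_negD_ext => // s s0.
by apply: negD_derive => //; exact: tail_iter_derive.
Qed.

End frac_D_inversion.

Section frac_D_tail.
Context {R : realType}.
Let mu := @lebesgue_measure R.

Lemma radial_kernel_tail (a b s x : R) : 0 < s -> s < x ->
  (\int[mu]_(w in `]s, +oo[) (w `^ (1 - 2 * (a + b)) * (w ^+ 2 - s ^+ 2) `^ (b - 1) *
     (x ^+ 2 - w ^+ 2) `^ (a - 1) * (w < x)%R%:R)%:E =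
  (2^-1 * s `^ (- (2 * a)) * x `^ (- (2 * b)) * (x ^+ 2 - s ^+ 2) `^ (a + b - 1))%:E *
    eBeta a b)%E.
Proof.
move=> s0 sx; rewrite -radial_kernel// [LHS]integral_mkcond [RHS]integral_mkcond.
apply: eq_integral => w _; rewrite !patchE !mem_setE !in_itv/= !andbT.
have [sw|sw] := ltP s w; first by rewrite (lt_trans s0 sw).
by rewrite mulr0; case: ifP.
Qed.

(** With a = d/2 and b = 1 - d/2 + m the sum a + b = m + 1 is an integer. The integral of order b of
    a tail integral of order a is, after Fubini and [radial_kernel], an (m+1)-fold integral, undone
    by m + 1 derivatives. The powers of t in the definition of [frac_D] cancel the factors s^(-2a)
    and t^(-2b) left by the kernel. *)
Lemma frac_D_tail (n : nat) (c t T : R) (phi q : R -> R) :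
  measurable_fun setT (phi : measurableTypeR R -> measurableTypeR R) ->
  (forall s, T <= s -> phi s = 0) ->
  (forall w : R, 0 < w -> (\int[mu]_(s in `]w, +oo[)
     (`|phi s| * (s ^+ 2 - w ^+ 2) `^ (n.+1%:R / 2 - 1) * s)%:E < +oo)%E) ->
  (forall w : R, 0 < w -> q w =
     c * \int[mu]_(s in `]w, +oo[) (phi s * ((s ^+ 2 - w ^+ 2) `^ (n.+1%:R / 2 - 1) * s))) ->
  0 < t -> {for t, continuous phi} ->
  frac_D n.+1 q t = c * Gamma (n.+1%:R / 2) / 2 * phi t.
Proof.
move=> mphi phi0 iphiK qE t0 cphi.
have iphi := tail_integrable mphi phi0 iphiK.
set d := n.+1; set a := d%:R / 2; pose m := d./2; pose b := 1 - a + m%:R.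
have dE : d = (odd d + m.*2)%N by rewrite odd_double_half.
have dR : d%:R = (odd d)%:R + 2 * m%:R :> R by rewrite {1}dE natrD -mul2n natrM.
(* b is 1/2 for odd d and 1 for even d, hence a positive half-integer. *)
have [bG b0] : eGamma b = (Gamma b)%:E /\ 0 < Gamma b.
  have -> : b = (~~ odd d).+1%:R / 2 by rewrite /b /a dR; case: odd => /=; field.
  exact: Gamma_half.
have [aG a0] : eGamma a = (Gamma a)%:E /\ 0 < Gamma a by exact: Gamma_half.
have abE : a + b = m.+1%:R by rewrite /b -natr1; ring.
have abm : a + b - 1 = m%:R by rewrite /b; ring.
pose B := Gamma a * Gamma b / m`!%:R.
have f0 : m`!%:R != 0 :> R by rewrite pnatr_eq0 -lt0n fact_gt0.
have BE : eBeta a b = B%:E.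
  have := @eGammaM R a b; rewrite abE eGamma_nat aG bG muleC [RHS]muleC => E.
  have fV : (m`!%:R^-1)^-1 = m`!%:R :> R by rewrite invrK.
  rewrite -(@muleKV R (m`!%:R^-1) (eBeta a b)) ?invr_eq0// fV -E -!EFinM.
  by congr EFin; rewrite /B; field.
rewrite /frac_D -/m -/a -/b.
(* It suffices to identify the function under the derivatives on s > 0: s^d times the fractional
   integral is a constant multiple of the iterated tail of index m. *)
rewrite (@iter_negD_ext _ _ _ (fun s => c * Gamma a / 2 * tail_iter phi (2 * b) m s)) => [|s s0|//].
  rewrite (iter_negD_tail mphi phi0 iphi)//.
  rewrite (_ : 2 - d%:R + m.*2%:R = 2 * b); last by rewrite /b /a -mul2n natrM; field.
  have := powR_gt0 (2 * b) t0; rewrite powRN; set X := t `^ _ => X0.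
  by field; rewrite gt_eqF.
rewrite /frac_I.
pose A (x : R) := c * (phi x * x).
pose K (w x : R) := w `^ (1 - 2 * (a + b)) * (w ^+ 2 - s ^+ 2) `^ (b - 1) *
     (x ^+ 2 - w ^+ 2) `^ (a - 1) * (w < x)%R%:R.
pose k x := 2^-1 * s `^ (- (2 * a)) * x `^ (- (2 * b)) * (x ^+ 2 - s ^+ 2) `^ (a + b - 1) * B.
pose C := c / 4 * s `^ (- (2 * a)) * B * m`!%:R.
have kE x : s < x -> A x * k x =
    C * (phi x * (2 / m`!%:R * x `^ (- (2 * b)) * x * (x ^+ 2 - s ^+ 2) ^+ m)).
  move=> sx; have x0 := lt_trans s0 sx.
  rewrite /A /k /C abm powR_mulrn; first by field.
  by rewrite subr_ge0 ler_pXn2r ?nnegrE ?(ltW s0) ?(ltW sx) ?(ltW x0).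
have ti := @tail_iter_integrable R phi T mphi phi0 iphi (2 * b) m s s0.
have Dx x : (`]s, +oo[%classic x) = (s < x) by rewrite /= in_itv/= andbT.
have [] := @fubini_kernel R s A K k.
- by rewrite /A; meas.
- by rewrite /K; meas.
- by move=> *; rewrite /K !mulr_ge0 ?powR_ge0.
- by move=> x sx; rewrite /K radial_kernel_tail// BE -EFinM.
- apply: (eq_integrable _ _ _ _ (integrableZl _ C ti)) => // x.
  by rewrite inE Dx => sx /=; rewrite kE.
move=> _ E.
have -> : \int[mu]_(w in `]s, +oo[) (w ^- m.*2.+2 * q w * w * (w ^+ 2 - s ^+ 2) `^ (b - 1)) =
    C * tail_iter phi (2 * b) m s.
  rewrite /tail_iter -RintegralZl//.
  transitivity (\int[mu]_(x in `]s, +oo[) (A x * k x)); last first.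
    by apply: eq_Rintegral => x; rewrite inE Dx => sx; rewrite kE.
  rewrite -E; apply: eq_Rintegral => w; rewrite inE Dx => sw.
  have w0 := lt_trans s0 sw.
  pose P := w `^ (1 - 2 * (a + b)) * (w ^+ 2 - s ^+ 2) `^ (b - 1).
  transitivity (\int[mu]_(x in `]w, +oo[) (P * c * (phi x * ((x ^+ 2 - w ^+ 2) `^ (a - 1) * x)))).
    rewrite RintegralZl//; last first.
      apply/integrableP; split; first by apply: measurable_funTS; apply: measurable_fun_EFin; meas.
      apply: le_lt_trans (iphiK _ w0); rewrite le_eqVlt; apply/orP; left; apply/eqP.
      apply: eq_integral => x; rewrite inE/= in_itv/= andbT => wx.
      rewrite !normrM (ger0_norm (powR_ge0 _ _)) mulrA.
      by rewrite [`|x|]gtr0_norm ?(lt_trans w0 wx).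
    rewrite qE// /P.
    have -> : w `^ (1 - 2 * (a + b)) = w ^- m.*2.+2 * w.
      rewrite abE (_ : 1 - 2 * m.+1%:R = - (m.*2.+2)%:R + 1); last first.
        by rewrite -[m.*2.+2]addn2 -[m.+1]addn1 !natrD -mul2n natrM; ring.
      by rewrite gt0_powRD1// powRN powR_mulrn// ltW.
    by ring.
  rewrite (Rintegral_tail_indic _ (ltW sw)); apply: eq_Rintegral => x _.
  by rewrite /A /K /P; ring.
rewrite /C /B -powR_mulrn ?(ltW s0)//.
rewrite (_ : 2 * a = d%:R); last by rewrite /a; field.
have := powR_gt0 d%:R s0; rewrite powRN; set X := s `^ _ => X0.
by field; rewrite f0 !gt_eqF.
Qed.

End frac_D_tail.

(** * Rotations fixing an axis *)

Section hyperplanes.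
Context {R : realType} {N : nat}.
Implicit Types a x y u w : 'rV[R]_N.

Lemma mem_hyperplane a x : (x \in hyperplane a) = (dot x a == 0).
Proof.
rewrite /hyperplane memv_ker lfunE/= /dot; apply/eqP/eqP => [->|h].
  by rewrite mxE.
by apply/matrixP => i j; rewrite !ord1 h mxE.
Qed.

Definition refl_mx u : 'M[R]_N := 1%:M - (2 / dot u u) *: (u^T *m u).

Lemma refl_mxE u x : x *m refl_mx u = hrefl u x.
Proof.
rewrite /refl_mx /hrefl mulmxBr mulmx1 -scalemxAr mulmxA.
rewrite [x *m u^T]mx11_scalar mul_scalar_mx scalerA.
by congr (_ - _ *: _); rewrite /dot; ring.
Qed.

Lemma trmx_refl u : (refl_mx u)^T = refl_mx u.
Proof. by rewrite /refl_mx raddfB/= trmx1 linearZ/= trmx_mul trmxK. Qed.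

Lemma hreflK u : u != 0 -> involutive (hrefl u).
Proof.
rewrite -dot_eq0 => u0 x; rewrite /hrefl dotBl dotZl -addrA -opprD -scalerDl.
rewrite [X in X *: u](_ : _ = 0) ?scale0r ?subr0//.
by field.
Qed.

Lemma refl_mxK u : u != 0 -> refl_mx u *m (refl_mx u)^T = 1%:M.
Proof.
move=> u0; rewrite trmx_refl; apply/row_matrixP => i.
by rewrite !rowE !mulmxA !refl_mxE hreflK// mulmx1.
Qed.

Lemma hrefl_orth u x : dot x u = 0 -> hrefl u x = x.
Proof. by move=> xu; rewrite /hrefl xu mul0r mulr0 scale0r subr0. Qed.

Lemma hrefl_swap x y : dot x x = dot y y -> x != y -> hrefl (x - y) x = y.
Proof.
move=> xy; rewrite -subr_eq0 -dot_eq0 /hrefl => d0.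
rewrite (_ : 2 * _ = 1) ?scale1r ?subKr//.
move: d0; rewrite !(dotBl, dotBr) (dotC y x) -xy => d0.
by field; apply: contra_neq d0 => <-; ring.
Qed.

Lemma refl_conj u (P : 'M[R]_N) : P *m P^T = 1%:M ->
  P^T *m refl_mx u *m P = refl_mx (u *m P).
Proof.
move=> PP; have PP' : P^T *m P = 1%:M by exact: mulmx1C.
rewrite /refl_mx mulmxBr mulmxBl mulmx1 PP' -scalemxAr -scalemxAl.
by rewrite (dot_mulmx_orth _ _ PP) trmx_mul !mulmxA.
Qed.

Lemma det_orth (P : 'M[R]_N) : P *m P^T = 1%:M -> \det P * \det P = 1.
Proof. by move=> /(congr1 determinant); rewrite det_mulmx det_tr det1. Qed.

(** Reflections are conjugate through the reflection that swaps their unit normals. Their common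
    determinant is not computed; a product of two has its square, which is 1. *)
Lemma det_refl_mx u w : u != 0 -> w != 0 -> \det (refl_mx u) = \det (refl_mx w).
Proof.
move=> u0 w0.
have cu : (enorm u)^-1 != 0 by rewrite invr_eq0 enorm_eq0.
have cw : (enorm w)^-1 != 0 by rewrite invr_eq0 enorm_eq0.
have E c v : c != 0 -> refl_mx (c *: v) = refl_mx v.
  move=> c0; rewrite /refl_mx dotZl dotZr [(c *: v)^T]linearZ/= -scalemxAl -scalemxAr !scalerA.
  congr (_ - _ *: _).
  have [->|v0] := eqVneq (dot v v) 0; first by rewrite !mulr0 invr0 !mulr0 !mul0r.
  by field; rewrite c0 v0.
have dU (v : 'rV[R]_N) : v != 0 -> dot ((enorm v)^-1 *: v) ((enorm v)^-1 *: v) = 1.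
  move=> v0; rewrite dotZl dotZr -sqr_enorm; field.
  by rewrite enorm_eq0.
rewrite -(E _ u cu) -(E _ w cw).
have := dU _ u0; have := dU _ w0; clear cu cw; move: {u w u0 w0}(_ *: u) (_ *: w) => u w w1 u1.
have [->//|uw] := eqVneq u w.
have uw0 : u - w != 0 by rewrite subr_eq0.
have := hrefl_swap (etrans u1 (esym w1)) uw; rewrite -refl_mxE => uwE.
rewrite -[in RHS]uwE -refl_conj ?refl_mxK// !det_mulmx det_tr.
rewrite mulrAC det_orth ?mul1r//; exact: refl_mxK.
Qed.

Lemma SO_perp1 a : SO_perp a (1%:M : 'M[R]_N).
Proof. by split; rewrite ?trmx1 ?mulmx1 ?det1. Qed.

Lemma SO_perpM a g h : SO_perp a g -> SO_perp a h -> SO_perp a (g *m h : 'M[R]_N).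
Proof.
move=> [g1 g2 g3] [h1 h2 h3]; split.
- by rewrite trmx_mul mulmxA -(mulmxA g) h1 mulmx1.
- by rewrite det_mulmx g2 h2 mulr1.
- by rewrite mulmxA g3.
Qed.

Lemma SO_perpV a g : SO_perp a g -> SO_perp a (g^T : 'M[R]_N).
Proof.
move=> [g1 g2 g3]; split; first by rewrite trmxK; exact: mulmx1C.
  by rewrite det_tr.
by rewrite -{1}g3 -mulmxA g1 mulmx1.
Qed.

Lemma SO_perpMr a g h : SO_perp a h -> SO_perp a (g *m h : 'M[R]_N) <-> SO_perp a g.
Proof.
move=> Sh; split => [Sgh|Sg]; last exact: SO_perpM.
have := SO_perpM Sgh (SO_perpV Sh); have [h1 _ _] := Sh.
by rewrite -mulmxA h1 mulmx1.
Qed.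

(* A rotation taking x to y is a product of two reflections; the second one  *)
(* fixes y and needs a further direction in a^perp.                          *)
Lemma SO_perp_trans a x y : (2 < N)%N -> a != 0 ->
  dot x a = 0 -> dot y a = 0 -> dot x x = dot y y -> exists2 g, SO_perp a g & x *m g = y.
Proof.
move=> N2 a0 xa ya xy.
have [->|xNy] := eqVneq x y; first by exists 1%:M; [exact: SO_perp1|rewrite mulmx1].
have [w w0 /andP[/eqP wa /eqP wy]] : exists2 w, w != 0 & (dot w a == 0) && (dot w y == 0).
  pose A : 'M[R]_(N, 1 + 1) := row_mx a^T y^T.
  have : kermx A != 0.
    rewrite kermx_eq0 /row_free neq_ltn; apply/orP; left.
    by rewrite (leq_ltn_trans (rank_leq_col A)).
  case/rowV0Pn => w /sub_kermxP wA w0; exists w => //.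
  move: wA; rewrite /A mul_mx_row => /(congr1 (fun M : 'M[R]_(1, 1 + 1) => (lsubmx M 0 0, rsubmx M 0 0))).
  by rewrite row_mxKl row_mxKr => -[]; rewrite /dot => -> ->; rewrite !mxE !eqxx.
have u0 : x - y != 0 by rewrite subr_eq0.
exists (refl_mx (x - y) *m refl_mx w); last first.
  by rewrite mulmxA !refl_mxE hrefl_swap// hrefl_orth// dotC.
split.
- by rewrite trmx_mul mulmxA -(mulmxA (refl_mx _)) refl_mxK// mulmx1 refl_mxK.
- by rewrite det_mulmx (det_refl_mx u0 w0) det_orth// refl_mxK.
- have au : dot a (x - y) = 0 by rewrite dotC dotBl xa ya subrr.
  by rewrite mulmxA !refl_mxE (hrefl_orth au) hrefl_orth// dotC.
Qed.

End hyperplanes.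

Section matrix_measurability.
Context {R : realType} d (T : measurableType d).

Lemma measurable_fun_det n (f : T -> 'M[R]_n) : measurable_fun setT f ->
  measurable_fun setT (fun x => \det (f x) : measurableTypeR R).
Proof.
move=> mf; rewrite /determinant; apply: measurable_sum => s.
apply: measurable_fun_mul; first exact: measurable_cst.
by apply: measurable_prod => i _; exact: measurable_fun_coord.
Qed.

Lemma measurable_mx_eq m n (f : T -> 'M[R]_(m, n)) M : measurable_fun setT f ->
  measurable [set x | f x = M].
Proof.
move=> mf; pose h x := \sum_i \sum_j `|f x i j - M i j|.
have mh : measurable_fun setT (h : T -> measurableTypeR R).
  apply: measurable_sum => i; apply: measurable_sum => j.
  apply: measurable_fun_norm; apply: measurable_fun_add; last exact: measurable_cst.
  exact: measurable_fun_coord.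
rewrite (_ : mkset _ = h @^-1` [set 0]).
  by rewrite -[X in measurable X]setTI; exact: mh.
apply/seteqP; split => x /=; first by move=> E; rewrite /h E big1// => i _; rewrite big1// => j _; rewrite subrr normr0.
move=> /eqP; rewrite psumr_eq0; last by move=> i _; apply: sumr_ge0.
move=> /allP hx; apply/matrixP => i j; apply/eqP; rewrite -subr_eq0 -normr_eq0.
have := hx i (mem_index_enum i); rewrite psumr_eq0// => /allP /(_ j (mem_index_enum j)).
exact.
Qed.

End matrix_measurability.

Section haar_measure.
Context {R : realType} {N : nat} (a : 'rV[R]_N).
Local Open Scope ereal_scope.

Lemma measurable_SO_perp : measurable (SO_perp a).
Proof.
rewrite (_ : SO_perp a = [set g | g *m g^T = 1%:M] `&` [set g | \det g = 1%R] `&` [set g | a *m g = a]).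
  apply: measurableI; first apply: measurableI.
  - by apply: measurable_mx_eq; meas.
  - have mh : measurable_fun setT (fun g : 'M[R]_N => \det g : measurableTypeR R).
      by apply: measurable_fun_det; meas.
    by rewrite -[X in measurable X]setTI; exact: (mh measurableT [set 1%R]).
  - by apply: measurable_mx_eq; meas.
by apply/seteqP; split => g [] // [].
Qed.

Variable mu : probability 'M[R]_N R.
Hypothesis haar_mu : is_haar a mu.
Implicit Type F : 'M[R]_N -> \bar R.

Let SO := SO_perp a.
Let mSO : measurable SO := measurable_SO_perp.

Lemma integral_SO_cst (c : \bar R) : \int[mu]_(g in SO) c = c.
Proof. transitivity (c * mu (SO_perp a)); first exact: integral_cst.
by rewrite haar_mu.1 mule1. Qed.

Lemma haar_mulr h F : SO h -> measurable_fun setT F -> (forall g, 0 <= F g) ->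
  \int[mu]_(g in SO) F (g *m h)%R = \int[mu]_(g in SO) F g.
Proof.
move=> Sh mF F0; rewrite [LHS]integral_mkcond [RHS]integral_mkcond.
have mr : measurable_fun setT (fun g : 'M[R]_N => (g *m h)%R) by meas.
rewrite [RHS](ge0_integral_map (m1 := mu) mr).
- apply: eq_integral => g _; rewrite !patchE.
  by have -> : (g *m h \in SO) = (g \in SO) by apply/idP/idP; rewrite !inE => /(SO_perpMr _ Sh).
- by move=> A mA; exact: (esym (haar_mu.2 _ Sh _ mA)).
- by apply/(measurable_restrictT _ _).1 => //; exact: measurable_funTS.
- by move=> g; rewrite patchE; case: ifP.
Qed.

(** The double average of F (h g^T) is computed in both orders: over h first, invariance gives the
    mean of F; over g first, replacing g by g h^T shows that it is the mean of F (g^T). *)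
Lemma haar_inv F : measurable_fun setT F -> (forall g, 0 <= F g) ->
  \int[mu]_(g in SO) F g^T = \int[mu]_(g in SO) F g.
Proof.
move=> mF F0.
transitivity (\int[mu]_(g in SO) \int[mu]_(h in SO) F (h *m g^T)%R).
  rewrite (@ge0_tonelli R _ _ _ _ mu mu _ _ (fun g h => F (h *m g^T)%R)); [|by []|by []|by meas|by []].
  transitivity (\int[mu]_(h in SO) \int[mu]_(g in SO) F g^T).
    by rewrite integral_SO_cst.
  apply: eq_integral => h; rewrite inE => Sh.
  rewrite -[LHS](@haar_mulr (h^T)%R (fun g => F (g^T)%R)); [|exact: SO_perpV|by meas|by []].
  by apply: eq_integral => g _; rewrite trmx_mul trmxK.
transitivity (\int[mu]_(g in SO) \int[mu]_(h in SO) F h); last by rewrite integral_SO_cst.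
apply: eq_integral => g; rewrite inE => Sg.
by rewrite haar_mulr//; exact: SO_perpV.
Qed.

Lemma haar_mull h F : SO h -> measurable_fun setT F -> (forall g, 0 <= F g) ->
  \int[mu]_(g in SO) F (h *m g)%R = \int[mu]_(g in SO) F g.
Proof.
move=> Sh mF F0.
rewrite -[LHS](@haar_inv (fun g => F (h *m g)%R)); [|by meas|by []].
rewrite -[RHS]haar_inv//.
rewrite -[RHS](@haar_mulr (h^T)%R (fun g => F (g^T)%R)); [|exact: SO_perpV|by meas|by []].
by apply: eq_integral => g _; rewrite trmx_mul trmxK.
Qed.

Hypotheses (N2 : (2 < N)%N) (a0 : a != 0%R).

(** Some rotation fixing a takes x to y, and left invariance absorbs it. *)
Lemma haar_orbit (F : 'rV[R]_N -> \bar R) x y : measurable_fun setT F -> (forall z, 0 <= F z) ->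
  x \in hyperplane a -> y \in hyperplane a -> enorm x = enorm y ->
  \int[mu]_(g in SO) F (x *m g)%R = \int[mu]_(g in SO) F (y *m g)%R.
Proof.
rewrite !mem_hyperplane => mF F0 /eqP xa /eqP ya xy.
have [h Sh <-] : exists2 h, SO h & (x *m h)%R = y.
  by apply: SO_perp_trans => //; rewrite -!sqr_enorm xy.
rewrite -[LHS](@haar_mull h (fun g => F (x *m g)%R)) => //; last by meas.
by apply: eq_integral => g _; rewrite mulmxA.
Qed.

Lemma is_onb_SO m (B : 'M[R]_(m, N)) g : is_onb (hyperplane a) B -> SO g ->
  exists2 O : 'M[R]_m, O *m O^T = 1%:M & B *m g = O *m B.
Proof.
move=> [BB BH] [g1 g2 g3].
have /submxP[Q QE] : (B *m g <= B)%MS.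
  apply/row_subP => i; rewrite -BH mem_hyperplane row_mul.
  have : row i B \in hyperplane a by rewrite BH row_sub.
  by rewrite mem_hyperplane -{2}g3 dot_mulmx_orth.
exists Q => //.
have : (B *m g) *m (B *m g)^T = 1%:M by rewrite trmx_mul mulmxA -(mulmxA B) g1 mulmx1.
by rewrite QE trmx_mul mulmxA -(mulmxA Q) BB mulmx1.
Qed.

(** Averaging F over rotations and over the sphere at once: the area is rotation invariant, so the
    rotation may be dropped; and by [haar_orbit] every direction gives the same Haar mean, so the
    sphere contributes only its area. *)
Lemma haar_sphere m (B : 'M[R]_(m, N)) (F : 'rV[R]_N -> \bar R) x :
  is_onb (hyperplane a) B -> measurable_fun setT F -> (forall z, 0 <= F z) ->
  x \in hyperplane a -> enorm x = 1%R ->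
  (\int[mu]_(g in SO) F (x *m g)%R) * sphere_int (fun _ : 'rV[R]_m => 1) =
  sphere_int (fun v : 'rV[R]_m => F (v *m B)%R).
Proof.
move=> HB mF F0 xH x1; have [BB BH] := HB.
transitivity (\int[mu]_(g in SO) sphere_int (fun v : 'rV[R]_m => F (v *m B *m g)%R)); last first.
  rewrite -[RHS]integral_SO_cst; apply: eq_integral => g; rewrite inE => Sg.
  have [Q QQ BgE] := is_onb_SO HB Sg.
  rewrite -[RHS](sphere_int_orth QQ) => //; last by meas.
  by rewrite /sphere_int; congr (_ * _); apply: eq_integral => v _; rewrite -mulmxA BgE mulmxA.
transitivity (m%:R%:E * \int[mu]_(g in SO) \int[leb m]_v
    (F ((enorm v)^-1 *: v *m B *m g)%R * ((0 < enorm v <= 1)%R%:R)%:E)); last first.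
  rewrite /sphere_int -ge0_integralZl//.
  - by apply: measurable_funTS; apply: measurable_fun_integral2 => //; [meas|move=> *; pos].
  - by move=> g _; apply: integral_ge0 => v _; pos.
rewrite (@ge0_tonelli R _ _ _ _ mu (leb m) SO setT
  (fun g v => F ((enorm v)^-1 *: v *m B *m g)%R * ((0 < enorm v <= 1)%R%:R)%:E));
  [|by []|by []|by meas|by move=> *; pos].
rewrite /sphere_int muleCA; congr (_ * _).
rewrite -ge0_integralZl//; [|by meas|exact: integral_ge0].
apply: eq_integral => v _; case: (boolP (0 < enorm v <= 1)%R) => v1; last first.
  by rewrite !mule0 integral0_eq// => g _; rewrite mule0.
rewrite !mule1; under [RHS]eq_integral do rewrite mule1.
apply: haar_orbit => //.
  by rewrite BH submxMl.
have /andP[v0 _] := v1.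
by rewrite enorm_mulmx_orth// enormZ ?invr_ge0 ?(ltW v0)// mulVf// gt_eqF.
Qed.

End haar_measure.

Lemma cons_rV_head (R : realType) n (s : measurableTypeR R) (u : 'rV[R]_n) : cons_rV (s, u) 0 0 = s.
Proof. exact: (congr1 fst (cons_rVK (s, u))). Qed.

(** * Zones of a sphere and the arcsine density *)

Section sphere_zones.
Local Open Scope ereal_scope.
Context {R : realType}.
Let mu := @lebesgue_measure R.

Lemma integral_reflect (F : measurableTypeR R -> \bar R) :
  measurable_fun setT F -> (forall x, 0 <= F x) ->
  \int[mu]_x F (- x)%R = \int[mu]_x F x.
Proof.
move=> mF F0; rewrite !integral_line_split//; last by meas.
by apply: eq_integral => x _; rewrite opprK addeC.
Qed.

Lemma orth_trans n (x y : 'rV[R]_n) : dot x x = dot y y ->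
  exists2 Q : 'M[R]_n, Q *m Q^T = 1%:M & (x *m Q)%R = y.
Proof.
move=> xy; have [->|xNy] := eqVneq x y.
  by exists 1%:M; rewrite ?trmx1 mulmx1.
exists (refl_mx (x - y)%R); first by rewrite refl_mxK// subr_eq0.
by rewrite refl_mxE hrefl_swap.
Qed.

(** On S^(n+1) the coordinate z = v.c has density proportional to (1 - z^2)^((n-1)/2). After
    projecting to the ball, the points with given z fill a ball of radius L = (1 - z^2)^(1/2) in
    R^n; rescaling it leaves L^n / L times the area of S^n, which is itself written through its
    projection. *)
Lemma sphere_int_zone n (h : measurableTypeR R -> \bar R) (c : 'rV[R]_n.+2) :
  measurable_fun setT h -> (forall z, 0 <= h z) -> enorm c = 1%R ->
  sphere_int (fun v : 'rV[R]_n.+2 => h (dot v c)) =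
  (\int[mu]_z (h z * (Num.sqrt (1 - z ^+ 2) ^+ n / Num.sqrt (1 - z ^+ 2))%:E)) *
  sphere_int (fun _ : 'rV[R]_n.+1 => 1).
Proof.
move=> mh h0 c1.
(* The axis goes to the second coordinate, because [sphere_int_proj] removes the first one. *)
pose e1 : 'rV[R]_n.+2 := cons_rV (0%R, cons_rV (1%R, 0%R)).
have [Q QQ Qe] : exists2 Q : 'M[R]_n.+2, Q *m Q^T = 1%:M & (e1 *m Q)%R = c.
  by apply: orth_trans; rewrite -(sqr_enorm c) c1 !dot_cons dot0l; ring.
rewrite -(sphere_int_orth QQ); [|by meas|by []].
have -> : (fun v : 'rV[R]_n.+2 => h (dot (v *m Q) c)) = fun v => h (dot v e1).
  by apply/funext => v; rewrite -Qe dot_mulmx_orth.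
rewrite sphere_int_proj; [|by meas|by []].
pose k (s : R) : R := ((Num.sqrt (1 - s))^-1 * (s < 1)%R%:R)%R.
transitivity (\int[leb n.+1]_u (h (u 0 0)%R * (2 * k (dot u u))%:E)).
  apply: eq_integral => u _; have [z [w ->]] := cons_rVP u.
  rewrite cons_rV_head.
  rewrite !dot_cons enorm_lt1 !dot_cons !mulr0 !mulr1 !add0r dot0r addr0.
  rewrite ge0_muleDl// -ge0_muleDr ?lee_fin; [|by pos|by pos]; rewrite -EFinD; congr (_ * _%:E).
  by rewrite /k; ring.
rewrite integral_leb_cons; last 2 first.
- by rewrite /k; meas.
- by move=> u; rewrite mule_ge0// lee_fin /k; pos.
rewrite sphere_int_proj; [|by meas|by []].
rewrite -ge0_integralZr//; last 3 first.
- by meas.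
- by move=> z _; rewrite mule_ge0// lee_fin; pos.
- by apply: integral_ge0 => v _; pos.
apply: eq_integral => z _.
have [z1|z1] := leP 1%R (z ^+ 2)%R.
  rewrite ler0_sqrtr ?subr_le0// invr0 mulr0 mule0 mul0e integral0_eq// => w _.
  rewrite cons_rV_head /k dot_cons -expr2 ltNge (le_trans z1) ?mulr0 ?mule0//.
  by rewrite lerDl dot_ge0.
set L := Num.sqrt _; have L0 : (0 < L)%R by rewrite sqrtr_gt0 subr_gt0.
have LL : (L ^+ 2 = 1 - z ^+ 2)%R by rewrite sqr_sqrtr// subr_ge0 ltW.
pose P (v : 'rV[R]_n) : \bar R := (2 * ((Num.sqrt (1 - dot v v))^-1 * (dot v v < 1)%R%:R))%:E.
have P0 v : 0 <= P v by rewrite /P; pos.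
have mP : measurable_fun setT P by rewrite /P; meas.
rewrite -muleA; under eq_integral do rewrite cons_rV_head.
rewrite ge0_integralZl//; last 2 first.
- by rewrite /k; meas.
- by move=> w _; rewrite lee_fin /k; pos.
congr (_ * _).
transitivity (\int[leb n]_w ((L^-1)%:E * P (L^-1 *: w)%R)).
  apply: eq_integral => w _; rewrite /k /P dot_cons -expr2 -EFinM; congr EFin.
  have -> : (dot (L^-1 *: w) (L^-1 *: w) = dot w w / L ^+ 2)%R.
    by rewrite dotZl dotZr; field; rewrite gt_eqF.
  have -> : (1 - dot w w / L ^+ 2 = (1 - (z ^+ 2 + dot w w)) / L ^+ 2)%R.
    by rewrite LL; field; rewrite subr_eq0 gt_eqF.
  have -> : (dot w w / L ^+ 2 < 1 = (z ^+ 2 + dot w w < 1))%R.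
    by rewrite ltr_pdivrMr ?exprn_gt0// mul1r LL ltrBrDl.
  case: (ltP (z ^+ 2 + dot w w) 1)%R => [zw|]; last by rewrite !mulr0.
  have zw0 : (0 < 1 - (z ^+ 2 + dot w w))%R by rewrite subr_gt0.
  rewrite sqrtrM ?(ltW zw0)// sqrtrV ?sqr_ge0// sqrtr_sqr gtr0_norm//.
  by field; rewrite !gt_eqF// sqrtr_gt0.
rewrite integralZl_nneg ?invr_ge0 ?(ltW L0)//; last by meas.
rewrite integral_leb_scale ?invr_gt0// muleA -EFinM; congr (_%:E * _).
  by rewrite exprVn invrK mulrC.
apply: eq_integral => v _; rewrite /P enorm_lt1 EFinM; congr (_ * _%:E).
Qed.

(** The zone formula on the circle: the integral times the positive measure of S^0 is the length of
    the circle. *)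
Lemma arcsine_lty : \int[mu]_z ((Num.sqrt (1 - z ^+ 2))^-1)%:E < +oo.
Proof.
have h0 : 0 <= \int[mu]_z ((Num.sqrt (1 - z ^+ 2))^-1)%:E by apply: integral_ge0 => z _; pos.
pose c : 'rV[R]_2 := cons_rV (1%R, 0%R).
have c1 : enorm c = 1%R by rewrite enorm_cons dot0l addr0 expr1n sqrtr1.
have := @sphere_int_zone 0 (fun _ => 1) c (measurable_cst _) (fun _ => lee01) c1.
rewrite !sphere_int_cst => E.
rewrite ltey; apply/eqP => I.
have F : ball_volume 2 \is a @fin_num R by exact: ball_volume_fin.
have : 2%:R%:E * ball_volume 2 \is a @fin_num R by rewrite fin_numM.
rewrite E; under eq_integral do rewrite expr0 mul1e div1r.
by rewrite I mul1e gt0_mulye ?ball_volume_gt0.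
Qed.

Lemma le_powRN (x y q : R) : (0 <= q)%R -> (0 < x)%R -> (x <= y)%R -> (y `^ (- q) <= x `^ (- q))%R.
Proof.
move=> q0 x0 xy; have y0 := lt_le_trans x0 xy.
rewrite !powRN lef_pV2 ?posrE ?powR_gt0//.
by apply: ge0_ler_powR; rewrite ?nnegrE ?(ltW x0) ?(ltW y0).
Qed.

(** The two singularities stay apart, uniformly in c. If c - z > delta the first factor is at most
    delta^(-3/4); if c - z <= delta and |z| < 1 then z is at distance at least delta from 1 and -1,
    so the second factor is at most 1/delta. *)
Lemma arcsine_moment (delta : R) : (0 < delta)%R -> exists C : R, forall c : R,
  (2 * delta <= `|c - 1|)%R -> (2 * delta <= `|c + 1|)%R ->
  \int[mu]_z (((c - z) `^ (- (3 / 4)) * (z < c)%R%:R * (Num.sqrt (1 - z ^+ 2))^-1)%:E) <= C%:E.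
Proof.
move=> d0; set A := \int[mu]_z ((Num.sqrt (1 - z ^+ 2))^-1)%:E.
have A0 : 0 <= A by apply: integral_ge0 => z _; pos.
have Af : A = (fine A)%:E by rewrite fineK// ge0_fin_numE// arcsine_lty.
exists (delta `^ (- (3 / 4)) * fine A + delta^-1 * (delta `^ (1 - 3 / 4) / (1 - 3 / 4)))%R => c c1 c2.
pose H (z : measurableTypeR R) : \bar R := (z `^ (- (3 / 4)) * (0 < z)%R%:R * (z <= delta)%R%:R)%:E.
have mH : measurable_fun setT H by rewrite /H; meas.
have H0 z : 0 <= H z by rewrite /H; pos.
have HE : \int[mu]_z H (c - z)%R = (delta `^ (1 - 3 / 4) / (1 - 3 / 4))%:E.
  under eq_integral do rewrite addrC.
  rewrite (@integral_reflect (fun z => H (z + c)%R)); [|by meas|by []].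
  rewrite integral_shift// -integral_pow_head; [|lra|by []].
  rewrite [RHS]integral_mkcond; apply: eq_integral => z _; rewrite patchE mem_setE in_itv/= andbT /H.
  by case: (ltP 0 z)%R => _; rewrite ?mulr0 ?mul0r ?mulr1.
apply: (@le_trans _ _ (\int[mu]_z ((delta `^ (- (3 / 4)))%:E * ((Num.sqrt (1 - z ^+ 2))^-1)%:E + (delta^-1)%:E * H (c - z)%R))).
  apply: ge0_le_integral => //; [by move=> z _; pos|by meas|by meas|].
  move=> z _; rewrite /H -!EFinM -EFinD lee_fin.
  have [zc|zc] := ltP z c; last first.
    by rewrite mulr0 mul0r; pos.
  rewrite mulr1; have cz : (0 < c - z)%R by rewrite subr_gt0.
  rewrite cz mulr1; have [czd|czd] := leP (c - z)%R delta; last first.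
    rewrite mulr0 mulr0 addr0 ler_wpM2r ?invr_ge0 ?sqrtr_ge0//.
    by apply: le_powRN => //; exact: ltW.
  rewrite mulr1; have [z1|z1] := leP 1%R (z ^+ 2)%R.
    rewrite ler0_sqrtr ?subr_le0// invr0 !mulr0 add0r; pos.
  have zz : (`|z| < 1)%R by rewrite -sqrtr_sqr -sqrtr1 ltr_sqrt.
  rewrite ler_wpDl ?mulr_ge0 ?powR_ge0 ?invr_ge0 ?sqrtr_ge0//.
  rewrite mulrC ler_wpM2r ?powR_ge0// lef_pV2 ?posrE ?sqrtr_gt0 ?subr_gt0//.
  rewrite -(ger0_norm (ltW d0)) -sqrtr_sqr ler_wsqrtr//.
  have : (delta <= 1 - z)%R /\ (delta <= 1 + z)%R.
    move: zz c1 c2; rewrite ltr_norml !ler_normr => /andP[? ?] /orP[?|?] /orP[?|?]; split; lra.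
  by move=> [? ?]; nra.
rewrite ge0_integralD//; [|by move=> z _; pos|by meas|by move=> z _; pos|by meas].
rewrite (integralZl_nneg mu (powR_ge0 delta (- (3 / 4)))); [|by meas|by move=> z; pos].
rewrite (@integralZl_nneg _ _ _ mu (delta^-1)%R); [|by rewrite invr_ge0 ltW|by meas|by []].
by rewrite HE -/A [X in _ * X + _]Af -!EFinM -EFinD.
Qed.

End sphere_zones.

(** * Continuous functions on the sphere *)

Section euclidean_topology.
Context {R : realType} {n : nat}.
Implicit Types (x y : 'rV[R]_n).

Lemma cvg_rV (T : Type) (F : set_system T) (h : T -> 'rV[R]_n) x : Filter F ->
  (forall i, h t 0 i @[t --> F] --> x 0 i) -> h t @[t --> F] --> x.
Proof.
move=> FF hx; apply/cvg_ballP => e e0.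
suff : \forall t \near F, forall j : 'I_n, ball (x 0 j) e (h t 0 j).
  by apply: filterS => t ht; split => //= i j; rewrite ord1; exact: ht.
by apply: filter_forall => j; have /cvg_ballP /(_ e e0) := hx j.
Qed.

Lemma cvg_coord (T : Type) (F : set_system T) (h : T -> 'rV[R]_n) x i : Filter F ->
  h t @[t --> F] --> x -> h t 0 i @[t --> F] --> x 0 i.
Proof. move=> FF hx; apply: (@cvg_comp _ _ _ h (fun M : 'rV[R]_n => M 0 i) F (nbhs x) _ hx).
exact: coord_continuous. Qed.

Lemma cvg_dot (T : Type) (F : set_system T) (h k : T -> 'rV[R]_n) x y : Filter F ->
  h t @[t --> F] --> x -> k t @[t --> F] --> y -> dot (h t) (k t) @[t --> F] --> dot x y.
Proof.
move=> FF hx ky; rewrite dotE; under eq_fun do rewrite dotE.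
have H (s : seq 'I_n) :
    \sum_(i <- s) h t 0 i * k t 0 i @[t --> F] --> \sum_(i <- s) x 0 i * y 0 i.
  elim: s => [|i s IH].
    by rewrite big_nil; under eq_fun do rewrite big_nil; exact: cvg_cst.
  rewrite (big_cons _ _ i s); under eq_fun do rewrite (big_cons _ _ i s).
  by apply: cvgD => //; apply: cvgM; exact: cvg_coord.
exact: H.
Qed.

Lemma cvg_enorm (T : Type) (F : set_system T) (h : T -> 'rV[R]_n) x : Filter F ->
  h t @[t --> F] --> x -> enorm (h t) @[t --> F] --> enorm x.
Proof.
move=> FF hx; apply: (cvg_comp (fun t => dot (h t) (h t)) Num.sqrt (cvg_dot FF hx hx)).
exact: sqrt_continuous.
Qed.

Lemma cvg_rVD (T : Type) (F : set_system T) (h k : T -> 'rV[R]_n) x y : Filter F ->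
  h t @[t --> F] --> x -> k t @[t --> F] --> y -> h t + k t @[t --> F] --> x + y.
Proof.
move=> FF hx ky; apply: cvg_rV => i; rewrite mxE; under eq_fun do rewrite mxE.
by apply: cvgD; exact: cvg_coord.
Qed.

Lemma cvg_rVZ (T : Type) (F : set_system T) (c : T -> R) (h : T -> 'rV[R]_n) (l : R) x : Filter F ->
  c t @[t --> F] --> l -> h t @[t --> F] --> x -> c t *: h t @[t --> F] --> l *: x.
Proof.
move=> FF cl hx; apply: cvg_rV => i; rewrite mxE; under eq_fun do rewrite mxE.
by apply: cvgM => //; exact: cvg_coord.
Qed.

Lemma compact_usphere : compact (@usphere R n).
Proof.
apply: bounded_closed_compact.
  exists 1; split => // c c1 x xS; apply: (le_trans _ (ltW c1)).
  change (mx_norm (x : 'rV[R]_n) <= 1).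
  have [->|x0] := eqVneq (mx_norm (x : 'rV[R]_n)) 0; first exact: ler01.
  have [[i j] /= ->] := mx_norm_neq0 x0; rewrite ord1.
  rewrite -xS -sqrtr_sqr ler_wsqrtr// dotE (bigD1 j)//= -expr2 lerDl.
  by apply: sumr_ge0 => k _; rewrite -expr2 sqr_ge0.
rewrite (_ : usphere = @enorm R n @^-1` [set 1]); last by apply/seteqP; split.
apply: closed_comp; last exact: closed_eq.
by move=> x _; apply: (@cvg_enorm _ (nbhs x) id); exact: cvg_id.
Qed.

End euclidean_topology.

Section sphere_extension.
Context {R : realType} {n : nat} (f : 'rV[R]_n -> R).
Hypothesis cf : csphere f.

(** The extension homogeneous of degree 0 turns continuity within the sphere into continuity at
    every nonzero point. *)
Definition sphere_ext (x : 'rV[R]_n) : R := f ((enorm x)^-1 *: x).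

Lemma csphere_bounded : exists C, forall x, x != 0 -> `|sphere_ext x| <= C.
Proof.
have /compact_bounded[M [_ MP]] := continuous_compact cf (@compact_usphere R n).
exists (M + 1) => x x0; apply: MP; first by rewrite ltrDl.
exists ((enorm x)^-1 *: x) => //.
by rewrite /usphere/= enormZ ?invr_ge0 ?enorm_ge0// mulVf// enorm_eq0.
Qed.

Lemma cvg_sphere_ext (T : Type) (F : set_system T) (h : T -> 'rV[R]_n) (x : 'rV[R]_n) : Filter F ->
  x != 0 -> h t @[t --> F] --> x -> sphere_ext (h t) @[t --> F] --> sphere_ext x.
Proof.
move=> FF x0 hx; have nx : enorm x != 0 by rewrite enorm_eq0.
have xS : usphere ((enorm x)^-1 *: x).
  by rewrite /usphere/= enormZ ?invr_ge0 ?enorm_ge0// mulVf.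
have /subspace_continuousP/(_ _ xS) cx := cf.
have ch := cvg_enorm FF hx.
have kx : (enorm (h t))^-1 *: h t @[t --> F] --> (enorm x)^-1 *: x.
  by apply: cvg_rVZ => //; exact: cvgV.
have hn : \forall t \near F, enorm (h t) != 0.
  have n0 : 0 < enorm x by rewrite lt_neqAle eq_sym nx enorm_ge0.
  by apply: filterS (cvgr_gt _ ch _ n0) => t; exact: lt0r_neq0.
move=> U /cx; rewrite /within/= => /kx /= h1.
apply: filterS2 hn h1 => t hn /(_ _) /=; apply.
by rewrite /usphere/= enormZ ?invr_ge0 ?enorm_ge0// mulVf.
Qed.

End sphere_extension.

Section floor_approximation.
Context {R : realType} {n : nat}.

Definition floor_rV (k : nat) (x : 'rV[R]_n) : 'rV[int]_n := \row_i Num.floor (k.+1%:R * x 0 i).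

Definition grid_rV (k : nat) (z : 'rV[int]_n) : 'rV[R]_n := \row_i ((z 0 i)%:~R / k.+1%:R).

Lemma cvg_floor_rV (x : 'rV[R]_n) : grid_rV k (floor_rV k x) @[k --> \oo] --> x.
Proof.
apply: cvg_rV => i; under eq_fun do rewrite !mxE.
apply/cvgrPdist_le => e e0; near=> k.
have k0 : 0 < k.+1%:R :> R by [].
have /andP[h1 h2] := floor_itv (k.+1%:R * x 0 i).
have -> : x 0 i - (Num.floor (k.+1%:R * x 0 i))%:~R / k.+1%:R =
  (k.+1%:R * x 0 i - (Num.floor (k.+1%:R * x 0 i))%:~R) / k.+1%:R by field.
rewrite normrM [X in _ * X]gtr0_norm ?invr_gt0// ger0_norm ?subr_ge0//.
apply: (@le_trans _ _ (k.+1%:R^-1)).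
  rewrite ler_piMl ?invr_ge0//; move: h2; rewrite intrD => h2.
  by rewrite lerBlDl ltW// -mulrz_nat.
near: k.
by apply: filterS (near_infty_natSinv_lt (PosNum e0)) => k /ltW.
Unshelve. all: by end_near. Qed.

Lemma measurable_fun_floor_rV k z : measurable [set x | floor_rV k x = z].
Proof.
pose g (x : 'rV[R]_n) : 'rV[R]_n := \row_i (Num.floor (k.+1%:R * x 0 i))%:~R.
have mg : measurable_fun setT g.
  apply: measurable_mxP => i j; rewrite (_ : (fun x => g x i j) =
      (fun y : measurableTypeR R => (Num.floor (k.+1%:R * y))%:~R : measurableTypeR R) \o (fun x : 'rV[R]_n => x i j : measurableTypeR R)); last first.
    by apply/funext => x /=; rewrite mxE ord1.
  apply: measurableT_comp; last exact: measurable_coord.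
  apply: nondecreasing_measurable => // y y' yy'.
  by rewrite ler_int; apply: le_floor; rewrite ler_wpM2l.
rewrite (_ : mkset _ = [set x | g x = \row_i (z 0 i)%:~R]); first exact: measurable_mx_eq.
apply/seteqP; split => x /=; first by move=> <-; apply/rowP => i; rewrite !mxE.
move=> /rowP gx; apply/rowP => i; have := gx i; rewrite !mxE => /eqP.
by rewrite eqr_int => /eqP.
Qed.

(** The approximations take countably many values, each on a grid cell given by coordinates; so
    measurability for the coordinate sigma-algebra passes to the limit. *)
Lemma measurable_floor_cvg (h : 'rV[R]_n -> R) :
  (forall x, h (grid_rV k (floor_rV k x)) @[k --> \oo] --> h x) ->
  measurable_fun setT (h : 'rV[R]_n -> measurableTypeR R).
Proof.
move=> hx; apply: (@measurable_fun_cvg _ _ R setT (fun k x => h (grid_rV k (floor_rV k x)))) => // k.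
move=> _ Y mY; rewrite setTI.
rewrite (_ : _ @^-1` Y = \bigcup_m [set x | pickle (floor_rV k x) = m /\ Y (h (grid_rV k (floor_rV k x)))]); last first.
  apply/seteqP; split => x /=; first by move=> Yx; exists (pickle (floor_rV k x)).
  by move=> [m _ []].
apply: bigcup_measurable => m _.
case: (pselect (exists z : 'rV[int]_n, pickle z = m /\ Y (h (grid_rV k z)))) => [[z [zm Yz]]|nz].
  rewrite (_ : mkset _ = [set x | floor_rV k x = z]); first exact: measurable_fun_floor_rV.
  apply/seteqP; split => x /=; last by move=> ->.
  by move=> [+ _]; rewrite -zm => /(pcan_inj pickleK).
rewrite (_ : mkset _ = set0)//; apply/seteqP; split => x //= h1; apply: nz.
by exists (floor_rV k x).
Qed.

End floor_approximation.

Section sphere_ext_measurable.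
Context {R : realType} {n : nat} (f : 'rV[R]_n -> R).

Lemma measurable_sphere_ext : csphere f ->
  measurable_fun setT (sphere_ext f : 'rV[R]_n -> measurableTypeR R).
Proof.
move=> cf; apply: measurable_floor_cvg => x.
(* The extension need not be continuous at 0, but the grid point of 0 is 0 itself, so the sequence
   is constant there. *)
have [->|x0] := eqVneq x 0; last by apply: cvg_sphere_ext => //; exact: cvg_floor_rV.
rewrite (_ : (fun k => _) = cst (sphere_ext f 0)); first exact: cvg_cst.
apply/funext => k; congr sphere_ext; apply/rowP => i.
by rewrite !mxE mulr0 floor0 mul0r.
Qed.

End sphere_ext_measurable.

(** * Sections by planes parallel to an axis *)

Section unit_normal.
Context {R : realType} {n : nat} (a : 'rV[R]_n).
Hypothesis a0 : a != 0.
Implicit Types x y : 'rV[R]_n.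

Lemma dot_unitv_unitv : dot (unitv a) (unitv a) = 1.
Proof. by rewrite /unitv dotZl dotZr -sqr_enorm; field; rewrite enorm_eq0. Qed.

Lemma dot_unitv_eq0 x : (dot x (unitv a) == 0) = (dot x a == 0).
Proof. by rewrite /unitv dotZr mulf_eq0 invr_eq0 enorm_eq0 (negbTE a0). Qed.

Lemma mem_hyperplane_unitv x : (x \in hyperplane a) = (dot x (unitv a) == 0).
Proof. by rewrite mem_hyperplane dot_unitv_eq0. Qed.

Lemma QprojE x : Qproj a x = x - dot x (unitv a) *: unitv a.
Proof.
rewrite /Qproj /unitv dotZr scalerA -sqr_enorm; congr (_ - _ *: _).
by field; rewrite enorm_eq0.
Qed.

Lemma hreflE x : hrefl a x = x - (2 * dot x (unitv a)) *: unitv a.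
Proof.
rewrite /hrefl /unitv dotZr scalerA -sqr_enorm; congr (_ - _ *: _).
by field; rewrite enorm_eq0.
Qed.

Lemma dot_lift y s : y \in hyperplane a ->
  dot (y + s *: unitv a) (y + s *: unitv a) = dot y y + s ^+ 2.
Proof.
rewrite mem_hyperplane_unitv => /eqP ya.
move: ya dot_unitv_unitv; move: (unitv a) => v ya vv.
by rewrite !(dotDl, dotDr, dotZl, dotZr) (dotC v y) ya vv; ring.
Qed.

Lemma Qproj_mem x : Qproj a x \in hyperplane a.
Proof. by rewrite mem_hyperplane_unitv QprojE dotBl dotZl dot_unitv_unitv mulr1 subrr. Qed.

Lemma dot_Qproj x : dot (Qproj a x) (Qproj a x) = dot x x - dot x (unitv a) ^+ 2.
Proof.
rewrite QprojE; move: dot_unitv_unitv; move: (unitv a) => v vv.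
by rewrite !(dotBl, dotBr, dotZl, dotZr) (dotC v x) vv; ring.
Qed.

End unit_normal.

Section slice_potential.
Context {R : realType} {n : nat} (a : 'rV[R]_n) (f : 'rV[R]_n -> R).
Implicit Types x y : 'rV[R]_n.

Definition slice_sum y : R :=
  sphere_ext f (y + Num.sqrt (1 - dot y y) *: unitv a) +
  sphere_ext f (y + (- Num.sqrt (1 - dot y y)) *: unitv a).

(* The function psi whose integral over tau is Phi tau; it vanishes outside the unit ball *)
(* because Num.sqrt does, and 0^-1 = 0. *)
Definition slice_pot y : R := slice_sum y / Num.sqrt (1 - dot y y).

(** A bounded continuous regularisation on a^perp: with r = 1 - |y|^2, the factor r^(-1/2) is
    replaced by r^(1/2) / (r + eps). The maximum with 0 keeps the denominator positive outside the
    ball. *)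
Definition slice_cut (eps : R) y : R :=
  slice_sum y * (Num.sqrt (1 - dot y y) / (Num.max (1 - dot y y) 0 + eps)).

Hypotheses (a0 : a != 0) (cf : csphere f).

Lemma slice_pot_out y : 1 <= dot y y -> slice_pot y = 0.
Proof. by move=> y1; rewrite /slice_pot ler0_sqrtr ?subr_le0// invr0 mulr0. Qed.

(** Inside the ball the lifted point lies on the sphere; outside, y alone has length at least 1. So
    [slice_sum] avoids the origin, where [sphere_ext] may be discontinuous, on all of a^perp. *)
Lemma slice_point_neq0 y s : y \in hyperplane a -> s ^+ 2 = Num.sqrt (1 - dot y y) ^+ 2 ->
  y + s *: unitv a != 0.
Proof.
move=> yH sE; rewrite -dot_eq0 dot_lift// sE.
have [y1|y1] := leP 1 (dot y y).
  by rewrite gt_eqF// ltr_pwDl ?sqr_ge0// (lt_le_trans ltr01).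
by rewrite sqr_sqrtr ?subr_ge0 ?(ltW y1)// subrKC oner_eq0.
Qed.

Lemma measurable_slice_sum : measurable_fun setT (slice_sum : _ -> measurableTypeR R).
Proof. by have mf := measurable_sphere_ext cf; rewrite /slice_sum; meas. Qed.

Lemma measurable_slice_pot : measurable_fun setT (slice_pot : _ -> measurableTypeR R).
Proof. by have mf := measurable_slice_sum; rewrite /slice_pot; meas. Qed.

Lemma measurable_slice_cut eps : measurable_fun setT (slice_cut eps : _ -> measurableTypeR R).
Proof.
have mf := measurable_slice_sum; rewrite /slice_cut; meas.
by apply: measurable_maxr; meas.
Qed.

Lemma cvg_sqrt_slice (T : Type) (F : set_system T) (h : T -> 'rV[R]_n) y : Filter F ->
  h t @[t --> F] --> y -> Num.sqrt (1 - dot (h t) (h t)) @[t --> F] --> Num.sqrt (1 - dot y y).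
Proof.
move=> FF hy; apply: (@cvg_comp _ _ _ (fun t => 1 - dot (h t) (h t)) Num.sqrt F (nbhs (1 - dot y y))).
  by apply: cvgB; [exact: cvg_cst|exact: cvg_dot].
exact: sqrt_continuous.
Qed.

Lemma cvg_slice_sum (T : Type) (F : set_system T) (h : T -> 'rV[R]_n) y : Filter F ->
  y \in hyperplane a -> h t @[t --> F] --> y -> slice_sum (h t) @[t --> F] --> slice_sum y.
Proof.
move=> FF yH hy; have hs := cvg_sqrt_slice FF hy.
apply: cvgD; apply: cvg_sphere_ext => //.
- exact: slice_point_neq0.
- by apply: cvg_rVD => //; apply: cvg_rVZ => //; exact: cvg_cst.
- by apply: slice_point_neq0; rewrite ?sqrrN.
- by apply: cvg_rVD => //; apply: cvg_rVZ; [exact: cvgN|exact: cvg_cst].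
Qed.

Lemma cvg_slice_pot (T : Type) (F : set_system T) (h : T -> 'rV[R]_n) y : Filter F ->
  y \in hyperplane a -> dot y y != 1 -> h t @[t --> F] --> y ->
  slice_pot (h t) @[t --> F] --> slice_pot y.
Proof.
move=> FF yH yn1 hy; have [y1|y1] := ltP (dot y y) 1.
  apply: cvgM; first exact: cvg_slice_sum.
  by apply: cvgV; [rewrite gt_eqF// sqrtr_gt0 subr_gt0|exact: cvg_sqrt_slice].
have {yn1}y1 : 1 < dot y y by rewrite lt_neqAle eq_sym yn1.
rewrite slice_pot_out ?(ltW y1)//.
apply: cvg_near_cst; apply: filterS (cvgr_gt _ (cvg_dot FF hy hy) _ y1) => t ht.
by rewrite slice_pot_out// ltW.
Qed.

Lemma cvg_slice_cut (T : Type) (F : set_system T) (h : T -> 'rV[R]_n) y eps : Filter F ->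
  y \in hyperplane a -> 0 < eps -> h t @[t --> F] --> y ->
  slice_cut eps (h t) @[t --> F] --> slice_cut eps y.
Proof.
move=> FF yH e0 hy; apply: cvgM; first exact: cvg_slice_sum.
apply: cvgM; first exact: cvg_sqrt_slice.
apply: cvgV; first by rewrite gt_eqF// ltr_wpDl// le_max lexx orbT.
apply: cvgD; last exact: cvg_cst.
apply: (@cvg_comp _ _ _ (fun t => 1 - dot (h t) (h t)) (fun r => Num.max r 0) F (nbhs (1 - dot y y))).
  by apply: cvgB; [exact: cvg_cst|exact: cvg_dot].
by apply: (@continuous_max R R id (cst 0)); [exact: cvg_id|exact: cvg_cst].
Qed.

Lemma slice_sum_bounded : exists2 C, 0 <= C & forall y, y \in hyperplane a -> `|slice_sum y| <= C.
Proof.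
have [C CP] := csphere_bounded cf.
have C0 : 0 <= C by apply: le_trans (CP _ a0).
exists (C + C) => [|y yH]; first exact: addr_ge0.
apply: le_trans (ler_normD _ _) _.
by apply: lerD; apply: CP; apply: slice_point_neq0; rewrite ?sqrrN.
Qed.

Lemma slice_pot_bound C y : 0 <= C -> `|slice_sum y| <= C -> `|slice_pot y| <= C / Num.sqrt (1 - dot y y).
Proof.
move=> C0 yC; rewrite normrM [X in _ * X]ger0_norm ?invr_ge0 ?sqrtr_ge0//.
by rewrite ler_wpM2r// invr_ge0 sqrtr_ge0.
Qed.

Lemma slice_cut_bound C y eps : 0 < eps -> 0 <= C -> `|slice_sum y| <= C ->
  `|slice_cut eps y| <= C / eps.
Proof.
move=> e0 C0 yC; rewrite normrM ler_pM//.
have d0 : 0 < Num.max (1 - dot y y) 0 + eps by rewrite ltr_wpDl// le_max lexx orbT.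
rewrite ger0_norm ?divr_ge0 ?sqrtr_ge0 ?(ltW d0)//.
rewrite -[leRHS]mul1r ler_pM ?sqrtr_ge0 ?invr_ge0 ?(ltW d0)//.
  by rewrite -[leRHS]sqrtr1 ler_wsqrtr// gerBl dot_ge0.
by rewrite lef_pV2 ?posrE// lerDr le_max lexx orbT.
Qed.

(** With r = 1 - |y|^2 the weights differ by r^(-1/2) eps / (r + eps), and the last quotient is at
    most min(1, eps/r), hence at most (eps/r)^(1/4). The exponent 1/4 gains a power of eps and
    leaves the singularity r^(-3/4) integrable. *)
Lemma slice_cut_diff C y eps : 0 < eps -> 0 <= C -> `|slice_sum y| <= C ->
  `|slice_pot y - slice_cut eps y| <=
  C * eps `^ 4^-1 * ((1 - dot y y) `^ (- (3 / 4)) * (dot y y < 1)%R%:R).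
Proof.
move=> e0 C0 yC; have [y1|y1] := ltP (dot y y) 1; last first.
  rewrite slice_pot_out// /slice_cut ler0_sqrtr ?subr_le0// mul0r mulr0 subrr normr0.
  by rewrite mulr0 mulr0.
rewrite /slice_pot /slice_cut mulr1; set r := 1 - dot y y.
have r0 : 0 < r by rewrite subr_gt0.
rewrite -mulrBr normrM -mulrA ler_pM//.
clearbody r; have s0 : 0 < Num.sqrt r by rewrite sqrtr_gt0.
have sr : Num.sqrt r ^+ 2 = r by rewrite sqr_sqrtr// ltW.
rewrite (max_idPl (ltW r0)).
have -> : (Num.sqrt r)^-1 - Num.sqrt r / (r + eps) = r `^ (- 2^-1) * (eps / (r + eps)).
  rewrite powRN powR12_sqrt ?(ltW r0)// -[in X in _ - _ / (X + _)]sr -[in X in _ = _ * (_ / (X + _))]sr.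
  by field; rewrite !gt_eqF// ltr_wpDl// sqr_ge0.
rewrite ger0_norm; last exact: mulr_ge0 (powR_ge0 _ _) (divr_ge0 (ltW e0) (addr_ge0 (ltW r0) (ltW e0))).
rewrite (_ : - (3 / 4) = - 2^-1 - 4^-1); last by field.
rewrite gt0_powRD// [leRHS]mulrCA ler_wpM2l ?powR_ge0//.
have eE : eps `^ 4^-1 * r `^ (- 4^-1) = (eps / r) `^ 4^-1.
  by rewrite powRM ?invr_ge0 ?(ltW e0) ?(ltW r0)// inv_powR.
have P1 : 1 `^ 4^-1 = 1 :> R by rewrite powR1.
rewrite eE; have [er|er] := leP eps r.
  apply: (@le_trans _ _ (eps / r)).
    by rewrite ler_wpM2l ?(ltW e0)// lef_pV2 ?posrE ?addr_gt0// lerDl ltW.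
  have x1 : eps / r <= 1 by rewrite ler_pdivrMr// mul1r.
  have x0 : 0 <= eps / r by rewrite divr_ge0 ?(ltW e0) ?(ltW r0).
  have t1 : (eps / r) `^ 4^-1 <= 1.
    by rewrite -[leRHS]P1; apply: ge0_ler_powR; rewrite ?nnegrE ?invr_ge0.
  have t0 : 0 <= (eps / r) `^ 4^-1 by exact: powR_ge0.
  have t4 : ((eps / r) `^ 4^-1) ^+ 4 = eps / r.
    by rewrite -powR_mulrn// -powRrM mulVf ?powRr1.
  by rewrite -[leLHS]t4 exprS ler_piMr ?exprn_ile1.
apply: (@le_trans _ _ 1).
  by rewrite ler_pdivrMr ?addr_gt0// mul1r lerDr ltW.
rewrite -[leLHS]P1; apply: ge0_ler_powR; rewrite ?nnegrE ?invr_ge0 ?divr_ge0 ?(ltW e0) ?(ltW r0)//.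
by rewrite ler_pdivlMr// mul1r ltW.
Qed.

(** The two lifts of Q x to the sphere are x and R_a x, in an order given by the sign of x.a~. On
    the equator [slice_pot] is 0 by convention, whence the condition on x.a. *)
Lemma slice_pot_sphere x : usphere x -> dot x a != 0 ->
  f x + f (hrefl a x) = `|dot x (unitv a)| * slice_pot (Qproj a x).
Proof.
move=> x1 xa; set s := dot x (unitv a).
have s0 : s != 0 by rewrite dot_unitv_eq0.
have xx : dot x x = 1 by rewrite -sqr_enorm x1 expr1n.
have r2 : Num.sqrt (1 - dot (Qproj a x) (Qproj a x)) = `|s|.
  by rewrite dot_Qproj// xx subKr sqrtr_sqr.
rewrite /slice_pot /slice_sum r2 mulrCA mulfV ?normr_eq0// mulr1.
have E : Qproj a x + s *: unitv a = x by rewrite QprojE// subrK.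
have E' : Qproj a x + (- s) *: unitv a = hrefl a x.
  rewrite QprojE// hreflE// /s; move: (dot x (unitv a)) => c.
  by rewrite -addrA -scaleNr -scaleNr -scalerDl; congr (_ + _ *: _); ring.
have n1 : enorm (hrefl a x) = 1.
  rewrite -E' /enorm (dot_lift a0 _ (Qproj_mem a0 x)) sqrrN.
  by rewrite -(dot_lift a0 _ (Qproj_mem a0 x)) E xx sqrtr1.
have fx : sphere_ext f x = f x by rewrite /sphere_ext x1 invr1 scale1r.
have fr : sphere_ext f (hrefl a x) = f (hrefl a x) by rewrite /sphere_ext n1 invr1 scale1r.
by case: (ger0P s) => _; rewrite ?opprK E E' fx fr// addrC.
Qed.

End slice_potential.

Section concentrated_measures.
Local Open Scope ereal_scope.
Context d (T : measurableType d) {R : realType} (m : {measure set T -> \bar R}).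
Import HBNNSimple.

(** The integrands can be wild off E, as f is arbitrary off the sphere; the comparison is therefore
    made on simple functions below f, cut off to E. *)
Let ge0_le_integral_conc (E : set T) (f g : T -> \bar R) : measurable E -> m (~` E) = 0 ->
  (forall x, 0 <= f x) -> (forall x, 0 <= g x) -> (forall x, E x -> f x = g x) ->
  \int[m]_x f x <= \int[m]_x g x.
Proof.
move=> mE mE0 f0 g0 fg; rewrite !ge0_integralTE//.
apply/ge_ereal_sup => _ [h /= hf <-].
rewrite -integralT_nnsfun (@ge0_negligible_integral _ _ _ m setT (~` E)) => //; last 3 first.
- exact: measurableC.
- by apply: measurable_fun_EFin.
- by move=> x _; rewrite lee_fin fun_ge0.
rewrite setTD setCK integral_nnsfun// (mrestrict h mE).
apply: ereal_sup_ubound; exists (proj_nnsfun h mE) => // x /=.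
rewrite mindicE; have [xE|xE] := boolP (x \in E); last by rewrite mulr0.
by rewrite mulr1 -fg//; move: xE; rewrite inE.
Qed.

Lemma eq_integral_conc (E : set T) (f g : T -> \bar R) : measurable E -> m (~` E) = 0 ->
  (forall x, E x -> f x = g x) -> \int[m]_x f x = \int[m]_x g x.
Proof.
move=> mE mE0 fg.
have ge0_eq (f' g' : T -> \bar R) : (forall x, 0 <= f' x) -> (forall x, 0 <= g' x) ->
    (forall x, E x -> f' x = g' x) -> \int[m]_x f' x = \int[m]_x g' x.
  move=> f0 g0 fg'; apply/eqP; rewrite eq_le; apply/andP; split.
    exact: (ge0_le_integral_conc mE).
  by apply: (ge0_le_integral_conc mE) => // x Ex; rewrite fg'.
rewrite integralE [RHS]integralE; congr (_ - _); apply: ge0_eq => // x Ex.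
  by rewrite !funeposE fg.
by rewrite !funenegE fg.
Qed.

End concentrated_measures.

Section plane_sections.
Context {R : realType} {N : nat}.
Implicit Types (u x : 'rV[R]_N) (W : {vspace 'rV[R]_N}).

(** The choice is forced: u' - u lies in both directions, so it is orthogonal to u' and to u, hence
    to itself. *)
Lemma plane_repE W u : orth_to u W -> plane_rep (aplane W u) = (W, u).
Proof.
move=> uW; rewrite /plane_rep; set P := [set Wu | _].
have : P (xget (0%VS, 0) P) by apply: xgetPex; exists (W, u).
case: (xget _ P) => W' u' [/= uW' E].
have up : (aplane W' u') u by rewrite -E /aplane/= subrr mem0v.
have up' : (aplane W u) u' by rewrite E /aplane/= subrr mem0v.
have eu : u' = u.
  apply/eqP; rewrite -subr_eq0 -dot_eq0 dotBl; apply/eqP.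
  rewrite (uW' (u' - u)) ?(uW (u' - u)) ?subrr//.
  by rewrite -opprB memvN.
subst u'; congr (_, _); apply/vspaceP => x.
have : (aplane W' u) (x + u) <-> (aplane W u) (x + u) by rewrite E.
by rewrite /aplane/= addrK => -[h1 h2]; apply/idP/idP.
Qed.

Lemma measurable_memv W : measurable [set x | x \in W].
Proof.
rewrite (_ : mkset _ = [set x | x *m (onb W)^T *m onb W = x]).
  rewrite (_ : mkset _ = [set x | x *m (onb W)^T *m onb W - x = 0]).
    by apply: measurable_mx_eq; meas.
  by apply/seteqP; split => x /= /eqP; [rewrite -subr_eq0 => /eqP|rewrite subr_eq0 => /eqP].
apply/seteqP; split => x /=; rewrite mem_onb; last by move=> <-; exact: submxMl.
by move=> /submxP[c ->]; rewrite -(mulmxA c) onb_orth mulmx1.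
Qed.

Lemma sphere_measure_conc W : sphere_measure W (~` [set x | x \in W /\ enorm x = 1]) = 0%E.
Proof.
rewrite /sphere_measure (_ : [set x | _ /\ _] = [set x | (0 < enorm x <= 1) /\ x \notin W]); last first.
  apply/seteqP; split => x /= [x1 h]; split => //; have /andP[x0 _] := x1.
    apply/negP => xW; apply: h; split; first by rewrite memvZ.
    by rewrite enormZ ?invr_ge0 ?enorm_ge0// mulVf// gt_eqF.
  move=> [h1 h2]; move/negP: h; apply.
  by rewrite -[x]scale1r -(mulfV (lt0r_neq0 x0)) -scalerA memvZ.
rewrite /leb_on /pushforward (_ : _ @^-1` _ = set0) ?measure0 ?mule0//.
apply/seteqP; split => v //= [_ /negP]; apply.
by rewrite /embed_onb mem_onb submxMl.
Qed.

Lemma measurable_usphere W : measurable [set x | x \in W /\ enorm x = 1].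
Proof.
apply: measurableI; first exact: measurable_memv.
have mN : measurable_fun setT (fun x : 'rV[R]_N => enorm x) by exact: measurable_enorm.
by rewrite -[X in measurable X]setTI; exact: (mN measurableT [set 1]).
Qed.

Lemma is_onb_add m a W (B : 'M[R]_(m, N)) : a != 0 -> (W <= hyperplane a)%VS -> is_onb W B ->
  is_onb (W + <[unitv a]>)%VS (col_mx (unitv a) B : 'M[R]_(1 + m, N)).
Proof.
move=> a0 WH [BB WB].
have aB : unitv a *m B^T = 0.
  apply/rowP => j; rewrite mxE [RHS]mxE.
  have : row j B \in hyperplane a by apply: (subvP WH); rewrite WB row_sub.
  rewrite mem_hyperplane_unitv// dotC dotE => /eqP E; rewrite -[RHS]E.
  by apply: eq_bigr => i _; rewrite !mxE.
split.
  rewrite tr_col_mx mul_col_row BB aB.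
  have -> : B *m (unitv a)^T = 0 by rewrite -[B]trmxK -trmx_mul aB trmx0.
  rewrite (_ : unitv a *m (unitv a)^T = 1%:M) ?scalar_mx_block//.
  by rewrite [LHS]mx11_scalar -/(dot _ _) dot_unitv_unitv.
move=> x; apply/memv_addP/idP => [[w wW [v /vlineP[c ->] ->]]|].
  move: wW; rewrite WB => /submxP[b ->].
  apply/submxP; exists (row_mx (c%:M : 'M[R]_1) b).
  by rewrite mul_row_col mul_scalar_mx addrC.
case/submxP => b; rewrite -[b]hsubmxK mul_row_col => ->.
exists (rsubmx b *m B); first by rewrite WB submxMl.
exists (lsubmx b *m unitv a); last by rewrite addrC.
by rewrite [lsubmx b]mx11_scalar mul_scalar_mx memvZ// memv_line.
Qed.

End plane_sections.

Section slice_link.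
Context {R : realType} {N : nat} (a : 'rV[R]_N).
Hypothesis a0 : a != 0.
Implicit Types (u x : 'rV[R]_N) (W : {vspace 'rV[R]_N}).

(** With a~ as the first basis vector of W + R a~, [sphere_int_proj] projects the section along a~.
    The point y = u + r v B has height r (1 - |v|^2)^(1/2) = (1 - |y|^2)^(1/2), and the dilation by
    r turns r^d dv into Lebesgue measure on tau; one factor r remains from the density. *)
Lemma ge0_slice_link (d : nat) W (B : 'M[R]_(d, N)) u (F : 'rV[R]_N -> \bar R) :
  (W <= hyperplane a)%VS -> is_onb W B -> u \in hyperplane a -> orth_to u W -> enorm u < 1 ->
  measurable_fun setT F -> (forall x, 0 <= F x)%E ->
  let r := Num.sqrt (1 - dot u u) in
  ((r ^+ d)%:E * \int[sphere_measure (W + <[unitv a]>)%VS]_(x in usphere) F (u + r *: x)%R =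
  r%:E * \int[leb d]_v
    ((F (u + v *m B + Num.sqrt (1 - dot (u + v *m B) (u + v *m B)) *: unitv a)%R +
      F (u + v *m B + (- Num.sqrt (1 - dot (u + v *m B) (u + v *m B))) *: unitv a)%R) *
     ((Num.sqrt (1 - dot (u + v *m B) (u + v *m B)))^-1)%:E))%E.
Proof.
move=> WH WB uH uW u1 mF F0 r; have [BB BW] := WB.
have r0 : 0 < r by rewrite sqrtr_gt0 subr_gt0 -enorm_lt1.
have r2 : r ^+ 2 = 1 - dot u u by rewrite sqr_sqrtr// subr_ge0 -enorm_le1 ltW.
rewrite (integral_usphere (is_onb_add a0 WH WB)); [|by meas|by []].
rewrite sphere_int_proj; [|by meas|by []].
pose G (v : 'rV[R]_d) : \bar R :=
  ((F (u + v *m B + Num.sqrt (1 - dot (u + v *m B) (u + v *m B)) *: unitv a)%R +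
      F (u + v *m B + (- Num.sqrt (1 - dot (u + v *m B) (u + v *m B))) *: unitv a)%R) *
     ((Num.sqrt (1 - dot (u + v *m B) (u + v *m B)))^-1)%:E)%E.
have G0 v : (0 <= G v)%E by rewrite /G; pos.
have mG : measurable_fun setT G by rewrite /G; meas.
transitivity ((r ^+ d)%:E * \int[leb d]_v (r%:E * G (r *: v)%R))%E.
  apply: (congr1 (mule (r ^+ d)%:E)); apply: eq_integral => v _.
  rewrite /G; set y := (u + r *: v *m B)%R.
  have yE : dot y y = dot u u + r ^+ 2 * dot v v.
    have uB : dot u (v *m B) = 0 by apply: uW; rewrite BW submxMl.
    rewrite /y -scalemxAl !(dotDl, dotDr, dotZl, dotZr) (dotC (v *m B) u) uB.
    by rewrite (dot_mulmx_orth _ _ BB); ring.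
  have sE : Num.sqrt (1 - dot y y) = r * Num.sqrt (1 - dot v v).
    rewrite yE (_ : 1 - _ = r ^+ 2 * (1 - dot v v)); last by rewrite r2; ring.
    by rewrite sqrtrM ?sqr_ge0// sqrtr_sqr gtr0_norm.
  rewrite !cons_rV_mul sE.
  have E (s : R) : u + r *: (s *: unitv a + v *m B) = y + (r * s) *: unitv a.
    by rewrite /y scalerDr scalerA scalemxAl addrCA addrC.
  rewrite !E mulrN muleCA -EFinM; congr (_ * _%:E)%E.
  have [v1|v1] := ltP (enorm v) 1; first by rewrite mulr1; field; rewrite !gt_eqF// sqrtr_gt0 subr_gt0 -enorm_lt1.
  rewrite mulr0 ler0_sqrtr ?mulr0 ?invr0 ?mulr0//.
  by rewrite subr_le0 leNgt -enorm_lt1 -leNgt.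
rewrite integralZl_nneg; [|exact: ltW|by meas|by []].
rewrite integral_leb_scale//.
rewrite muleCA; apply: (congr1 (mule r%:E)).
by rewrite muleA -EFinM mulfV ?mul1e// expf_neq0// gt_eqF.
Qed.

Definition slice_weight (y : 'rV[R]_N) : R := (Num.sqrt (1 - dot y y))^-1.

Lemma dim_add_unitv (d : nat) W (B : 'M[R]_(d, N)) : (W <= hyperplane a)%VS -> is_onb W B ->
  \dim (W + <[unitv a]>)%VS = d.+1.
Proof. by move=> WH WB; exact: is_onb_dim (is_onb_add a0 WH WB). Qed.

Lemma orth_add_unitv W u : u \in hyperplane a -> orth_to u W -> orth_to u (W + <[unitv a]>)%VS.
Proof.
rewrite mem_hyperplane_unitv// => /eqP ua uW x /memv_addP[w wW [v /vlineP[c ->] ->]].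
by rewrite dotDr dotZr ua mulr0 addr0 uW.
Qed.

(* Integrals of the slice potential over planes are bounded, because the area of a section is. *)
Lemma slice_weight_bounded d : exists K : R, forall W (B : 'M[R]_(d.+1, N)) u,
  (W <= hyperplane a)%VS -> is_onb W B -> u \in hyperplane a -> orth_to u W ->
  (\int[leb d.+1]_v (slice_weight (u + v *m B))%:E <= K%:E)%E.
Proof.
pose S : \bar R := sphere_int (fun _ : 'rV[R]_d.+2 => 1%E).
have Sf : S = (fine S)%:E.
  by rewrite fineK// /S sphere_int_cst fin_numM// ball_volume_fin.
have S0 : 0 <= fine S by rewrite fine_ge0// /S sphere_int_cst mule_ge0// ltW// ball_volume_gt0.
exists (fine S) => W B u WH WB uH uW; have [BB BW] := WB.
have [u1|u1] := ltP (enorm u) 1; last first.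
  rewrite integral0_eq ?lee_fin// => v _; rewrite /slice_weight ler0_sqrtr ?invr0//.
  have uB : dot u (v *m B) = 0 by apply: uW; rewrite BW submxMl.
  rewrite subr_le0 !(dotDl, dotDr) (dotC (v *m B) u) uB add0r addr0.
  by rewrite ler_wpDr ?dot_ge0// leNgt -enorm_lt1 -leNgt.
have := ge0_slice_link WH WB uH uW u1 (measurable_cst 1%E) (fun=> lee01).
set r := Num.sqrt (1 - dot u u) => /=.
have r0 : 0 < r by rewrite sqrtr_gt0 subr_gt0 -enorm_lt1.
have r1 : r <= 1 by rewrite -[leRHS]sqrtr1 ler_wsqrtr// gerBl dot_ge0.
rewrite (integral_usphere (is_onb_add a0 WH WB)); [|by meas|by []].
rewrite -[sphere_int _]/S => E; rewrite Sf in E.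
have wP : forall v : 'rV[R]_d.+1, (0 <= (slice_weight (u + v *m B))%:E)%E.
  by move=> v; rewrite lee_fin invr_ge0 sqrtr_ge0.
(* For F = 1 the two hemispheres give twice the weight; its integral is r^d times the area of the
   unit sphere, and r <= 1. *)
apply: (@le_trans _ _ (\int[leb d.+1]_v ((1 + 1) * (slice_weight (u + v *m B))%:E))%E).
  apply: ge0_le_integral => //.
  - by rewrite /slice_weight; meas.
  - by rewrite /slice_weight; meas.
  - by move=> v _; rewrite -EFinD -EFinM lee_fin ler_peMl ?lerDl// invr_ge0 sqrtr_ge0.
have -> : (\int[leb d.+1]_v ((1 + 1) * (slice_weight (u + v *m B))%:E) = (r ^+ d * fine S)%:E)%E.
  have Er X : ((r^-1)%:E * (r%:E * X) = X)%E by rewrite muleA -EFinM mulVf ?gt_eqF// mul1e.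
  move/(congr1 (mule (r^-1)%:E)) : E; rewrite Er => <-.
  by rewrite -!EFinM exprS; congr EFin; field; rewrite gt_eqF.
by rewrite lee_fin ler_piMl// exprn_ile1// ltW.
Qed.

Lemma slice_weight_integrable d W (B : 'M[R]_(d.+1, N)) u (h : 'rV[R]_N -> R) (C : R) :
  (W <= hyperplane a)%VS -> is_onb W B -> u \in hyperplane a -> orth_to u W ->
  measurable_fun setT (h : _ -> measurableTypeR R) -> 0 <= C ->
  (forall y, y \in hyperplane a -> `|h y| <= C * slice_weight y) ->
  (leb d.+1).-integrable setT (EFin \o (fun v => h (u + v *m B))).
Proof.
move=> WH WB uH uW mh C0 hC; have [K KP] := slice_weight_bounded d.
apply/integrableP; split; first by apply: measurable_fun_EFin; meas.
apply: (@le_lt_trans _ _ (C%:E * \int[leb d.+1]_v (slice_weight (u + v *m B))%:E)%E); last first.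
  rewrite (le_lt_trans (lee_wpmul2l _ (KP _ _ _ WH WB uH uW))) ?lee_fin//.
  by rewrite -EFinM ltry.
rewrite -integralZl_nneg//; last 2 first.
- by rewrite /slice_weight; meas.
- by move=> v; rewrite lee_fin invr_ge0 sqrtr_ge0.
apply: ge0_le_integral => //.
- by apply: measurable_fun_abse; apply: measurable_fun_EFin; meas.
- by rewrite /slice_weight; meas.
move=> v _; rewrite /= -EFinM lee_fin; apply: hC.
have [_ BW] := WB.
by rewrite memvD// (subvP WH)// BW submxMl.
Qed.

Variable f : 'rV[R]_N -> R.
Hypothesis cf : csphere f.

(** The link is applied to the positive and negative parts of [sphere_ext f], which is measurable
    and agrees with f on the section; both parts have finite integrals, so they may be
    subtracted. *)
Lemma section_slice d W (B : 'M[R]_(d.+1, N)) u :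
  (W <= hyperplane a)%VS -> is_onb W B -> u \in hyperplane a -> orth_to u W -> enorm u < 1 ->
  section_integral f (aplane (W + <[unitv a]>)%VS u) =
  Num.sqrt (1 - dot u u) * \int[leb d.+1]_v (slice_pot a f (u + v *m B)).
Proof.
move=> WH WB uH uW u1; have [BB BW] := WB.
rewrite /section_integral (plane_repE (orth_add_unitv uH uW)) (dim_add_unitv WH WB)/=.
set r := Num.sqrt (1 - dot u u).
have r0 : 0 < r by rewrite sqrtr_gt0 subr_gt0 -enorm_lt1.
have r2 : r ^+ 2 = 1 - dot u u by rewrite sqr_sqrtr// subr_ge0 -enorm_le1 ltW.
pose I (F : 'rV[R]_N -> R) := (\int[sphere_measure (W + <[unitv a]>)%VS]_(x in usphere) (F (u + r *: x))%:E)%E.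
pose P (F : 'rV[R]_N -> R) y := (F (y + Num.sqrt (1 - dot y y) *: unitv a) +
  F (y + (- Num.sqrt (1 - dot y y)) *: unitv a)) * slice_weight y.
pose fp x := Num.max (sphere_ext f x) 0; pose fm x := Num.max (- sphere_ext f x) 0.
have mfe := measurable_sphere_ext cf.
have mfp : measurable_fun setT (fp : _ -> measurableTypeR R) by apply: measurable_maxr => //; meas.
have mfm : measurable_fun setT (fm : _ -> measurableTypeR R).
  by apply: measurable_maxr; [apply: measurable_fun_opp|meas].
have fp0 x : 0 <= fp x by rewrite /fp le_max lexx orbT.
have fm0 x : 0 <= fm x by rewrite /fm le_max lexx orbT.
have fpm x : sphere_ext f x = fp x - fm x by rewrite /fp /fm !maxEle; case: ifP; case: ifP; lra.
have IE : (\int[sphere_measure (W + <[unitv a]>)%VS]_(x in usphere) (f (u + r *: x))%:E = I fp - I fm)%E.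
  have fE x : x \in (W + <[unitv a]>)%VS /\ enorm x = 1 -> f (u + r *: x) = sphere_ext f (u + r *: x).
    move=> [xW x1]; rewrite /sphere_ext (_ : enorm _ = 1) ?invr1 ?scale1r//.
    have ux : dot u x = 0 by exact: (orth_add_unitv uH uW).
    apply/eqP; rewrite -(@eqrXn2 _ 2) ?enorm_ge0 ?ler01// sqr_enorm expr1n.
    rewrite !(dotDl, dotDr, dotZl, dotZr) (dotC x u) ux -(sqr_enorm x) x1; apply/eqP.
    by rewrite !mulr0 addr0 add0r expr1n mulr1 -expr2 r2; ring.
  rewrite integralE; congr (_ - _)%E.
    rewrite integral_mkcond [RHS]integral_mkcond.
    apply: (eq_integral_conc (measurable_usphere (W + <[unitv a]>)%VS)).
      exact: sphere_measure_conc.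
    move=> x xE; rewrite !patchE; case: ifP => // _.
    by rewrite funeposE (fE x xE) -EFin_max.
  rewrite integral_mkcond [RHS]integral_mkcond.
  apply: (eq_integral_conc (measurable_usphere (W + <[unitv a]>)%VS)).
    exact: sphere_measure_conc.
  move=> x xE; rewrite !patchE; case: ifP => // _.
  by rewrite funenegE (fE x xE) -EFinN -EFin_max.
have [C CP] := csphere_bounded cf.
have C0 : 0 <= C by apply: le_trans (CP _ a0).
have PP F : measurable_fun setT (F : _ -> measurableTypeR R) -> (forall x, 0 <= F x) ->
    (forall x, F x <= `|sphere_ext f x|) ->
    [/\ (leb d.+1).-integrable setT (EFin \o (fun v => P F (u + v *m B))),
        I F \is a fin_num & r ^+ d.+1 * fine (I F) = r * \int[leb d.+1]_v P F (u + v *m B)].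
  move=> mF F0 FC.
  have iP : (leb d.+1).-integrable setT (EFin \o (fun v => P F (u + v *m B))).
    apply: (slice_weight_integrable (C := C + C) WH WB uH uW) => //.
    - by rewrite /P /slice_weight; meas.
    - exact: addr_ge0.
    move=> y yH; rewrite /P ger0_norm ?mulr_ge0 ?addr_ge0 ?invr_ge0 ?sqrtr_ge0//.
    rewrite ler_wpM2r ?invr_ge0 ?sqrtr_ge0// lerD// (le_trans (FC _))//; apply: CP;
      by apply: slice_point_neq0; rewrite ?sqrrN.
  have PI := integrable_fin_num measurableT iP.
  have := ge0_slice_link (F := EFin \o F) WH WB uH uW u1 (measurable_fun_EFin mF) (fun x => F0 x).
  rewrite -/r /= -/(I F).
  have -> : (\int[cons_measure (leb d)]_v
     (((F (u + v *m B + Num.sqrt (1 - dot (u + v *m B) (u + v *m B)) *: unitv a)%R)%:E +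
      (F (u + v *m B + (- Num.sqrt (1 - dot (u + v *m B) (u + v *m B))) *: unitv a)%R)%:E) *
     ((Num.sqrt (1 - dot (u + v *m B) (u + v *m B)))^-1)%:E) = \int[leb d.+1]_v (P F (u + v *m B))%:E)%E.
    by apply: eq_integral => v _; rewrite -EFinD -EFinM.
  move=> E.
  have rn : r ^+ d.+1 != 0 by rewrite expf_neq0// gt_eqF.
  have IF : I F \is a fin_num.
    have -> : I F = (((r ^+ d.+1)^-1)%:E * (r%:E * \int[leb d.+1]_v (P F (u + v *m B))%:E))%E.
      by rewrite -E muleA -EFinM mulVf// mul1e.
    by rewrite !fin_numM.
  split => //; move/(congr1 fine) : E.
  by rewrite !fineM.
have fpC x : fp x <= `|sphere_ext f x| by rewrite /fp ge_max ler_norm normr_ge0.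
have fmC x : fm x <= `|sphere_ext f x| by rewrite /fm ge_max -normrN ler_norm normr_ge0.
have [ip Ip Ep] := PP fp mfp fp0 fpC.
have [im Im Em] := PP fm mfm fm0 fmC.
rewrite /Rintegral IE (fineB Ip Im) mulrBr Ep Em -mulrBr -(RintegralB measurableT ip im).
by congr (_ * fine _); apply: eq_integral => v _; rewrite /slice_pot /slice_sum !fpm /P /slice_weight; congr EFin; ring.
Qed.

(** Phi is the Radon-John transform of the potential. Planes with |u| >= 1 miss the open ball, where
    alone the potential can be nonzero. *)
Lemma Phi_slice k d (g : set 'rV[R]_N -> R) W (B : 'M[R]_(d.+1, N)) u : k = d.+2 ->
  {in parallel_planes a k, forall zeta, g zeta = section_integral f zeta} ->
  (W <= hyperplane a)%VS -> is_onb W B -> u \in hyperplane a -> orth_to u W ->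
  Phi a g W u = \int[leb d.+1]_v (slice_pot a f (u + v *m B)).
Proof.
move=> kd gf WH WB uH uW; have [BB BW] := WB; rewrite /Phi; case: ifPn => u1; last first.
  rewrite /Rintegral integral0_eq// => v _; rewrite slice_pot_out//.
  have uB : dot u (v *m B) = 0 by apply: uW; rewrite BW submxMl.
  rewrite !(dotDl, dotDr) (dotC (v *m B) u) uB add0r addr0.
  by rewrite ler_wpDr ?dot_ge0// leNgt -enorm_lt1.
rewrite gf; last first.
  rewrite inE; exists (W + <[unitv a]>)%VS, u; split => //.
  - by rewrite (dim_add_unitv WH WB) kd.
  - apply: (subvP (addvSr _ _)); apply/vlineP; exists (enorm a).
    by rewrite /unitv scalerA mulfV ?scale1r// enorm_eq0.
  - by exists u; split => //; rewrite /aplane/= subrr mem0v.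
rewrite (section_slice WH WB)// mulrA powRN powR12_sqrt; last by rewrite subr_ge0 -enorm_le1 ltW.
by rewrite mulVf ?mul1r// gt_eqF// sqrtr_gt0 subr_gt0 -enorm_lt1.
Qed.

End slice_link.

(** * Means over planes and spheres *)

Section signed_integrals.
Context {R : realType}.

Lemma integral_pos_neg d (T : measurableType d) (m : {measure set T -> \bar R}) (D : set T) (f : T -> R) :
  (\int[m]_(x in D) (f x)%:E =
   \int[m]_(x in D) (Num.max (f x) 0)%:E - \int[m]_(x in D) (Num.max (- f x) 0)%:E)%E.
Proof.
rewrite integralE; congr (_ - _)%E; apply: eq_integral => x _.
  by rewrite funeposE -EFin_max.
by rewrite funenegE -EFinN -EFin_max.
Qed.

(** Positive and negative parts have the same integrals on both sides, so the values agree even when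
    the difference degenerates. *)
Lemma integral_signed_comp d1 d2 d3 (T1 : measurableType d1) (T2 : measurableType d2)
    (Y : measurableType d3) (m1 : {measure set T1 -> \bar R}) (m2 : {measure set T2 -> \bar R})
    (D1 : set T1) (D2 : set T2) (h1 : T1 -> Y) (h2 : T2 -> Y) :
  (forall F : Y -> \bar R, measurable_fun setT F -> (forall y, 0 <= F y)%E ->
    (\int[m1]_(x in D1) F (h1 x) = \int[m2]_(x in D2) F (h2 x))%E) ->
  forall F : Y -> R, measurable_fun setT (F : Y -> measurableTypeR R) ->
    \int[m1]_(x in D1) F (h1 x) = \int[m2]_(x in D2) F (h2 x).
Proof.
move=> E F mF; rewrite /Rintegral integral_pos_neg [in RHS]integral_pos_neg.
have mp : measurable_fun setT (fun y => Num.max (F y) 0 : measurableTypeR R) by apply: measurable_maxr => //; meas.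
have mn : measurable_fun setT (fun y => Num.max (- F y) 0 : measurableTypeR R).
  by apply: measurable_maxr; [exact: measurable_fun_opp|meas].
rewrite (E (fun y => (Num.max (F y) 0)%:E)) => [|//|y]; last by rewrite lee_fin le_max lexx orbT.
  rewrite (E (fun y => (Num.max (- F y) 0)%:E)) => [//|//|y]; last by rewrite lee_fin le_max lexx orbT.
  exact: measurable_fun_EFin.
exact: measurable_fun_EFin.
Qed.

Lemma le_abse_Rintegral d (T : measurableType d) (m : {measure set T -> \bar R}) (D : set T)
    (f : T -> R) : measurable D -> measurable_fun setT (f : T -> measurableTypeR R) ->
  (`|\int[m]_(x in D) f x|%:E <= \int[m]_(x in D) `|f x|%:E)%E.
Proof.
move=> mD mf; have mE : measurable_fun D (EFin \o f).
  by apply: measurable_funTS; exact: measurable_fun_EFin.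
apply: le_trans (le_abse_integral m mD mE).
by rewrite /Rintegral /comp; case: (integral m D _) => [r| |] //=; rewrite normr0 leey.
Qed.

Lemma measurable_fun_Rintegral d1 d2 (T1 : measurableType d1) (T2 : measurableType d2)
    (m2 : {sigma_finite_measure set T2 -> \bar R}) (D2 : set T2) (F : T1 -> T2 -> R) :
  measurable D2 -> measurable_fun setT (fun p => F p.1 p.2 : measurableTypeR R) ->
  measurable_fun setT (fun x => \int[m2]_(y in D2) F x y : measurableTypeR R).
Proof.
move=> mD2 mF.
rewrite (_ : (fun x => _) = fun x => fine (\int[m2]_(y in D2) (Num.max (F x y) 0)%:E -
   \int[m2]_(y in D2) (Num.max (- F x y) 0)%:E)%E); last first.
  by apply/funext => x; rewrite /Rintegral integral_pos_neg.
apply: measurable_fun_fine; apply: emeasurable_funB.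
  apply: (@measurable_fun_integral2 R _ _ _ _ m2 D2 (fun x y => (Num.max (F x y) 0)%:E)) => //.
    by apply: measurable_fun_EFin; apply: measurable_maxr => //; meas.
  by move=> x y _; rewrite lee_fin le_max lexx orbT.
apply: (@measurable_fun_integral2 R _ _ _ _ m2 D2 (fun x y => (Num.max (- F x y) 0)%:E)) => //.
  by apply: measurable_fun_EFin; apply: measurable_maxr; [exact: measurable_fun_opp|meas].
by move=> x y _; rewrite lee_fin le_max lexx orbT.
Qed.

End signed_integrals.

Section radial_planes.
Context {R : realType}.
Let mu := @lebesgue_measure R.

(** The area of the unit sphere of R^(n+1), that is |S^(d-1)| for d = n + 1. *)
Definition radial_cst n : R := n.+1%:R * fine (@ball_volume R n.+1).

(** The polar density r^(d-1) dr of a d-plane at distance w from the centre, in terms of s^2 = w^2 +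
    r^2. *)
Definition radial_weight n (w s : R) : R := (s ^+ 2 - w ^+ 2) `^ (n.+1%:R / 2 - 1) * s.

Lemma radial_cst_ge0 n : 0 <= radial_cst n.
Proof. by rewrite mulr_ge0// fine_ge0// ltW// ball_volume_gt0. Qed.

Lemma ge0_integral_plane n (w : R) (F : measurableTypeR R -> \bar R) : 0 < w ->
  measurable_fun setT F -> (forall s, 0 <= F s)%E ->
  (\int[leb n.+1]_v F (Num.sqrt (w ^+ 2 + dot v v)) =
  (radial_cst n)%:E * \int[mu]_(s in `]w, +oo[) (F s * (radial_weight n w s)%:E))%E.
Proof.
move=> w0 mF F0.
pose G (r : measurableTypeR R) := F (Num.sqrt (w ^+ 2 + r ^+ 2)).
have mG : measurable_fun setT G by rewrite /G; meas.
transitivity (\int[leb n.+1]_v G (enorm v))%E.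
  by apply: eq_integral => v _; rewrite /G sqr_enorm.
rewrite integral_leb_radial//; last by move=> x; exact: F0.
rewrite /radial_cst EFinM fineK ?ball_volume_fin//; congr (_ * _)%E.
rewrite (integral_pythagoras (ltW w0)); [|by meas|by move=> x x0; rewrite mule_ge0 ?lee_fin ?exprn_ge0 ?(ltW x0)//; exact: F0].
apply: eq_integral => s; rewrite inE/= in_itv/= andbT => ws.
have s0 := lt_trans w0 ws.
have d0 : 0 < s ^+ 2 - w ^+ 2 by rewrite subr_gt0 ltr_pXn2r ?nnegrE ?(ltW w0) ?(ltW s0).
rewrite /G -muleA -EFinM sqr_sqrtr ?(ltW d0)// subrKC sqrtr_sqr gtr0_norm//.
congr (_ * _%:E)%E; rewrite /radial_weight mulrCA mulrC; congr (_ * _).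
have q0 : 0 < Num.sqrt (s ^+ 2 - w ^+ 2) by rewrite sqrtr_gt0.
rewrite -[in RHS](@sqr_sqrtr _ (s ^+ 2 - w ^+ 2)) ?(ltW d0)//; set q := Num.sqrt _ in q0 *.
rewrite sqr_powR// (_ : 2 * _ = n%:R + - 1); last by rewrite -natr1; field.
by rewrite gt0_powRD// powR_mulrn ?(ltW q0)// powR_inv1// ltW.
Qed.

Lemma Rintegral_plane n (w : R) (F : R -> R) : 0 < w ->
  measurable_fun setT (F : measurableTypeR R -> measurableTypeR R) ->
  \int[leb n.+1]_v F (Num.sqrt (w ^+ 2 + dot v v)) =
  radial_cst n * \int[mu]_(s in `]w, +oo[) (F s * radial_weight n w s).
Proof.
move=> w0 mF.
have W0 s : w < s -> 0 <= radial_weight n w s.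
  by move=> ws; rewrite mulr_ge0 ?powR_ge0// (ltW (lt_trans w0 ws)).
rewrite /Rintegral integral_pos_neg [in RHS]integral_pos_neg.
rewrite (@ge0_integral_plane n w (fun s => (Num.max (F s) 0)%:E)) => [|//||s]; last 2 first.
- by apply: measurable_fun_EFin; apply: measurable_maxr => //; meas.
- by rewrite lee_fin le_max lexx orbT.
rewrite (@ge0_integral_plane n w (fun s => (Num.max (- F s) 0)%:E)) => [|//||s]; last 2 first.
- by apply: measurable_fun_EFin; apply: measurable_maxr; [exact: measurable_fun_opp|meas].
- by rewrite lee_fin le_max lexx orbT.
have E (G : R -> R) : (\int[mu]_(s in `]w, +oo[) ((Num.max (G s) 0)%:E * (radial_weight n w s)%:E) =
    \int[mu]_(s in `]w, +oo[) (Num.max (G s * radial_weight n w s) 0)%:E)%E.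
  apply: eq_integral => s; rewrite inE/= in_itv/= andbT => ws.
  by rewrite -EFinM maxr_pMl ?W0// mul0r.
rewrite !E; under [X in _ = _ * fine (_ - X)]eq_integral do rewrite -mulNr.
have [->|c0] := eqVneq (radial_cst n) 0.
  by rewrite !mul0e sube0 mul0r.
have c1 : 0 < radial_cst n by rewrite lt_neqAle eq_sym c0 radial_cst_ge0.
set A := integral _ _ _; set B := integral _ _ _.
have A0 : (0 <= A)%E by apply: integral_ge0 => s _; rewrite lee_fin le_max lexx orbT.
have B0 : (0 <= B)%E by apply: integral_ge0 => s _; rewrite lee_fin le_max lexx orbT.
(* When one of the parts is infinite, [fine] sends both sides to 0. *)
move: A B A0 B0 => [x| |] [y| |] // _ _; rewrite ?gt0_muley ?lte_fin//= ?mulr0//.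
by rewrite mulrBr.
Qed.

End radial_planes.

Section rotated_planes.
Context {R : realType} {N : nat}.
Implicit Types (x : 'rV[R]_N) (W : {vspace 'rV[R]_N}).

Lemma perp_decomp m W (B : 'M[R]_(m, N)) x : is_onb W B ->
  exists c : 'rV[R]_m, perp W x = x - c *m B.
Proof.
move=> [BB BW]; have : x *m (onb W)^T *m onb W \in W by rewrite mem_onb submxMl.
by rewrite BW => /submxP[c E]; exists c; rewrite /perp E.
Qed.

Lemma perp_orth W x : orth_to (perp W x) W.
Proof.
move=> w; rewrite mem_onb => /submxP[c ->].
rewrite /perp /dot trmx_mul mulmxBl !mulmxA.
by rewrite -[X in _ - X *m _]mulmxA onb_orth mulmx1 subrr mxE.
Qed.

Lemma is_onb_img m W (B : 'M[R]_(m, N)) (g : 'M[R]_N) : g *m g^T = 1%:M -> is_onb W B ->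
  is_onb (linfun (mulmxr g) @: W)%VS (B *m g).
Proof.
move=> gg [BB BW]; split; first by rewrite trmx_mul mulmxA -(mulmxA B) gg mulmx1.
move=> x; apply/memv_imgP/submxP => [[w + ->]|[c ->]].
  by rewrite BW lfunE/= => /submxP[c ->]; exists c; rewrite mulmxA.
by exists (c *m B); rewrite ?BW ?submxMl// lfunE/= mulmxA.
Qed.

Lemma dot_mul_SO a (g : 'M[R]_N) x : SO_perp a g -> dot (x *m g) a = dot x a.
Proof. by move=> [gg _ ag]; rewrite -{1}ag (dot_mulmx_orth _ _ gg). Qed.

Lemma mem_mul_SO a (g : 'M[R]_N) x : SO_perp a g -> (x *m g \in hyperplane a) = (x \in hyperplane a).
Proof. by move=> Sg; rewrite !mem_hyperplane dot_mul_SO. Qed.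

Lemma sqr_dot_le x y : dot x x = 1 -> dot x y ^+ 2 <= dot y y.
Proof.
move=> x1; have := dot_ge0 (y - dot x y *: x).
rewrite !(dotBl, dotBr, dotZl, dotZr) x1 (dotC y x) => h; rewrite -subr_ge0.
by move: h; congr (0 <= _); ring.
Qed.

End rotated_planes.

Section mean_values.
Context {R : realType} {N : nat} (a : 'rV[R]_N) (mu : probability 'M[R]_N R).
Hypotheses (haar_mu : is_haar a mu) (N2 : (2 < N)%N) (a0 : a != 0).
Variable e : 'rV[R]_N.
Hypotheses (eH : e \in hyperplane a) (e1 : enorm e = 1).
Let SO := SO_perp a.
Let mSO : measurable SO := measurable_SO_perp a.

Definition sphere_mean (psi : 'rV[R]_N -> R) (y : 'rV[R]_N) (s : R) : R :=
  \int[mu]_(g in SO) psi (y + s *: (e *m g)).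

Lemma measurable_sphere_mean psi : measurable_fun setT (psi : _ -> measurableTypeR R) ->
  measurable_fun setT (fun p : 'rV[R]_N * measurableTypeR R => sphere_mean psi p.1 p.2 : measurableTypeR R).
Proof.
move=> mpsi; apply: (@measurable_fun_Rintegral R _ _ ('rV[R]_N * measurableTypeR R)%type _ mu SO
  (fun p g => psi (p.1 + p.2 *: (e *m g)))) => //.
by meas.
Qed.

Section planes.
Variables (n : nat) (tau0 : {vspace 'rV[R]_N}) (B0 : 'M[R]_(n.+1, N)).
Hypotheses (tauH : (tau0 <= hyperplane a)%VS) (tauB : is_onb tau0 B0) (etau : orth_to e tau0).

Lemma enorm_direction w v : enorm (w *: e + v *m B0) = Num.sqrt (w ^+ 2 + dot v v).
Proof.
have [BB BW] := tauB.
have eB : dot e (v *m B0) = 0 by apply: etau; rewrite BW submxMl.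
rewrite /enorm !(dotDl, dotDr, dotZl, dotZr) (dotC (v *m B0) e) eB (dot_mulmx_orth _ _ BB).
by rewrite -(sqr_enorm e) e1; congr Num.sqrt; ring.
Qed.

Lemma direction_mem w v : w *: e + v *m B0 \in hyperplane a.
Proof.
have [BB BW] := tauB.
by rewrite memvD ?memvZ// (subvP tauH)// BW submxMl.
Qed.

Lemma ge0_haar_direction (F : 'rV[R]_N -> \bar R) y w v :
  measurable_fun setT F -> (forall x, 0 <= F x)%E ->
  (\int[mu]_(g in SO) F (y + (w *: e + v *m B0) *m g)%R =
   \int[mu]_(g in SO) F (y + (Num.sqrt (w ^+ 2 + dot v v) *: e) *m g)%R)%E.
Proof.
move=> mF F0; apply: (haar_orbit haar_mu N2 a0 (F := fun x => F (y + x)%R)) => //.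
- by meas.
- exact: direction_mem.
- by rewrite memvZ.
- by rewrite enorm_direction enormZ ?sqrtr_ge0// e1 mulr1.
Qed.

(** After Tonelli v is fixed; w e + v B0 then has length (w^2 + |v|^2)^(1/2), and the rotation mean
    depends on this length alone. The rest is polar coordinates in the plane. *)
Lemma ge0_mean_planes (F : 'rV[R]_N -> \bar R) y w : 0 < w ->
  measurable_fun setT F -> (forall x, 0 <= F x)%E ->
  (\int[mu]_(g in SO) \int[leb n.+1]_v F (y + (w *: e + v *m B0) *m g)%R =
   (@radial_cst R n)%:E * \int[lebesgue_measure]_(s in `]w, +oo[)
     ((\int[mu]_(g in SO) F (y + s *: (e *m g))%R) * (radial_weight n w s)%:E))%E.
Proof.
move=> w0 mF F0.
rewrite (@ge0_tonelli R _ _ _ _ mu (leb n.+1) SO setT (fun g v => F (y + (w *: e + v *m B0) *m g)%R));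
  [|by []|by []|by meas|by []].
under eq_integral do rewrite ge0_haar_direction//.
pose G (s : measurableTypeR R) := (\int[mu]_(g in SO) F (y + s *: (e *m g))%R)%E.
have mG : measurable_fun setT G.
  by apply: (@measurable_fun_integral2 R _ _ (measurableTypeR R) _ mu SO (fun s g => F (y + s *: (e *m g))%R)) => //; meas.
have G0 s : (0 <= G s)%E by apply: integral_ge0.
transitivity (\int[leb n.+1]_v G (Num.sqrt (w ^+ 2 + dot v v)))%E; last exact: ge0_integral_plane.
by apply: eq_integral => v _; apply: eq_integral => g _; rewrite scalemxAl.
Qed.

Lemma mean_planes (psi : 'rV[R]_N -> R) y w : 0 < w ->
  measurable_fun setT (psi : _ -> measurableTypeR R) ->
  (\int[mu]_(g in SO) \int[leb n.+1]_v `|psi (y + (w *: e + v *m B0) *m g)%R|%:E < +oo)%E ->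
  \int[mu]_(g in SO) \int[leb n.+1]_v psi (y + (w *: e + v *m B0) *m g) =
   @radial_cst R n * \int[lebesgue_measure]_(s in `]w, +oo[)
     (sphere_mean psi y s * radial_weight n w s).
Proof.
move=> w0 mpsi foo.
have [||||_ _ ->] := @Rintegral_fubini R _ _ _ _ mu (leb n.+1) SO setT
  (fun g v => psi (y + (w *: e + v *m B0) *m g)) => //; first by meas.
have ms : measurable_fun setT (fun s : measurableTypeR R => sphere_mean psi y s : measurableTypeR R).
  apply: (measurable_fun_compr (measurable_sphere_mean mpsi) (h := fun s => (y, s))).
  by apply/measurable_fun_pairP; split; meas.
transitivity (\int[leb n.+1]_v sphere_mean psi y (Num.sqrt (w ^+ 2 + dot v v))); last exact: Rintegral_plane.
apply: eq_Rintegral => v _; rewrite /sphere_mean.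
have mh : measurable_fun setT (fun x => psi (y + x) : measurableTypeR R) by meas.
under [RHS]eq_Rintegral do rewrite scalemxAl.
apply: (@integral_signed_comp R _ _ _ _ _ _ mu mu SO SO (fun g => (w *: e + v *m B0) *m g)
  (fun g => (Num.sqrt (w ^+ 2 + dot v v) *: e) *m g) _ (fun x => psi (y + x)) mh) => F mF F0.
apply: (haar_orbit haar_mu N2 a0) => //.
- exact: direction_mem.
- by rewrite memvZ.
- by rewrite enorm_direction enormZ ?sqrtr_ge0// e1 mulr1.
Qed.

End planes.

Section planes_of_slices.
Variables (n : nat) (tau0 : {vspace 'rV[R]_N}) (B0 : 'M[R]_(n.+1, N)).
Hypotheses (tauH : (tau0 <= hyperplane a)%VS) (tauB : is_onb tau0 B0) (etau : orth_to e tau0).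
Variable f : 'rV[R]_N -> R.
Hypothesis cf : csphere f.
Variable g : set 'rV[R]_N -> R.
Hypothesis gf : {in parallel_planes a n.+2, forall zeta, g zeta = section_integral f zeta}.

(** The bound is uniform over planes because areas of sections are. Shifting v by c moves the origin
    of the plane to the foot of the perpendicular, as [slice_weight_bounded] requires. *)
Lemma abs_slice_pot_planes : exists K : R, forall y w (h : 'M[R]_N), y \in hyperplane a -> SO h ->
  (\int[leb n.+1]_v `|slice_pot a f (y + (w *: e + v *m B0) *m h)%R|%:E <= K%:E)%E.
Proof.
have [C C0 CP] := slice_sum_bounded a0 cf.
have [K KP] := slice_weight_bounded a0 n.
exists (C * K) => y w h yH Sh; have [hh _ _] := Sh.
have hB := is_onb_img hh tauB.
pose x := y + w *: (e *m h).
have xH : x \in hyperplane a by rewrite memvD// memvZ// mem_mul_SO.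
have WH : (linfun (mulmxr h) @: tau0 <= hyperplane a)%VS.
  by apply/subvP => z /memv_imgP[z' z'W ->]; rewrite lfunE/= mem_mul_SO// (subvP tauH).
have BH v : v *m (B0 *m h) \in hyperplane a.
  by apply: (subvP WH); have [_ ->] := hB; exact: submxMl.
have [c cE] := perp_decomp x hB.
set u := perp _ x in cE.
have uH : u \in hyperplane a by rewrite cE memvB.
have xE v : y + (w *: e + v *m B0) *m h = u + (v + c) *m (B0 *m h).
  by rewrite cE /x !mulmxDl -scalemxAl -(mulmxA v) (addrC (v *m _)) !addrA subrK.
under eq_integral do rewrite xE.
have mf := measurable_slice_pot a cf.
rewrite (integral_leb_shift c (F := fun v => (`|slice_pot a f (u + v *m (B0 *m h))|%:E))%E); [|by meas|by []].
apply: (@le_trans _ _ (C%:E * \int[leb n.+1]_v (slice_weight (u + v *m (B0 *m h)))%:E)%E); last first.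
  rewrite EFinM lee_wpmul2l ?lee_fin//; apply: KP WH hB uH _; exact: perp_orth.
rewrite -integralZl_nneg//; last 2 first.
- by rewrite /slice_weight; meas.
- by move=> v; rewrite lee_fin invr_ge0 sqrtr_ge0.
apply: ge0_le_integral => //.
- by meas.
- by rewrite /slice_weight; meas.
move=> v _; rewrite -EFinM lee_fin; apply: slice_pot_bound => //; apply: CP.
by rewrite memvD.
Qed.

(** [mean_dist] records a rotated plane by its foot, whereas [mean_planes] parametrises it from y +
    w e g; the two differ by a translation c within the plane, under which the integral is
    invariant. *)
Lemma mean_distE y w : 0 < w -> y \in hyperplane a ->
  mean_dist a mu tau0 e (Phi a g) y w =
  @radial_cst R n * \int[lebesgue_measure]_(s in `]w, +oo[)
     (sphere_mean (slice_pot a f) y s * radial_weight n w s).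
Proof.
move=> w0 yH; have mf := measurable_slice_pot a cf.
rewrite -(mean_planes tauH tauB etau)//; last first.
  have [K KP] := abs_slice_pot_planes.
  apply: (@le_lt_trans _ _ (\int[mu]_(h in SO) K%:E)%E); last by rewrite (integral_SO_cst haar_mu) ltry.
  apply: ge0_le_integral => //.
  - by move=> h _; apply: integral_ge0.
  - apply: measurable_funTS.
    by apply: (@measurable_fun_integral2 R _ _ _ _ (leb n.+1) setT
      (fun h v => `|slice_pot a f (y + (w *: e + v *m B0) *m h)|%:E)) => //; meas.
  - by move=> h Sh; exact: KP.
apply: eq_Rintegral => h; rewrite inE => Sh; have [hh _ _] := Sh.
have hB := is_onb_img hh tauB.
pose x := y + w *: (e *m h).
have xH : x \in hyperplane a by rewrite memvD// memvZ// mem_mul_SO.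
have WH : (linfun (mulmxr h) @: tau0 <= hyperplane a)%VS.
  by apply/subvP => z /memv_imgP[z' z'W ->]; rewrite lfunE/= mem_mul_SO// (subvP tauH).
have BH v : v *m (B0 *m h) \in hyperplane a.
  by apply: (subvP WH); have [_ ->] := hB; exact: submxMl.
have [c cE] := perp_decomp x hB.
have uH : perp (linfun (mulmxr h) @: tau0)%VS x \in hyperplane a by rewrite cE memvB.
rewrite /= (Phi_slice a0 cf (erefl _) gf WH hB uH (perp_orth _)).
set u := perp _ x in cE *.
have xE v : y + (w *: e + v *m B0) *m h = u + (v + c) *m (B0 *m h).
  by rewrite cE /x !mulmxDl -scalemxAl -(mulmxA v) (addrC (v *m _)) !addrA subrK.
under [RHS]eq_Rintegral do rewrite xE.
apply/esym; apply: (@integral_signed_comp R _ _ _ _ _ _ (leb n.+1) (leb n.+1) setT setT (fun v => v + c) id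
  _ (fun v => slice_pot a f (u + v *m (B0 *m h)))); last by meas.
by move=> F mF F0; exact: integral_leb_shift.
Qed.

(** Read backwards from the planes: the positive constant times the radial integral is a mean of
    plane integrals bounded by K. *)
Lemma sphere_mean_integrable y w : 0 < w -> y \in hyperplane a ->
  (\int[lebesgue_measure]_(s in `]w, +oo[)
     (`|sphere_mean (slice_pot a f) y s| * radial_weight n w s)%:E < +oo)%E.
Proof.
move=> w0 yH; have mf := measurable_slice_pot a cf.
have [K KP] := abs_slice_pot_planes.
have c0 : @radial_cst R n != 0.
  by rewrite mulf_neq0// fine_eq0 ?ball_volume_fin// gt_eqF// ball_volume_gt0.
have cp : 0 < @radial_cst R n by rewrite lt_neqAle eq_sym c0 radial_cst_ge0.
have W0 s : w < s -> 0 <= radial_weight n w s.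
  by move=> ws; rewrite mulr_ge0 ?powR_ge0// (ltW (lt_trans w0 ws)).
pose A := (\int[lebesgue_measure]_(s in `]w, +oo[)
     ((\int[mu]_(g in SO) `|slice_pot a f (y + s *: (e *m g))|%:E) * (radial_weight n w s)%:E))%E.
apply: (@le_lt_trans _ _ A).
  apply: ge0_le_integral => //.
  - by move=> s; rewrite /= in_itv/= andbT => ws; rewrite lee_fin mulr_ge0 ?W0.
  - apply: measurable_funTS; rewrite /radial_weight.
    have ms : measurable_fun setT (fun s : measurableTypeR R => sphere_mean (slice_pot a f) y s : measurableTypeR R).
      apply: (measurable_fun_compr (measurable_sphere_mean mf) (h := fun s => (y, s))).
      by apply/measurable_fun_pairP; split; meas.
    by meas.
  - apply: measurable_funTS; rewrite /radial_weight; apply: measurable_fun_mule; last by meas.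
    by apply: (@measurable_fun_integral2 R _ _ (measurableTypeR R) _ mu SO (fun s g => `|slice_pot a f (y + s *: (e *m g))|%:E)) => //; meas.
  - move=> s; rewrite /= in_itv/= andbT => ws; rewrite EFinM lee_wpmul2r ?lee_fin ?W0//.
    by apply: le_abse_Rintegral => //; meas.
have AK : ((@radial_cst R n)%:E * A <= K%:E)%E.
  have mA : measurable_fun setT (fun x => `|slice_pot a f x|%:E)%E by meas.
  have -> : ((@radial_cst R n)%:E * A =
    \int[mu]_(h in SO) \int[leb n.+1]_v `|slice_pot a f (y + (w *: e + v *m B0) *m h)|%:E)%E.
    by apply/esym; exact: (ge0_mean_planes tauH tauB etau y w0 mA).
  rewrite -[leRHS](integral_SO_cst haar_mu); apply: ge0_le_integral => //.
  - by move=> h _; apply: integral_ge0.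
  - apply: measurable_funTS.
    by apply: (@measurable_fun_integral2 R _ _ _ _ (leb n.+1) setT
      (fun h v => `|slice_pot a f (y + (w *: e + v *m B0) *m h)|%:E)) => //; meas.
  - by move=> h Sh; exact: KP.
rewrite ltey; apply/eqP => Aoo; move: AK; rewrite Aoo gt0_muley ?lte_fin//.
Qed.

End planes_of_slices.

(** Such a sphere lies outside the open unit ball. This provides the cut-off T = 1 + |y| for the
    tail integrals. *)
Lemma sphere_mean_out f y s : y \in hyperplane a -> 1 + enorm y <= s -> sphere_mean (slice_pot a f) y s = 0.
Proof.
move=> yH ys; rewrite /sphere_mean /Rintegral integral0_eq// => h Sh; have [hh _ _] := Sh.
rewrite slice_pot_out//.
have n1 : dot (e *m h) (e *m h) = 1 by rewrite (dot_mulmx_orth _ _ hh) -sqr_enorm e1 expr1n.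
have := sqr_dot_le y n1; rewrite -(sqr_enorm y) => h1.
rewrite !(dotDl, dotDr, dotZl, dotZr) n1 (dotC y) -(sqr_enorm y).
have y0 := enorm_ge0 y; move: (dot _ y) (enorm y) h1 ys y0 => c r h1 ys r0.
have : `|c| <= r by rewrite -(ger0_norm r0) -!sqrtr_sqr ler_wsqrtr.
rewrite ler_norml => /andP[c1 c2].
by nra.
Qed.

End mean_values.

Lemma dist_split3 (R : realFieldType) (p1 p2 p3 p4 eta : R) :
  `|p1 - p3| < eta / 3 -> `|p2 - p4| < eta / 3 -> `|p4 - p3| < eta / 3 -> `|p2 - p1| < eta.
Proof. by rewrite !ltr_norml => /andP[? ?] /andP[? ?] /andP[? ?]; apply/andP; split; lra. Qed.

(** * Continuity of spherical means away from tangency *)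

Section mean_continuity.
Context {R : realType} {N : nat} (a : 'rV[R]_N) (mu : probability 'M[R]_N R).
Hypotheses (haar_mu : is_haar a mu) (N2 : (2 < N)%N) (a0 : a != 0).
Variables (m : nat) (B : 'M[R]_(m.+2, N)).
Hypothesis HB : is_onb (hyperplane a) B.
Variable e : 'rV[R]_N.
Hypotheses (eH : e \in hyperplane a) (e1 : enorm e = 1).
Let SO := SO_perp a.
Let mSO : measurable SO := measurable_SO_perp a.
Let lam := @lebesgue_measure R.

Let sigma n : R := n.+1%:R * fine (@ball_volume R n.+1).

Let sigmaE n : sphere_int (fun _ : 'rV[R]_n.+1 => 1%E) = (sigma n)%:E.
Proof. by rewrite sphere_int_cst EFinM fineK// ball_volume_fin. Qed.

Let sigma_gt0 n : 0 < sigma n.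
Proof. by rewrite mulr_gt0// fine_gt0// ball_volume_gt0 -ge0_fin_numE ?ball_volume_fin// ltW// ball_volume_gt0. Qed.

(** In a^perp, of dimension m + 2, the coordinate along y has density proportional to (1 -
    z^2)^((m-1)/2), which is at most (1 - z^2)^(-1/2). *)
Lemma haar_zone (h : measurableTypeR R -> \bar R) y : measurable_fun setT h -> (forall z, 0 <= h z)%E ->
  y \in hyperplane a -> enorm y = 1 ->
  (\int[mu]_(g in SO) h (dot (e *m g) y) <=
   (sigma m / sigma m.+1)%:E * \int[lam]_z (h z * ((Num.sqrt (1 - z ^+ 2))^-1)%:E))%E.
Proof.
move=> mh h0 yH y1; have [BB BH] := HB.
have := haar_sphere haar_mu N2 a0 (F := fun x => h (dot x y)) HB _ _ eH e1.
move=> /(_ _ (fun _ => h0 _)) E.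
have {}E := E ltac:(by meas).
move: yH; rewrite BH => /submxP[c cE].
have c1 : enorm c = 1 by rewrite -y1 cE enorm_mulmx_orth.
have zE : (fun v : 'rV[R]_m.+2 => h (dot (v *m B) y)) = fun v => h (dot v c).
  by apply/funext => v; rewrite cE dot_mulmx_orth.
move: E; rewrite zE sphere_int_zone// !sigmaE => E.
set I := integral mu _ _ in E *.
have -> : I = ((sigma m.+1)^-1%:E * (I * (sigma m.+1)%:E))%E.
  by rewrite [X in (_ * X)%E]muleC muleA -EFinM mulVf ?mul1e// gt_eqF.
rewrite E (mulrC (sigma m)) [X in (_ <= X * _)%E]EFinM -[leRHS]muleA lee_wpmul2l ?lee_fin ?invr_ge0 ?(ltW (sigma_gt0 _))//.
rewrite muleC lee_wpmul2l ?lee_fin ?(ltW (sigma_gt0 _))//.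
apply: ge0_le_integral => //.
- by move=> z _; pos.
- by meas.
- by meas.
move=> z _; rewrite lee_wpmul2l// lee_fin ler_piMl ?invr_ge0 ?sqrtr_ge0//.
by rewrite exprn_ile1 ?sqrtr_ge0// -[leRHS]sqrtr1 ler_wsqrtr// gerBl sqr_ge0.
Qed.

Variable f : 'rV[R]_N -> R.
Hypothesis cf : csphere f.
Notation psi := (slice_pot a f).

(* y + s * e meets the unit sphere in the zone of directions e.y/|y| < zone y s. *)
Definition zone (y : 'rV[R]_N) (s : R) : R := (1 - dot y y - s ^+ 2) / (2 * s * enorm y).

Lemma zoneE y s (x : 'rV[R]_N) : y != 0 -> 0 < s -> enorm x = 1 ->
  1 - dot (y + s *: x) (y + s *: x) = 2 * s * enorm y * (zone y s - dot x (unitv y)).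
Proof.
move=> y0 s0 x1; have ny : enorm y != 0 by rewrite enorm_eq0.
rewrite /zone /unitv !(dotDl, dotDr, dotZl, dotZr) (dotC y x) -(sqr_enorm x) x1.
by field; rewrite ny gt_eqF.
Qed.

Lemma enorm_unitv (y : 'rV[R]_N) : y != 0 -> enorm (unitv y) = 1.
Proof. by move=> y0; rewrite /unitv enormZ ?invr_ge0 ?enorm_ge0// mulVf// enorm_eq0. Qed.

Lemma unitv_mem y : y \in hyperplane a -> unitv y \in hyperplane a.
Proof. by move=> yH; rewrite memvZ. Qed.

(** By [zoneE], 1 - |y + s x|^2 is affine in the coordinate of x along y, so the mean is bounded by
    an arcsine moment at c = [zone y s]. That c stays away from 1 and -1 means that the spheres stay
    away from tangency. *)
Lemma zone_moment delta : 0 < delta -> exists2 K : R, 0 <= K & forall y s,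
  y \in hyperplane a -> y != 0 -> 0 < s ->
  2 * delta <= `|zone y s - 1| -> 2 * delta <= `|zone y s + 1| ->
  (\int[mu]_(g in SO) ((1 - dot (y + s *: (e *m g)) (y + s *: (e *m g))) `^ (- (3 / 4)) *
     (dot (y + s *: (e *m g)) (y + s *: (e *m g)) < 1)%R%:R)%:E <=
   ((2 * s * enorm y) `^ (- (3 / 4)) * K)%:E)%E.
Proof.
move=> d0; have [K KP] := arcsine_moment d0.
exists (sigma m / sigma m.+1 * K) => [|y s yH y0 s0 z1 z2].
  rewrite mulr_ge0 ?divr_ge0 ?(ltW (sigma_gt0 _))// -lee_fin.
  (* K is nonnegative since it bounds a nonnegative integral at the admissible value c = 1 + 2
     delta. *)
  apply: le_trans (KP (1 + 2 * delta) _ _); first by apply: integral_ge0 => z _; pos.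
    by rewrite addrAC subrr add0r ger0_norm// mulr_ge0// ltW.
  by rewrite ger0_norm; lra.
have q0 : 0 < 2 * s * enorm y by rewrite !mulr_gt0 ?enorm_gt0.
pose h (z : measurableTypeR R) : \bar R := ((zone y s - z) `^ (- (3 / 4)) * (z < zone y s)%R%:R)%:E.
have mh : measurable_fun setT h by rewrite /h; meas.
have h0 z : (0 <= h z)%E by rewrite /h; pos.
have mfun : measurable_fun setT (fun g : 'M[R]_N => h (dot (e *m g) (unitv y))) by meas.
have -> : (\int[mu]_(g in SO) ((1 - dot (y + s *: (e *m g)) (y + s *: (e *m g))) `^ (- (3 / 4)) *
     (dot (y + s *: (e *m g)) (y + s *: (e *m g)) < 1)%R%:R)%:E =
   ((2 * s * enorm y) `^ (- (3 / 4)))%:E * \int[mu]_(g in SO) h (dot (e *m g) (unitv y)))%E.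
  rewrite -ge0_integralZl_EFin ?powR_ge0//; last exact: measurable_funTS.
  apply: eq_integral => g; rewrite inE => -[gg _ _].
  have x1 : enorm (e *m g) = 1 by rewrite enorm_mulmx_orth.
  rewrite -EFinM -[(_ < 1)%R]subr_gt0 (zoneE y0 s0 x1); congr EFin.
  rewrite pmulr_rgt0// subr_gt0.
  have [zc|zc] := ltP (dot (e *m g) (unitv y)) (zone y s); last by rewrite !mulr0.
  by rewrite !mulr1 powRM ?(ltW q0)// subr_ge0 ltW.
rewrite [leRHS]EFinM lee_wpmul2l ?lee_fin ?powR_ge0//.
apply: le_trans (haar_zone mh h0 (unitv_mem yH) (enorm_unitv y0)) _.
rewrite [leRHS]EFinM lee_wpmul2l ?lee_fin ?divr_ge0 ?(ltW (sigma_gt0 _))//.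
by apply: le_trans (KP _ z1 z2); under eq_integral do rewrite -EFinM.
Qed.

Lemma mem_sphere_mean y s g : y \in hyperplane a -> SO g -> y + s *: (e *m g) \in hyperplane a.
Proof. by move=> yH Sg; rewrite memvD// memvZ// mem_mul_SO. Qed.

Lemma slice_cut_integrable eps y s : 0 < eps -> y \in hyperplane a ->
  mu.-integrable SO (EFin \o (fun g => slice_cut a f eps (y + s *: (e *m g)))).
Proof.
move=> e0 yH; have [C C0 CP] := slice_sum_bounded a0 cf.
have mc := measurable_slice_cut a cf eps.
apply: (@le_integrable _ _ _ mu SO mSO _ (cst (C / eps)%:E)).
- by apply: measurable_funTS; apply: measurable_fun_EFin; meas.
- move=> g Sg; rewrite /= lee_fin [leRHS]ger0_norm ?divr_ge0 ?(ltW e0)//.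
  by apply: slice_cut_bound => //; apply: CP; exact: mem_sphere_mean.
- by apply/integrableP; split => //; rewrite (integral_SO_cst haar_mu) ltry.
Qed.

Lemma slice_cut_mean_continuous eps y t : 0 < eps -> y \in hyperplane a -> 0 < t ->
  {for t, continuous (sphere_mean a mu e (slice_cut a f eps) y)}.
Proof.
move=> e0 yH t0; have [C C0 CP] := slice_sum_bounded a0 cf.
have tI : t \in `]0, (t + 1)[%classic by rewrite inE/= in_itv/= t0 ltrDl ltr01.
apply: (continuity_under_integral mSO _ _ (g := cst (C / eps)) _ _ tI).
- by move=> s _; exact: slice_cut_integrable.
- apply: aeW => g Sg s _.
  apply: (@cvg_slice_cut R N a f a0 cf R (nbhs s) (fun s => y + s *: (e *m g))) => //.
    exact: mem_sphere_mean.
  by apply: cvg_rVD; [exact: cvg_cst|apply: cvg_rVZ; [exact: cvg_id|exact: cvg_cst]].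
- by apply: (integrableS measurableT mSO (@subsetT _ SO)); exact: finite_measure_integrable_cst.
- move=> s _; apply: aeW => g Sg; apply: slice_cut_bound => //; apply: CP.
  exact: mem_sphere_mean.
Qed.

Lemma sphere_mean_cut_dist C K eps y s : 0 < eps -> 0 <= C -> (forall y, y \in hyperplane a -> `|slice_sum a f y| <= C) ->
  y \in hyperplane a ->
  (\int[mu]_(g in SO) ((1 - dot (y + s *: (e *m g)) (y + s *: (e *m g))) `^ (- (3 / 4)) *
     (dot (y + s *: (e *m g)) (y + s *: (e *m g)) < 1)%R%:R)%:E <= K%:E)%E ->
  `|sphere_mean a mu e psi y s - sphere_mean a mu e (slice_cut a f eps) y s| <= C * eps `^ 4^-1 * K.
Proof.
move=> e0 C0 CP yH KP.
have mf := measurable_slice_pot a cf; have mc := measurable_slice_cut a cf eps.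
have md : measurable_fun setT (fun g => psi (y + s *: (e *m g)) - slice_cut a f eps (y + s *: (e *m g)) : measurableTypeR R).
  by meas.
have D : (\int[mu]_(g in SO) `|psi (y + s *: (e *m g)) - slice_cut a f eps (y + s *: (e *m g))|%:E <=
    (C * eps `^ 4^-1 * K)%:E)%E.
  rewrite [leRHS]EFinM; apply: le_trans (lee_wpmul2l _ KP); last by rewrite lee_fin mulr_ge0 ?powR_ge0.
  rewrite -ge0_integralZl_EFin ?mulr_ge0 ?powR_ge0//; last 2 first.
  - by move=> g _; pos.
  - by apply: measurable_funTS; meas.
  apply: ge0_le_integral => //.
  - by apply: measurable_funTS; meas.
  - by apply: measurable_funTS; meas.
  - move=> g Sg; rewrite -EFinM lee_fin; apply: slice_cut_diff => //; apply: CP.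
    exact: mem_sphere_mean.
have ic := slice_cut_integrable s e0 yH.
have id0 : mu.-integrable SO (EFin \o (fun g => psi (y + s *: (e *m g)) - slice_cut a f eps (y + s *: (e *m g)))).
  apply/integrableP; split; first by apply: measurable_funTS; apply: measurable_fun_EFin.
  by apply: le_lt_trans D _; rewrite ltry.
have -> : sphere_mean a mu e psi y s - sphere_mean a mu e (slice_cut a f eps) y s =
    \int[mu]_(g in SO) (psi (y + s *: (e *m g)) - slice_cut a f eps (y + s *: (e *m g))).
  apply/eqP; rewrite subr_eq -RintegralD//; apply/eqP.
  by apply: eq_Rintegral => g _; rewrite subrK.
by rewrite -lee_fin; apply: le_trans (le_abse_Rintegral _ _ _) D.
Qed.

(** For s near t the zone stays away from 1 and -1, so the means of [slice_cut] approximate those of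
    [slice_pot] uniformly with error of order eps^(1/4). The former are continuous by dominated
    convergence, and three thirds of eta finish the argument. *)
Lemma sphere_mean_continuous y t : y \in hyperplane a -> y != 0 -> 0 < t ->
  zone y t != 1 -> zone y t != -1 -> {for t, continuous (sphere_mean a mu e psi y)}.
Proof.
move=> yH y0 t0 zt1 zt2; have [C C0 CP] := slice_sum_bounded a0 cf.
have ny : 0 < enorm y by rewrite enorm_gt0.
(* A quarter of the distance, so that 2 delta is strictly below it and stays so for s near t. *)
pose delta := Num.min `|zone y t - 1| `|zone y t + 1| / 4.
have m0 : 0 < Num.min `|zone y t - 1| `|zone y t + 1|.
  by rewrite lt_min !normr_gt0 subr_eq0 zt1/= addr_eq0.
have d0 : 0 < delta by rewrite divr_gt0.
have [K K0 KP] := zone_moment d0.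
have cz : zone y s @[s --> t] --> zone y t.
  apply: cvgM; first by apply: cvgB; [exact: cvg_cst|apply: cvgM; exact: cvg_id].
  apply: cvgV; first by rewrite gt_eqF// !mulr_gt0.
  by apply: cvgM; [apply: cvgM; [exact: cvg_cst|exact: cvg_id]|exact: cvg_cst].
(* The bound of 2 s |y| from below for s > t/2 makes the power in [zone_moment] uniform. *)
pose q := (t * enorm y) `^ (- (3 / 4)).
have q0 : 0 < q by rewrite powR_gt0// mulr_gt0.
have near_bound : \forall s \near t, forall eps, 0 < eps ->
    `|sphere_mean a mu e psi y s - sphere_mean a mu e (slice_cut a f eps) y s| <= C * eps `^ 4^-1 * (q * K).
  have d1 : 2 * delta < `|zone y t - 1|.
    rewrite /delta (@lt_le_trans _ _ (Num.min `|zone y t - 1| `|zone y t + 1|))//; first by lra.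
    by rewrite ge_min lexx.
  have d2 : 2 * delta < `|zone y t + 1|.
    rewrite /delta (@lt_le_trans _ _ (Num.min `|zone y t - 1| `|zone y t + 1|))//; first by lra.
    by rewrite ge_min lexx orbT.
  have c1 : `|zone y s - 1| @[s --> t] --> `|zone y t - 1|.
    by apply: cvg_norm; apply: cvgB => //; exact: cvg_cst.
  have c2 : `|zone y s + 1| @[s --> t] --> `|zone y t + 1|.
    by apply: cvg_norm; apply: cvgD => //; exact: cvg_cst.
  have th : t / 2 < t by rewrite gtr_pMr// invf_lt1 ?ltr1n.
  near=> s.
  have s2 : t / 2 < s by near: s; exact: lt_nbhsr.
  have s0 : 0 < s by apply: lt_trans s2; rewrite divr_gt0.
  move=> eps e0; apply: sphere_mean_cut_dist => //.
  apply: le_trans (KP y s yH y0 s0 _ _) _.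
  - by apply: ltW; near: s; exact: (cvgr_gt _ c1).
  - by apply: ltW; near: s; exact: (cvgr_gt _ c2).
  - rewrite lee_fin ler_wpM2r// le_powRN//; first by rewrite mulr_gt0.
    by rewrite ler_pM2r//; lra.
have near_t := nbhs_singleton near_bound.
apply/cvgrPdist_lt => eta eta0.
pose L := C * (q * K) + 1.
have L0 : 0 < L by rewrite ltr_wpDl// mulr_ge0// mulr_ge0// ltW.
(* The fourth power undoes the exponent 1/4; the summand 1 in L keeps it positive and the inequality
   strict. *)
pose eps := (eta / (3 * L)) ^+ 4.
have b0 : 0 < eta / (3 * L) by rewrite divr_gt0// mulr_gt0.
have e0 : 0 < eps by rewrite exprn_gt0.
have epsE : eps `^ 4^-1 = eta / (3 * L).
  by rewrite /eps -powR_mulrn ?(ltW b0)// -powRrM mulfV ?powRr1// ltW.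
have Le : C * eps `^ 4^-1 * (q * K) < eta / 3.
  rewrite epsE [ltLHS](_ : _ = eta / 3 * ((C * (q * K)) / L)); last by field; rewrite gt_eqF.
  by rewrite gtr_pMr ?divr_gt0// ltr_pdivrMr// mul1r /L ltrDl.
have /cvgrPdist_lt /(_ (eta / 3)) cc := slice_cut_mean_continuous e0 yH t0.
have {}cc := cc ltac:(by rewrite divr_gt0).
near=> s.
have h1 : `|sphere_mean a mu e psi y s - sphere_mean a mu e (slice_cut a f eps) y s| < eta / 3.
  apply: le_lt_trans Le.
  by have /(_ eps e0) : forall eps, 0 < eps -> `|sphere_mean a mu e psi y s - sphere_mean a mu e (slice_cut a f eps) y s| <= C * eps `^ 4^-1 * (q * K) by near: s.
have h2 := le_lt_trans (near_t _ e0) Le.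
have h3 : `|sphere_mean a mu e (slice_cut a f eps) y t - sphere_mean a mu e (slice_cut a f eps) y s| < eta / 3 by near: s.
exact: dist_split3 h1 h2 h3.
Unshelve. all: by end_near. Qed.

End mean_continuity.

Section almost_everywhere.
Context {R : realType} {N : nat}.
Implicit Types (W : {vspace 'rV[R]_N}).

Lemma ae_memv W : {ae leb_on W, forall y, y \in W}.
Proof.
exists (~` [set x | x \in W]); split; last by move=> x.
  by apply: measurableC; exact: measurable_memv.
rewrite /= /leb_on /pushforward (_ : _ @^-1` _ = set0) ?measure0//.
by apply/seteqP; split => v //=; apply; rewrite /embed_onb mem_onb submxMl.
Qed.

Lemma ae_integral0 d (T : measurableType d) (m : {measure set T -> \bar R}) (b : T -> bool) :
  measurable_fun setT b -> (\int[m]_x ((b x)%:R : R)%:E = 0)%E -> {ae m, forall x, ~~ b x}.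
Proof.
move=> mb b0.
have mA : measurable [set x | b x].
  rewrite -[X in measurable X]setTI (_ : mkset _ = b @^-1` [set true]); first exact: mb.
  by apply/seteqP; split.
exists [set x | b x]; split => //; last by move=> x /= /negP; rewrite negbK.
transitivity (\int[m]_x (\1_[set x | b x] x : R)%:E)%E; first by rewrite integral_indic// setIT.
rewrite -b0; apply: eq_integral => x _; rewrite indicE; congr ((nat_of_bool _)%:R%:E).
by apply/idP/idP; rewrite inE.
Qed.

(** In polar coordinates a sphere about 0 is a single radius, a null set of the half-line. *)
Lemma ae_enorm_neq m W (B : 'M[R]_(m.+1, N)) (c : R) : is_onb W B ->
  {ae leb_on W, forall y, enorm y != c}.
Proof.
move=> WB; have [BB BW] := WB.
have mb : measurable_fun setT (fun y : 'rV[R]_N => (enorm y <= c) && (c <= enorm y)) by meas.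
suff : {ae leb_on W, forall y, ~~ ((enorm y <= c) && (c <= enorm y))}.
  by apply: filterS => y; apply: contraNN => /eqP ->; rewrite lexx.
apply: ae_integral0 => //.
rewrite (integral_leb_on WB (F := fun y => (((enorm y <= c) && (c <= enorm y))%:R)%:E)); [|by meas|by move=> y; pos].
under eq_integral do rewrite enorm_mulmx_orth//.
pose F (r : measurableTypeR R) : \bar R := (((r <= c) && (c <= r))%:R)%:E.
have mF : measurable_fun setT F by rewrite /F; meas.
have F0 r : (0 <= F r)%E by rewrite /F; pos.
rewrite (integral_leb_radial m mF F0).
rewrite (_ : integral _ _ _ = 0%E) ?mule0//.
rewrite (@ge0_negligible_integral _ _ _ lebesgue_measure _ [set c]) => //.
- apply: integral0_eq => r [_ rc]; rewrite /F.
  case: (boolP ((r <= c) && (c <= r))) => [/andP[h1 h2]|_]; last by rewrite mul0e.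
  by exfalso; apply: rc; apply/eqP; rewrite eq_le h1.
- by apply: measurable_funTS; meas.
- by move=> r; rewrite /= in_itv/= andbT => r0; rewrite mule_ge0// lee_fin exprn_ge0// ltW.
- exact: lebesgue_measure_set1.
Qed.

Lemma coord_le_enorm (x : 'rV[R]_N) j : `|x 0 j| <= enorm x.
Proof.
rewrite -sqrtr_sqr ler_wsqrtr// dotE (bigD1 j)//= -expr2 lerDl.
by apply: sumr_ge0 => k _; rewrite -expr2 sqr_ge0.
Qed.

End almost_everywhere.

(** * Pointwise inversion almost everywhere *)

Section inversion_pointwise.
Context {R : realType} {N : nat} (a : 'rV[R]_N) (mu : probability 'M[R]_N R).
Hypotheses (haar_mu : is_haar a mu) (N2 : (2 < N)%N) (a0 : a != 0).
Variables (m : nat) (B : 'M[R]_(m.+2, N)).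
Hypothesis HB : is_onb (hyperplane a) B.
Variable e : 'rV[R]_N.
Hypotheses (eH : e \in hyperplane a) (e1 : enorm e = 1).
Variables (n : nat) (tau0 : {vspace 'rV[R]_N}) (B0 : 'M[R]_(n.+1, N)).
Hypotheses (tauH : (tau0 <= hyperplane a)%VS) (tauB : is_onb tau0 B0) (etau : orth_to e tau0).
Variables (f : 'rV[R]_N -> R) (g : set 'rV[R]_N -> R).
Hypotheses (cf : csphere f)
  (gf : {in parallel_planes a n.+2, forall zeta, g zeta = section_integral f zeta}).

Lemma radial_cst_Gamma : @radial_cst R n * Gamma (n.+1%:R / 2) = 2 * pi `^ (n.+1%:R / 2).
Proof.
have [gE g0] := @Gamma_half R n.
have := @ball_volume_eGamma R n; rewrite gE -(fineK (ball_volume_fin n.+1)) -!EFinM => -[].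
by rewrite /radial_cst.
Qed.

(** [frac_D_tail] returns the spherical mean times |S^(d-1)| Gamma(d/2) / 2 = pi^(d/2), which the
    prefactor cancels. *)
Lemma frac_D_mean_dist y t : y \in hyperplane a -> y != 0 -> 0 < t ->
  zone y t != 1 -> zone y t != -1 ->
  pi `^ (- (n.+1%:R / 2)) * frac_D n.+1 (mean_dist a mu tau0 e (Phi a g) y) t =
  sphere_mean a mu e (slice_pot a f) y t.
Proof.
move=> yH y0 t0 z1 z2; have mf := measurable_slice_pot a cf.
have ms : measurable_fun setT (fun s : measurableTypeR R => sphere_mean a mu e (slice_pot a f) y s : measurableTypeR R).
  apply: (measurable_fun_compr (@measurable_sphere_mean R N a mu e _ mf) (h := fun s => (y, s))).
  by apply/measurable_fun_pairP; split; meas.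
rewrite (@frac_D_tail R n (radial_cst n) t (1 + enorm y) (sphere_mean a mu e (slice_pot a f) y)) //.
- have pi0 : 0 < pi `^ (n.+1%:R / 2) :> R by rewrite powR_gt0// pi_gt0.
  rewrite radial_cst_Gamma powRN; field.
  by rewrite gt_eqF.
- by move=> s; exact: sphere_mean_out.
- move=> w w0; apply: le_lt_trans (sphere_mean_integrable haar_mu N2 a0 eH e1 tauH tauB etau cf w0 yH).
  by under eq_integral do rewrite -mulrA.
- by move=> w w0; exact: (mean_distE haar_mu N2 a0 eH e1 tauH tauB etau cf gf).
- exact: (sphere_mean_continuous haar_mu N2 a0 HB eH e1 cf).
Qed.

(** The zone is 1 or -1 only at tangency, that is when |y| is 1 - t, 1 + t or t - 1, as the
    factorisations show; with y = 0 these are four null sets. *)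
Lemma ae_zone t : 0 < t -> {ae leb_on (hyperplane a), forall y, y != 0 /\ zone y t != 1 /\ zone y t != -1}.
Proof.
move=> t0.
have h1 := ae_enorm_neq 0 HB; have h2 := ae_enorm_neq (1 - t) HB.
have h3 := ae_enorm_neq (1 + t) HB; have h4 := ae_enorm_neq (t - 1) HB.
apply: filterS2 (filterI h1 h2) (filterI h3 h4) => y [y0 y1] [y2 y3].
have ny : 0 < enorm y by rewrite lt_neqAle eq_sym y0 enorm_ge0.
split; first by rewrite -enorm_eq0.
have q0 : 2 * t * enorm y != 0 by rewrite gt_eqF// !mulr_gt0.
rewrite /zone -(sqr_enorm y); split; rewrite -subr_eq0.
  rewrite (_ : _ - 1 = ((1 - t) - enorm y) * ((1 + t) + enorm y) / (2 * t * enorm y)); last first.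
    by field; rewrite !gt_eqF.
  apply: mulf_neq0; last by rewrite invr_eq0.
  apply: mulf_neq0; first by rewrite subr_eq0 eq_sym.
  by rewrite gt_eqF// addr_gt0// addr_gt0.
rewrite (_ : _ - -1 = ((1 + t) - enorm y) * (enorm y - (t - 1)) / (2 * t * enorm y)); last first.
  by field; rewrite !gt_eqF.
apply: mulf_neq0; last by rewrite invr_eq0.
by apply: mulf_neq0; rewrite subr_eq0// eq_sym.
Qed.

Lemma ae_inversion t : 0 < t -> {ae leb_on (hyperplane a), forall y,
  sphere_mean a mu e (slice_pot a f) y t =
  pi `^ (- (n.+1%:R / 2)) * frac_D n.+1 (mean_dist a mu tau0 e (Phi a g) y) t}.
Proof.
move=> t0; apply: filterS2 (ae_memv (hyperplane a)) (ae_zone t0) => y yH [y0 [z1 z2]].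
by rewrite frac_D_mean_dist.
Qed.

End inversion_pointwise.

Section mean_limit.
Context {R : realType} {N : nat} (a : 'rV[R]_N) (mu : probability 'M[R]_N R).
Hypotheses (haar_mu : is_haar a mu) (a0 : a != 0).
Variable e : 'rV[R]_N.
Hypotheses (eH : e \in hyperplane a) (e1 : enorm e = 1).
Variable f : 'rV[R]_N -> R.
Hypothesis cf : csphere f.

(** The potential is continuous at y because |y| differs from 1, and all points y + u e g approach y
    uniformly in g. *)
Lemma sphere_mean_cvg0 (T : Type) (F : set_system T) (u : T -> R) y : Filter F ->
  u k @[k --> F] --> 0 -> y \in hyperplane a -> dot y y != 1 ->
  sphere_mean a mu e (slice_pot a f) y (u k) @[k --> F] --> slice_pot a f y.
Proof.
move=> FF cu yH y1; have mf := measurable_slice_pot a cf.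
have mSO := measurable_SO_perp a.
apply/cvgrPdist_le => eta eta0.
have cy : slice_pot a f x @[x --> y] --> slice_pot a f y.
  by apply: (@cvg_slice_pot R N a f a0 cf _ (nbhs y) id y _ yH y1); exact: cvg_id.
move/cvgrPdist_lt/(_ eta eta0) : cy => /nbhs_ballP[delta /= d0 dP].
have : \forall k \near F, `|u k| < delta.
  have /cvgrPdist_lt /(_ delta d0) := cu.
  by apply: filterS => k; rewrite sub0r normrN.
apply: filterS => k kd.
have near_y g : SO_perp a g -> `|slice_pot a f y - slice_pot a f (y + u k *: (e *m g))| < eta.
  move=> [gg _ _]; apply: dP; split => //= i j; rewrite /ball/= ord1.
  have -> : y 0 j - (y + u k *: (e *m g)) 0 j = - (u k * (e *m g) 0 j).
    have E (p q : 'rV[R]_N) c : (p + c *: q) 0 j = p 0 j + c * q 0 j.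
      by rewrite mxE [X in _ + X]mxE.
    by rewrite E opprD addNKr.
  rewrite normrN normrM (le_lt_trans _ kd)// ler_piMr//.
  have <- : enorm (e *m g) = 1 by rewrite enorm_mulmx_orth.
  by apply: le_trans (coord_le_enorm (e *m g) j); rewrite mxE.
have mpsi : measurable_fun setT (fun g => slice_pot a f (y + u k *: (e *m g)) : measurableTypeR R) by meas.
have icst (c : R) : mu.-integrable (SO_perp a) (EFin \o cst c).
  by apply: (integrableS measurableT mSO (@subsetT _ _)); exact: finite_measure_integrable_cst.
have ipsi : mu.-integrable (SO_perp a) (EFin \o (fun g => slice_pot a f (y + u k *: (e *m g)))).
  apply: (le_integrable mSO _ _ (icst (`|slice_pot a f y| + eta))).
    by apply: measurable_funTS; exact: measurable_fun_EFin.
  move=> g Sg; rewrite /= lee_fin [leRHS]ger0_norm ?addr_ge0 ?(ltW eta0)//.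
  have := near_y g Sg; set p := slice_pot a f y; set q := slice_pot a f _ => h.
  rewrite -[q](subKr p) (le_trans (ler_normB _ _))// lerD2l ltW//.
have -> : slice_pot a f y - sphere_mean a mu e (slice_pot a f) y (u k) =
    \int[mu]_(g in SO_perp a) (slice_pot a f y - slice_pot a f (y + u k *: (e *m g))).
  rewrite RintegralB//; last exact: icst.
  by congr (_ - _); rewrite /Rintegral (integral_SO_cst haar_mu).
rewrite -lee_fin; apply: le_trans (le_abse_Rintegral _ _ _) _ => //; first by meas.
rewrite -[leRHS](integral_SO_cst haar_mu); apply: ge0_le_integral => //.
- by apply: measurable_funTS; meas.
- by move=> g Sg; rewrite lee_fin ltW// near_y.
Qed.

End mean_limit.

(** * Convergence in mean of order p *)

Section Lp_tools.
Context d {T : measurableType d} {R : realType}.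
Local Open Scope ereal_scope.

Lemma le_limn_einf (u v : (\bar R)^nat) : (forall n, u n <= v n) -> limn_einf u <= limn_einf v.
Proof.
move=> uv; rewrite !limn_einf_lim; apply: lee_lim; [exact: is_cvg_einfs|exact: is_cvg_einfs|].
apply: nearW => n; apply: le_ereal_inf_tmp => _ [k /= nk <-].
by apply: le_trans (uv k); apply: ereal_inf_lbound; exists k.
Qed.

Definition powint (m : {measure set T -> \bar R}) (p : R) (h : T -> R) : \bar R :=
  \int[m]_x (`|h x| `^ p)%:E.

Lemma powint_ge0 m p h : 0 <= powint m p h.
Proof. by apply: integral_ge0 => x _; rewrite lee_fin powR_ge0. Qed.

Lemma poweR_Lnorm_powint m p h : (p != 0)%R -> Lnorm m p%:E (EFin \o h) `^ p = powint m p h.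
Proof. by move=> p0; rewrite poweR_Lnorm//; apply: eq_integral => x _; rewrite poweR_EFin. Qed.

Lemma Lnorm_lty m p h : (p != 0)%R -> (Lnorm m p%:E (EFin \o h) < +oo) = (powint m p h < +oo).
Proof.
move=> p0; rewrite -poweR_Lnorm_powint//; apply/idP/idP; first exact: poweR_lty.
exact: lty_poweRy.
Qed.

Lemma Lnorm_le m p h (eta : R) : (0 < p)%R -> (0 <= eta)%R ->
  powint m p h <= (eta `^ p)%:E -> Lnorm m p%:E (EFin \o h) <= eta%:E.
Proof.
move=> p0 eta0; rewrite -poweR_Lnorm_powint ?gt_eqF// -poweR_EFin => le.
have p1 : (p * p^-1 = 1)%R by rewrite divff ?gt_eqF.
rewrite -[leLHS]poweRe1 ?Lnorm_ge0// -[leRHS]poweRe1 ?lee_fin// -p1 !poweRrM.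
apply: gt0_ler_poweR => //; first by rewrite invr_ge0 ltW.
  by rewrite in_itv/= leey andbT poweR_ge0.
by rewrite in_itv/= leey andbT lee_fin powR_ge0.
Qed.

Lemma cvg_Lnorm m p (S : Type) (F : set_system S) (h : S -> T -> R) : Filter F -> (0 < p)%R ->
  (Lnorm m p%:E (EFin \o h s) @[s --> F] --> 0) <-> (powint m p (h s) @[s --> F] --> 0).
Proof.
move=> FF p0; have pn0 : (p != 0)%R by rewrite gt_eqF.
have le0 (u : S -> \bar R) : (forall s, 0 <= u s) ->
    u s @[s --> F] --> 0 <-> forall eta : R, (0 < eta)%R -> \forall s \near F, u s <= eta%:E.
  move=> u0; split=> [/fine_cvgP[uf /cvgrPdist_le cu] eta eta0|H].
    apply: filterS2 uf (cu _ eta0) => s us; rewrite sub0r normrN ger0_norm ?fine_ge0// => us2.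
    by rewrite -(fineK us) lee_fin.
  apply/fine_cvgP; split.
    apply: filterS (H 1%R ltr01) => s us.
    by rewrite ge0_fin_numE// (le_lt_trans us)// ltry.
  apply/cvgrPdist_le => eta eta0; apply: filterS (H eta eta0) => s us.
  rewrite sub0r normrN /= ger0_norm ?fine_ge0// -lee_fin fineK// ge0_fin_numE//.
  by rewrite (le_lt_trans us)// ltry.
rewrite !le0; [|by move=> s; exact: Lnorm_ge0|by move=> s; exact: powint_ge0].
split=> H eta eta0.
  have e0 : (0 < eta `^ p^-1)%R by rewrite powR_gt0.
  apply: filterS (H _ e0) => s le; rewrite -poweR_Lnorm_powint//.
  rewrite (_ : eta%:E = (eta `^ p^-1)%:E `^ p); last first.
    by rewrite poweR_EFin -powRrM mulVf// powRr1// ltW.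
  by apply: gt0_ler_poweR => //; rewrite ?ltW// in_itv/= leey andbT ?Lnorm_ge0// lee_fin ltW.
have e0 : (0 < eta `^ p)%R by rewrite powR_gt0.
by apply: filterS (H _ e0) => s; apply: Lnorm_le => //; exact: ltW.
Qed.

Lemma powR_normB_le (p x y : R) : (0 <= p)%R ->
  (`|x - y| `^ p <= 2 `^ p * (`|x| `^ p + `|y| `^ p))%R.
Proof.
move=> p0; have : (`|x - y| <= 2 * Num.max `|x| `|y|)%R.
  rewrite (le_trans (ler_normB _ _))// mulrDl mul1r lerD// le_max lexx ?orbT//.
move=> le; apply: le_trans (ge0_ler_powR p0 _ _ le) _; rewrite ?nnegrE ?mulr_ge0 ?le_max ?normr_ge0//.
rewrite powRM ?le_max ?normr_ge0// ler_wpM2l ?powR_ge0//.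
by case: (leP `|x|%R `|y|%R) => _; rewrite ?lerDl ?lerDr powR_ge0.
Qed.

Lemma cvg_powR_norm (S : Type) (F : set_system S) (p : R) (u : S -> R) (l : R) : Filter F ->
  (0 < p)%R -> u s @[s --> F] --> l -> (`|u s| `^ p)%R @[s --> F] --> (`|l| `^ p)%R.
Proof.
move=> FF p0 cu; case: (eqVneq l 0%R) => [l0|l0]; last first.
  apply: (@cvg_comp _ _ _ (fun s => `|u s|%R) (fun x => x `^ p)%R F (nbhs `|l|%R)).
    exact: cvg_norm.
  by apply: continuous_powR; rewrite normr_gt0.
rewrite l0 normr0 powR0 ?gt_eqF//; apply/cvgrPdist_le => eta eta0.
have e0 : (0 < eta `^ p^-1)%R by rewrite powR_gt0.
move/cvgrPdist_le/(_ _ e0) : cu; 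
apply: filterS => s; rewrite l0 !sub0r !normrN => us.
rewrite ger0_norm ?powR_ge0//.
rewrite (_ : eta = (eta `^ p^-1) `^ p)%R; first by rewrite ge0_ler_powR ?nnegrE// ltW.
by rewrite -powRrM mulVf ?gt_eqF// powRr1// ltW.
Qed.

(** Hölder's inequality against the constant 1, whose norm is 1 for a probability; p = 1 is apart
    since its conjugate exponent is infinite. *)
Lemma powR_jensen (m : probability T R) (A : set T) (p : R) (h : T -> R) : (1 <= p)%R ->
  measurable A -> m A = 1 -> measurable_fun setT (h : T -> measurableTypeR R) ->
  (`|\int[m]_(x in A) h x| `^ p)%R%:E <= \int[m]_(x in A) (`|h x| `^ p)%:E.
Proof.
move=> p1 mA A1 mh.
have full (F : T -> \bar R) : measurable_fun setT F -> (forall x, 0 <= F x) ->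
    \int[m]_(x in A) F x = \int[m]_x F x.
  move=> mF F0; rewrite [RHS](@ge0_negligible_integral _ _ _ _ _ (~` A)) ?setDE ?setCK ?setTI//.
    exact: measurableC.
  transitivity (1 - m A); last by rewrite A1 subee.
  exact: probability_setC.
have le1 := le_abse_Rintegral m mA mh.
move: le1; rewrite (full (fun x => `|h x|%:E)); [|by meas|by []] => le1.
rewrite full; [|by meas|by move=> x; rewrite lee_fin powR_ge0].
have {p1} [p1|p1] : (p = 1 \/ 1 < p)%R by move: p1; rewrite le_eqVlt => /predU1P[<-|]; [left|right].
  rewrite p1 powRr1//; apply: le_trans le1 _.
  by rewrite le_eqVlt; apply/orP; left; apply/eqP/eq_integral => x _; rewrite powRr1.
have p0 : (0 < p)%R by rewrite (lt_trans ltr01).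
pose q := (p / (p - 1))%R.
have q0 : (0 < q)%R by rewrite divr_gt0// subr_gt0.
have pq : (p^-1 + q^-1 = 1)%R by rewrite /q invf_div; field; rewrite gt_eqF.
have := hoelder m mh (@measurable_cst _ _ T (measurableTypeR R) setT 1%R) p0 q0 pq.
rewrite (_ : EFin \o cst 1%R = cst 1); last by [].
have N1 : Lnorm m q%:E (cst 1) = 1.
  transitivity ((1 : \bar R) `^ q^-1); last exact: poweR1r.
  by rewrite Lnorm_cst1; congr (_ `^ _); exact: probability_setT.
rewrite N1 mule1 Lnorm1.
have -> : \int[m]_x `|(EFin \o (h \* cst 1)%R) x| = \int[m]_x `|h x|%:E.
  by apply: eq_integral => x _; rewrite /= [X in `|X|%R]mulr1.
move=> le2; rewrite -/(powint m p h) -poweR_Lnorm_powint ?gt_eqF// -poweR_EFin.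
apply: gt0_ler_poweR; [exact: ltW|by rewrite in_itv/= leey andbT lee_fin| |exact: le_trans le1 le2].
by rewrite in_itv/= leey andbT Lnorm_ge0.
Qed.

(** Fatou's lemma for the nonnegative functions 2^p (|M_k|^p + |psi|^p) - |M_k - psi|^p. The bound
    on the norms of M_k takes the place of a dominating function. *)
Lemma powint_cvg (m : {measure set T -> \bar R}) (p : R) (M : nat -> T -> R) (psi : T -> R) :
  (0 < p)%R -> (forall k, measurable_fun setT (M k : T -> measurableTypeR R)) ->
  measurable_fun setT (psi : T -> measurableTypeR R) ->
  {ae m, forall x, M k x @[k --> \oo] --> psi x} ->
  powint m p psi < +oo -> (forall k, powint m p (M k) <= powint m p psi) ->
  powint m p (fun x => M k x - psi x)%R @[k --> \oo] --> 0.
Proof.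
move=> p0 mM mpsi [Z [mZ Z0 ZP]] psifin Mle.
pose D := ~` Z; have mD : measurable D by exact: measurableC.
have cvg_off x : D x -> M k x @[k --> \oo] --> psi x.
  by move=> Dx; apply: contrapT => nc; apply: Dx; exact: ZP.
have full (F : T -> \bar R) : measurable_fun setT F -> (forall x, 0 <= F x) ->
    \int[m]_(x in D) F x = \int[m]_x F x.
  move=> mF F0; rewrite [RHS](@ge0_negligible_integral _ _ _ _ _ Z) ?setDE ?setTI//.
pose c : R := (2 `^ p)%R; have c0 : (0 <= c)%R by exact: powR_ge0.
pose h k x : R := (c * (`|M k x| `^ p + `|psi x| `^ p) - `|M k x - psi x| `^ p)%R.
have h0 k x : (0 <= h k x)%R by rewrite subr_ge0 powR_normB_le// ltW.
have mh k : measurable_fun setT (h k : T -> measurableTypeR R).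
  by rewrite /h; have mMk := mM k; meas.
pose del k := powint m p (fun x => M k x - psi x)%R.
have sumE k : \int[m]_x (h k x)%:E + del k = c%:E * (powint m p (M k) + powint m p psi).
  have mMk := mM k.
  rewrite /del /powint -!ge0_integralD//; try by meas.
  - rewrite -ge0_integralZl//; try by meas.
      by apply: eq_integral => x _; rewrite -!EFinD -EFinM /h subrK.
    by move=> x _; rewrite lee_fin addr_ge0 ?powR_ge0.
  - by move=> x _; rewrite lee_fin.
  - by apply: measurable_fun_EFin; exact: mh.
pose K := c%:E * (powint m p psi + powint m p psi).
have psif : powint m p psi \is a fin_num by rewrite ge0_fin_numE// powint_ge0.
have Kf : K \is a fin_num by apply: fin_numM => //; rewrite fin_numD psif.
have KE : K = c%:E * (powint m p psi + powint m p psi) by [].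
have del0 k : 0 <= del k by exact: powint_ge0.
have delE : del = (fun k => powint m p (fun x => M k x - psi x)%R) by [].
clearbody K del.
have Kle k : \int[m]_x (h k x)%:E + del k <= K.
  rewrite sumE KE; apply: lee_wpmul2l; [by rewrite lee_fin|by apply: leeD2r].
have hi0 k : 0 <= \int[m]_x (h k x)%:E by apply: integral_ge0 => x _; rewrite lee_fin.
have delf k : del k \is a fin_num.
  rewrite ge0_fin_numE//; apply: le_lt_trans (_ : K < +oo); last by rewrite ltey_eq Kf.
  by apply: le_trans (Kle k); rewrite leeDr.
have hle k : \int[m]_(x in D) (h k x)%:E <= K + - del k.
  rewrite full; [|by apply: measurable_fun_EFin; exact: mh|by move=> x; rewrite lee_fin].
  by rewrite leeBrDr.
have hlim x : D x -> limn_einf (fun k => (h k x)%:E) = (c * (`|psi x| `^ p + `|psi x| `^ p))%:E.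
  move=> Dx; apply: (cvg_limn_einf_sup _).1; apply: cvg_EFin; first exact: nearW.
  rewrite (_ : fine \o _ = h ^~ x)//.
  have cM := cvg_off x Dx.
  rewrite -[X in _ --> X]subr0; apply: cvgB.
    apply: cvgM; first exact: cvg_cst.
    by apply: cvgD; [exact: cvg_powR_norm|exact: cvg_cst].
  have c0' : (M k x - psi x)%R @[k --> \oo] --> (psi x - psi x)%R by apply: cvgB => //; exact: cvg_cst.
  rewrite [X in _ --> X](_ : _ = (`|psi x - psi x| `^ p)%R); first exact: cvg_powR_norm.
  by rewrite subrr normr0 powR0// gt_eqF.
have K2 : \int[m]_(x in D) limn_einf (fun k => (h k x)%:E) = K.
  transitivity (\int[m]_(x in D) (c * (`|psi x| `^ p + `|psi x| `^ p))%:E).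
    by apply: eq_integral => x /set_mem Dx; rewrite hlim.
  rewrite full; [|by meas|by move=> x; rewrite lee_fin mulr_ge0// addr_ge0// powR_ge0].
  rewrite KE /powint -!ge0_integralD//; try by meas.
  rewrite -ge0_integralZl//; try by meas.
  by move=> x _; rewrite adde_ge0// lee_fin powR_ge0.
rewrite -delE; apply: limn_esup_le_cvg => //.
(* This says K <= K - limsup [del]; as K is finite, the limsup is at most 0. *)
have : K <= limn_einf (fun k => K + - del k).
  rewrite -{1}K2; apply: le_trans (fatou m mD _ _) _ => //.
    by move=> k; apply: measurable_funTS; apply: measurable_fun_EFin; exact: mh.
    by move=> k x _; rewrite lee_fin.
  exact: le_limn_einf.
rewrite limn_einf_shift// (_ : (fun k => - del k) = -%E \o del)// limn_einfN.
by case: (limn_esup del) => [s| |]; case: (K) Kf => [r| |]//= _; rewrite !lee_fin; lra.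
Qed.

End Lp_tools.

Section Lp_potential.
Context {R : realType} {N : nat} (a : 'rV[R]_N).
Local Notation lam := (leb_on (hyperplane a)).

Lemma in_LpE p psi : p != 0 -> measurable_fun setT (psi : 'rV[R]_N -> measurableTypeR R) ->
  in_Lp a p psi <-> (powint lam p psi < +oo)%E.
Proof. by move=> p0 mpsi; rewrite /in_Lp Lnorm_lty//; split=> [[]|]. Qed.

Section contraction.
Variable mu : probability 'M[R]_N R.
Hypothesis haar_mu : is_haar a mu.
Variable e : 'rV[R]_N.
Hypothesis eH : e \in hyperplane a.

(** Jensen's inequality inside, Tonelli, and then translation invariance on a^perp for each
    rotation. *)
Lemma powint_sphere_mean p psi t : 1 <= p -> measurable_fun setT (psi : 'rV[R]_N -> measurableTypeR R) ->
  (powint lam p (fun y => sphere_mean a mu e psi y t) <= powint lam p psi)%E.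
Proof.
move=> p1 mpsi; have mSO := measurable_SO_perp a; have HB := is_onb_onb (hyperplane a).
have mM := @measurable_sphere_mean R N a mu e _ mpsi.
have mMt : measurable_fun setT (fun y => sphere_mean a mu e psi y t : measurableTypeR R).
  by apply: (measurable_fun_compr mM (h := fun y => (y, t))); apply/measurable_fun_pairP; split; meas.
have mG : measurable_fun setT (fun q : 'rV[R]_N * 'M[R]_N => (`|psi (q.1 + t *: (e *m q.2))%R| `^ p)%:E).
  by meas.
apply: (@le_trans _ _ (\int[lam]_y \int[mu]_(g in SO_perp a) (`|psi (y + t *: (e *m g))%R| `^ p)%:E)%E).
  apply: ge0_le_integral => //.
  - by meas.
  - apply: (@measurable_fun_integral2 R _ _ 'rV[R]_N 'M[R]_N mu _
      (fun y g => (`|psi (y + t *: (e *m g))%R| `^ p)%:E)) => //.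
  - by move=> y _; apply: powR_jensen => //; [exact: haar_mu.1|meas].
rewrite (integral_leb_on HB (F := fun y => (\int[mu]_(g in SO_perp a) (`|psi (y + t *: (e *m g))%R| `^ p)%:E)%E)); last 2 first.
- by apply: (@measurable_fun_integral2 R _ _ 'rV[R]_N 'M[R]_N mu _
      (fun y g => (`|psi (y + t *: (e *m g))%R| `^ p)%:E)).
- by move=> y; apply: integral_ge0 => g _; rewrite lee_fin powR_ge0.
rewrite (@ge0_tonelli R _ _ _ _ (leb _) mu setT (SO_perp a)
  (fun v g => (`|psi (v *m onb (hyperplane a) + t *: (e *m g))%R| `^ p)%:E)) => //; last by meas.
rewrite -[leRHS](integral_SO_cst haar_mu) le_eqVlt; apply/orP; left; apply/eqP.
apply: eq_integral => g /set_mem Sg.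
rewrite -(integral_leb_on HB (F := fun y => (`|psi (y + t *: (e *m g))%R| `^ p)%:E)); [|by meas|by move=> y; pos].
by rewrite (integral_leb_on_shift (F := fun y => (`|psi y%R| `^ p)%:E)) ?memvZ ?mem_mul_SO//; meas.
Qed.

End contraction.

Variables (m : nat) (B : 'M[R]_(m.+2, N)).
Hypothesis HB : is_onb (hyperplane a) B.
Variable f : 'rV[R]_N -> R.
Hypotheses (a0 : a != 0) (cf : csphere f).

Let head (k : R) (w : measurableTypeR R) : \bar R := (w `^ (- k) * ((0 < w) && (w <= 1))%:R)%:E.

Let integral_head k : k < 1 -> (\int[@lebesgue_measure R]_(u in `]0%R, +oo[) head k (1 - u)%R < +oo)%E.
Proof.
move=> k1; have mh : measurable_fun setT (head k) by rewrite /head; meas.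
have h0 w : (0 <= head k w)%E by rewrite /head; pos.
apply: (@le_lt_trans _ _ (\int[@lebesgue_measure R]_u head k (1 - u)%R)%E).
  by apply: ge0_subset_integral => //; meas.
under eq_integral do rewrite addrC.
rewrite (integral_reflect (F := fun x => head k (x + 1)%R)); [|by meas|by []].
rewrite integral_shift//.
rewrite (_ : integral _ _ _ = (\int[@lebesgue_measure R]_(w in `]0%R, +oo[) (w `^ (- k) * (w <= 1)%R%:R)%:E)%E).
  by rewrite integral_pow_head// ltry.
rewrite [RHS]integral_mkcond; apply: eq_integral => w _; rewrite patchE /head.
have -> : (w \in `]0, +oo[%classic) = (0 < w) by apply/idP/idP; rewrite inE/= in_itv/= andbT.
by case: (0 < w); rewrite //= mulr0.
Qed.

(** |psi|^p is at most a multiple of (1 - |y|^2)^(-p/2), and p/2 < 1. In polar coordinates the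
    factor r^(m+1) is at most 2 r for r < 1, which is the Jacobian of u = r^2. *)
Lemma in_Lp_slice_pot p : 1 <= p < 2 -> in_Lp a p (slice_pot a f).
Proof.
move=> /andP[p1 p2]; have p0 : 0 < p by rewrite (lt_le_trans ltr01).
have mpsi := measurable_slice_pot a cf.
apply/in_LpE => //; first by rewrite gt_eqF.
have [C C0 CP] := slice_sum_bounded a0 cf.
have [BB BW] := HB.
pose k := p / 2; have k1 : k < 1 by rewrite /k; lra.
have mh : measurable_fun setT (head k) by rewrite /head; meas.
have h0 w : (0 <= head k w)%E by rewrite /head; pos.
rewrite /powint (integral_leb_on HB (F := fun y => (`|slice_pot a f y| `^ p)%:E)); [|by meas|by move=> y; pos].
pose F (r : measurableTypeR R) : \bar R := ((C `^ p)%:E * head k (1 - r ^+ 2)%R)%E.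
have mF : measurable_fun setT F by rewrite /F; meas.
have F0 r : (0 <= F r)%E by rewrite mule_ge0// lee_fin powR_ge0.
apply: (@le_lt_trans _ _ (\int[leb m.+2]_v F (enorm v))%E).
  apply: ge0_le_integral => //; [by meas|by meas|move=> v _].
  have yH : v *m B \in hyperplane a by rewrite BW submxMl.
  have vv : dot (v *m B) (v *m B) = enorm v ^+ 2 by rewrite dot_mulmx_orth// sqr_enorm.
  have [le1|lt1] := leP 1 (dot (v *m B) (v *m B)).
    by rewrite slice_pot_out// normr0 powR0 ?gt_eqF// F0.
  rewrite /F /head -EFinM lee_fin -vv subr_gt0 lt1 /= lerBlDr lerDl dot_ge0 mulr1.
  apply: le_trans (ge0_ler_powR (ltW p0) _ _ (slice_pot_bound C0 (CP _ yH))) _; rewrite ?nnegrE ?divr_ge0 ?sqrtr_ge0//.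
  rewrite powRM ?invr_ge0 ?sqrtr_ge0// ler_wpM2l ?powR_ge0// -powR12_sqrt ?subr_ge0; last exact: ltW.
  by rewrite -powRN -powRrM /k mulNr mulrC.
rewrite (integral_leb_radial m.+1 mF F0) lte_mul_pinfty//.
- by rewrite mule_ge0// ?lee_fin// ltW// ball_volume_gt0.
- by rewrite fin_numM// ball_volume_fin.
apply: (@le_lt_trans _ _ ((C `^ p)%:E * \int[@lebesgue_measure R]_(u in `]0%R, +oo[) head k (1 - u)%R)%E); last first.
  by rewrite lte_mul_pinfty ?lee_fin ?powR_ge0// integral_head.
rewrite -ge0_integralZl//; [|by apply: measurable_funTS; meas|by rewrite lee_fin powR_ge0].
rewrite (integral_sqr (F := fun u => ((C `^ p)%:E * head k (1 - u)%R)%E)); [|by meas|by move=> x _; rewrite mule_ge0// lee_fin powR_ge0].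
apply: ge0_le_integral => //.
- by move=> r /=; rewrite in_itv/= andbT => r0; rewrite mule_ge0// lee_fin exprn_ge0// ltW.
- by apply: measurable_funTS; meas.
- by apply: measurable_funTS; meas.
move=> r /=; rewrite in_itv/= andbT => r0.
rewrite -/(F r); have [r1|r1] := leP 1 (r ^+ 2).
  by rewrite /F /head ltNge lerBlDr add0r r1 mulr0 mule0 !mul0e.
apply: lee_wpmul2l => //; rewrite lee_fin exprS.
have rm : r ^+ m <= 1.
  by rewrite exprn_ile1// ltW//; move: r1; rewrite expr_lt1// ltW.
have : r * r ^+ m <= r * 1 by rewrite ler_wpM2l// ltW.
by rewrite mulr1; lra.
Qed.

End Lp_potential.

Section radon_john.
Context {R : realType} {N : nat} (a : 'rV[R]_N) (mu : probability 'M[R]_N R).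
Hypotheses (haar_mu : is_haar a mu) (N2 : (2 < N)%N) (a0 : a != 0).
Variables (m : nat) (B : 'M[R]_(m.+2, N)).
Hypothesis HB : is_onb (hyperplane a) B.
Variable e : 'rV[R]_N.
Hypotheses (eH : e \in hyperplane a) (e1 : enorm e = 1).
Variables (n : nat) (tau0 : {vspace 'rV[R]_N}) (B0 : 'M[R]_(n.+1, N)).
Hypotheses (tauH : (tau0 <= hyperplane a)%VS) (tauB : is_onb tau0 B0) (etau : orth_to e tau0).
Variables (f : 'rV[R]_N -> R) (g : set 'rV[R]_N -> R).
Hypotheses (cf : csphere f)
  (gf : {in parallel_planes a n.+2, forall zeta, g zeta = section_integral f zeta}).
Local Notation lam := (leb_on (hyperplane a)).

Lemma ae_sphere_mean_cvg (u : nat -> R) : u k @[k --> \oo] --> 0 ->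
  {ae lam, forall y, sphere_mean a mu e (slice_pot a f) y (u k) @[k --> \oo] --> slice_pot a f y}.
Proof.
move=> cu; apply: filterS2 (ae_memv (hyperplane a)) (ae_enorm_neq 1 HB) => y yH y1.
apply: sphere_mean_cvg0 => //; apply: contra y1 => /eqP yy.
by rewrite /enorm yy sqrtr1.
Qed.

(** The spherical means are the representatives F t: almost everywhere equal to the fractional
    derivatives, and in L^p by contraction. The limit t -> 0 is tested on sequences, as Fatou's
    lemma demands. *)
Lemma radon_john_inv_slice_pot p : 1 <= p -> in_Lp a p (slice_pot a f) ->
  is_radon_john_inv a mu tau0 e p (Phi a g) (slice_pot a f).
Proof.
move=> p1 Lpsi; have p0 : 0 < p by rewrite (lt_le_trans ltr01).
have pn0 : p != 0 by rewrite gt_eqF.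
have mpsi := measurable_slice_pot a cf.
have mM := @measurable_sphere_mean R N a mu e _ mpsi.
have mMt t : measurable_fun setT (fun y => sphere_mean a mu e (slice_pot a f) y t : measurableTypeR R).
  by apply: (measurable_fun_compr mM (h := fun y => (y, t))); apply/measurable_fun_pairP; split; meas.
have fin : (powint lam p (slice_pot a f) < +oo)%E by apply/(in_LpE a pn0 mpsi).
split; first exact: Lpsi.
exists (fun t y => sphere_mean a mu e (slice_pot a f) y t); split.
- move=> t t0; apply/(in_LpE a pn0 (mMt t)).
  by apply: le_lt_trans fin; exact: powint_sphere_mean.
- by move=> t t0; rewrite (is_onb_dim tauB); exact: (ae_inversion haar_mu N2 a0 HB eH e1 tauH tauB etau cf gf).
- apply/(cvge_at_rightP _ 0 0) => u [u0 cu].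
  apply/(cvg_Lnorm lam (fun k y => sphere_mean a mu e (slice_pot a f) y (u k) - slice_pot a f y) _ p0).
  apply: powint_cvg; [exact: p0|by move=> k; exact: mMt|exact: mpsi|exact: ae_sphere_mean_cvg|exact: fin|].
  by move=> k; exact: powint_sphere_mean.
Qed.

End radon_john.

(** * Uniqueness *)

Section Lp_limit.
Context d {T : measurableType d} {R : realType}.
Local Open Scope ereal_scope.

(** Fatou's lemma applied to |M_k - psi|^p gives a zero integral of |phi - psi|^p. *)
Lemma powint_limit_unique (m : {measure set T -> \bar R}) (p : R) (M : nat -> T -> R) (psi phi : T -> R) :
  (0 < p)%R -> (forall k, measurable_fun setT (M k : T -> measurableTypeR R)) ->
  measurable_fun setT (psi : T -> measurableTypeR R) ->
  measurable_fun setT (phi : T -> measurableTypeR R) ->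
  {ae m, forall x, M k x @[k --> \oo] --> phi x} ->
  powint m p (fun x => M k x - psi x)%R @[k --> \oo] --> 0 -> {ae m, forall x, psi x = phi x}.
Proof.
move=> p0 mM mpsi mphi aeM cM; have [Z [mZ Z0 ZP]] := aeM.
pose D := ~` Z; have mD : measurable D by exact: measurableC.
have cvg_off x : D x -> M k x @[k --> \oo] --> phi x.
  by move=> Dx; apply: contrapT => nc; apply: Dx; exact: ZP.
have full (F : T -> \bar R) : measurable_fun setT F -> (forall x, 0 <= F x) ->
    \int[m]_(x in D) F x = \int[m]_x F x.
  move=> mF F0; rewrite [RHS](@ge0_negligible_integral _ _ _ _ _ Z) ?setDE ?setTI//.
have mh k : measurable_fun setT (fun x => (`|M k x - psi x| `^ p)%:E).
  by have mMk := mM k; meas.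
have mphi2 : measurable_fun setT (fun x => (`|phi x - psi x| `^ p)%:E) by meas.
have le0 : \int[m]_x (`|phi x - psi x| `^ p)%:E <= 0.
  rewrite -(cvg_limn_einf_sup cM).1 -full; [|exact: mphi2|by move=> x; rewrite lee_fin powR_ge0].
  rewrite (_ : integral _ _ _ = \int[m]_(x in D) limn_einf (fun k => (`|M k x - psi x| `^ p)%:E)); last first.
    apply: eq_integral => x /set_mem Dx; apply/esym; apply: (cvg_limn_einf_sup _).1.
    apply: cvg_EFin; first exact: nearW.
    rewrite (_ : fine \o _ = fun k => (`|M k x - psi x| `^ p)%R)//.
    apply: cvg_powR_norm => //; apply: cvgB; [exact: cvg_off|exact: cvg_cst].
  apply: le_trans (fatou m mD _ _) _.
  - by move=> k; apply: measurable_funTS; exact: mh.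
  - by move=> k x _; rewrite lee_fin powR_ge0.
  - apply: le_limn_einf => k; rewrite full; [by []|exact: mh|by move=> x; rewrite lee_fin powR_ge0].
have eq0 : \int[m]_x `|(`|phi x - psi x| `^ p)%:E| = 0.
  apply/eqP; rewrite eq_le integral_ge0// andbT; apply: le_trans le0.
  by rewrite le_eqVlt; apply/orP; left; apply/eqP/eq_integral => x _; rewrite gee0_abs// lee_fin powR_ge0.
have /ae_eq_integral_abs := eq0 => /(_ measurableT mphi2).
apply: filterS => x /(_ I) /= -[] /powR_eq0_eq0 /eqP.
by rewrite normr_eq0 subr_eq0 => /eqP.
Qed.

End Lp_limit.

Section null_sets.
Context {R : realType} {N : nat}.

Lemma ball_leb_on_gt0 m W (B : 'M[R]_(m, N)) y (delta : R) : is_onb W B -> y \in W -> 0 < delta ->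
  (0 < \int[leb_on W]_x ((enorm (x - y) <= delta)%R%:R)%:E)%E.
Proof.
move=> WB yW d0; have [BB _] := WB.
rewrite (integral_leb_on_shift (w := - y) (F := fun x => ((enorm x <= delta)%R%:R)%:E)) ?memvN//; last by meas.
rewrite (integral_leb_on WB); [|by meas|by move=> x; pos].
under eq_integral do rewrite enorm_mulmx_orth//.
rewrite (_ : integral _ _ _ = \int[leb m]_v ((dot (delta^-1 *: v) (delta^-1 *: v) <= 1)%R%:R)%:E)%E.
  rewrite (integral_leb_scale (F := fun v => ((dot v v <= 1)%R%:R)%:E)); [|by rewrite invr_gt0|by meas|by move=> x; pos].
  by apply: mule_gt0; [rewrite lte_fin invr_gt0 exprn_gt0// invr_gt0|exact: ball_volume_gt0].
apply: eq_integral => v _; congr ((nat_of_bool _)%:R%:E).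
rewrite -enorm_le1 enormZ; last by rewrite invr_ge0 ltW.
by rewrite ler_pdivrMl// mulr1.
Qed.

(** A set of full measure in W is dense, since balls have positive measure. *)
Lemma ae_exists_near m W (B : 'M[R]_(m, N)) (P : 'rV[R]_N -> Prop) y (delta : R) : is_onb W B ->
  {ae leb_on W, forall x, P x} -> y \in W -> 0 < delta ->
  exists x, [/\ x \in W, P x & enorm (x - y) <= delta].
Proof.
move=> WB aeP yW d0; apply: contrapT => nex.
suff : (\int[leb_on W]_x ((enorm (x - y) <= delta)%R%:R)%:E = 0)%E.
  by move=> E; have := ball_leb_on_gt0 WB yW d0; rewrite E ltxx.
rewrite (_ : 0%E = \int[leb_on W]_x (cst 0%E x))%E; last by rewrite integral0.
apply: ge0_ae_eq_integral => //; [by meas|].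
apply: filterS2 (ae_memv W) aeP => x xW Px _ /=.
by case: leP => // xy; exfalso; apply: nex; exists x.
Qed.

Variable a : 'rV[R]_N.
Hypothesis a0 : a != 0.

Lemma hyperplane_add : (hyperplane a + <[unitv a]>)%VS = fullv.
Proof.
apply/vspaceP => x; rewrite memvf; apply/memv_addP.
exists (Qproj a x); first exact: Qproj_mem.
exists (dot x (unitv a) *: unitv a); first by rewrite memvZ ?memv_line.
by rewrite QprojE// subrK.
Qed.

Lemma dim_hyperplane : (\dim (hyperplane a)).+1 = N.
Proof.
rewrite -(dim_add_unitv a0 (subvv _) (is_onb_onb (hyperplane a))) hyperplane_add dimvf.
by rewrite /dim/= mul1n.
Qed.

Lemma measurable_Qproj : measurable_fun setT (Qproj a).
Proof. by rewrite /Qproj; meas. Qed.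

Lemma Qproj_lift y s : y \in hyperplane a -> Qproj a (y + s *: unitv a) = y.
Proof.
rewrite mem_hyperplane_unitv// => /eqP ya.
by rewrite QprojE// dotDl dotZl ya dot_unitv_unitv// add0r mulr1 addrK.
Qed.

(* The projection of the area measure of the sphere has the density 2 (1 - |y|^2)^(-1/2). *)
Lemma ae_Qproj (P : 'rV[R]_N -> Prop) : {ae leb_on (hyperplane a), forall y, P y} ->
  {ae sphere_measure fullv, forall x, usphere x /\ P (Qproj a x)}.
Proof.
case=> Z [mZ Z0 ZP]; have HB := is_onb_onb (hyperplane a).
have mS := @measurable_usphere R N fullv.
have SE : [set x : 'rV[R]_N | x \in fullv /\ enorm x = 1] = usphere.
  by apply/seteqP; split => x /=; [case|move=> x1; split; first exact: memvf].
have mQZ : measurable (Qproj a @^-1` Z) by rewrite -[X in measurable X]setTI; exact: measurable_Qproj.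
have ae1 : {ae sphere_measure fullv, forall x : 'rV[R]_N, usphere x}.
  exists (~` [set x | x \in fullv /\ enorm x = 1]); split; [exact: measurableC|exact: sphere_measure_conc|].
  by rewrite SE.
suff E : sphere_measure fullv (Qproj a @^-1` Z `&` usphere) = 0%E.
  have ae2 : {ae sphere_measure fullv, forall x : 'rV[R]_N, ~ (Qproj a @^-1` Z `&` usphere) x}.
    exists (Qproj a @^-1` Z `&` usphere); split => //; last by move=> x /= /contrapT.
    by apply: measurableI => //; rewrite -SE.
  apply: filterS2 ae1 ae2 => x x1 x2; split => //.
  by apply: contrapT => nP; apply: x2; split => //; exact: ZP.
rewrite SE in mS.
rewrite -integral_indic//.
pose F (x : 'rV[R]_N) : \bar R := (\1_Z (Qproj a x))%:E.
have mI : measurable_fun setT (\1_Z : 'rV[R]_N -> measurableTypeR R) by exact: measurable_indic.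
have mF : measurable_fun setT F.
  by rewrite /F; apply: measurable_fun_EFin; exact: (measurableT_comp mI measurable_Qproj).
transitivity (\int[sphere_measure fullv]_(x in usphere) F x)%E.
  by apply: eq_integral => x _; rewrite /F !indicE; congr ((nat_of_bool _)%:R%:E); apply/idP/idP; rewrite !inE.
have u0 : 0 \in hyperplane a by rewrite mem0v.
have o0 : orth_to 0 (hyperplane a) by move=> w _; rewrite dot0l.
have n0 : enorm (0 : 'rV[R]_N) < 1 by rewrite enorm0.
have F0 x : (0 <= F x)%E by rewrite lee_fin.
(* With W = a^perp and u = 0 the section is the whole sphere. *)
have := ge0_slice_link a0 (subvv _) HB u0 o0 n0 mF F0.
rewrite /= dot0l subr0 sqrtr1 expr1n !mul1e hyperplane_add => E.
transitivity (\int[sphere_measure fullv]_(x in usphere) F (0 + 1 *: x)%R)%E.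
  by apply: eq_integral => x _; rewrite scale1r add0r.
rewrite E.
pose G (y : 'rV[R]_N) : \bar R := ((\1_Z y + \1_Z y)%:E * ((Num.sqrt (1 - dot y y))^-1)%:E)%E.
have mG : measurable_fun setT G by rewrite /G; meas.
have G0 y : (0 <= G y)%E by rewrite /G mule_ge0// lee_fin ?addr_ge0// invr_ge0 sqrtr_ge0.
transitivity (\int[leb_on (hyperplane a)]_y G y)%E.
  rewrite (integral_leb_on HB mG G0); apply: eq_integral => v _.
  by rewrite add0r /F !Qproj_lift// mem_onb submxMl.
rewrite (@ge0_negligible_integral _ _ _ _ _ Z)//.
by apply: integral0_eq => y [_ yZ]; rewrite /G indicE memNset// addr0 mul0e.
Qed.

End null_sets.

Section uniqueness.
Context {R : realType} {N : nat} (a : 'rV[R]_N).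
Hypothesis a0 : a != 0.
Variables f f1 : 'rV[R]_N -> R.
Hypotheses (cf : csphere f) (cf1 : csphere f1).
Hypothesis ff1 : {ae leb_on (hyperplane a), forall y, slice_pot a f y = slice_pot a f1 y}.

Let slice_pot_eq y : y \in hyperplane a -> dot y y != 1 -> slice_pot a f y = slice_pot a f1 y.
Proof.
move=> yH y1.
have c0 (h : 'rV[R]_N -> R) : csphere h -> slice_pot a h x @[x --> y] --> slice_pot a h y.
  by move=> ch; apply: (@cvg_slice_pot R N a h a0 ch _ (nbhs y) id y _ yH y1); exact: cvg_id.
apply/eqP; rewrite -subr_eq0; apply/negPn/negP => ne.
have := cvgB (c0 _ cf) (c0 _ cf1) => /(_ (nbhs_filter y)).
move/cvgrPdist_lt; set D := _ - _; rewrite -/D in ne.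
move/(_ `|D|); rewrite normr_gt0 => /(_ ne) /nbhs_ballP[delta /= d0 dP].
have d2 : 0 < delta / 2 by rewrite divr_gt0.
have [x [xH xE xy]] := ae_exists_near (is_onb_onb (hyperplane a)) ff1 yH d2.
have /= : `|D - (slice_pot a f x - slice_pot a f1 x)| < `|D|.
  apply: dP; split => //= i j; rewrite /ball/= ord1.
  have -> : y 0 j - x 0 j = - ((x - y) 0 j) by rewrite !mxE opprB.
  rewrite normrN (le_lt_trans (coord_le_enorm _ _))// (le_lt_trans xy)//; lra.
by rewrite xE subrr subr0 ltxx.
Qed.

(** Off the equator the sum is read from the potentials, which agree wherever |y| differs from 1. A
    point x of the equator is the limit of the normalised points x + s a~ and their reflections x -
    s a~ as s tends to 0. *)
Lemma sum_hrefl_unique x : usphere x -> f x + f (hrefl a x) = f1 x + f1 (hrefl a x).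
Proof.
move=> x1; have [xa|xa] := eqVneq (dot x a) 0; last first.
  rewrite (slice_pot_sphere f a0 x1 xa) (slice_pot_sphere f1 a0 x1 xa) slice_pot_eq ?Qproj_mem//.
  rewrite dot_Qproj// -[dot x x]sqr_enorm x1 expr1n -subr_eq0 addrAC subrr sub0r oppr_eq0.
  by rewrite sqrf_eq0 dot_unitv_eq0.
have xH : x \in hyperplane a by rewrite mem_hyperplane xa.
have xn0 : x != 0 by rewrite -enorm_eq0 x1 oner_neq0.
rewrite hrefl_orth//.
pose z (s : R) : 'rV[R]_N := x + s *: unitv a.
have nz s : enorm (z s) = Num.sqrt (1 + s ^+ 2).
  by rewrite /enorm dot_lift// -sqr_enorm x1 expr1n.
have nz0 (s : R) : 0 < Num.sqrt (1 + s ^+ 2) by rewrite sqrtr_gt0 ltr_pwDl// sqr_ge0.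
have lin (c s : R) : hrefl a (c *: z s) = c *: z (- s).
  have xu : dot x (unitv a) = 0 by apply/eqP; rewrite dot_unitv_eq0// xa.
  rewrite hreflE// dotZl /z dotDl dotZl xu add0r dot_unitv_unitv// mulr1 !scalerDr !scalerA.
  by rewrite -addrA -scalerBl; congr (_ + _ *: _); ring.
have E k : sphere_ext f (z (harmonic k)) + sphere_ext f (z (- harmonic k)) =
    sphere_ext f1 (z (harmonic k)) + sphere_ext f1 (z (- harmonic k)).
  set s := harmonic k; rewrite /sphere_ext !nz sqrrN -!lin.
  have s0 : s != 0 by rewrite invr_eq0.
  set w := _ *: z s.
  have w1 : usphere w.
    by rewrite /usphere/= enormZ ?invr_ge0 ?sqrtr_ge0// nz mulVf// gt_eqF.
  have wa : dot w a != 0.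
    rewrite -dot_unitv_eq0// dotZl /z dotDl dotZl dot_unitv_unitv// mulr1.
    have /eqP -> : dot x (unitv a) == 0 by rewrite dot_unitv_eq0// xa.
    by rewrite add0r mulf_neq0// invr_eq0 gt_eqF.
  rewrite (slice_pot_sphere f a0 w1 wa) (slice_pot_sphere f1 a0 w1 wa) slice_pot_eq ?Qproj_mem//.
  rewrite dot_Qproj// -[dot w w]sqr_enorm w1 expr1n -subr_eq0 addrAC subrr sub0r oppr_eq0.
  by rewrite sqrf_eq0 dot_unitv_eq0.
have cz (eps : R) : z (eps * harmonic k) @[k --> \oo] --> x.
  rewrite -[X in _ --> X]addr0 -(scale0r (unitv a)) -(mulr0 eps).
  apply: cvg_rVD; first exact: cvg_cst.
  by apply: cvg_rVZ; [apply: cvgM; [exact: cvg_cst|exact: cvg_harmonic]|exact: cvg_cst].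
have lim (h : 'rV[R]_N -> R) : csphere h ->
    sphere_ext h (z (harmonic k)) + sphere_ext h (z (- harmonic k)) @[k --> \oo] --> h x + h x.
  move=> ch; have hx : sphere_ext h x = h x by rewrite /sphere_ext x1 invr1 scale1r.
  rewrite -hx; apply: cvgD; apply: cvg_sphere_ext => //.
    by under eq_fun do rewrite -[harmonic _]mul1r; exact: cz.
  by under eq_fun do rewrite -mulN1r; exact: cz.
have l1 := lim _ cf; have l2 := lim _ cf1.
have EE := funext E; rewrite EE in l1.
by apply: (cvg_unique _ l1 l2).
Qed.

End uniqueness.

Section radon_john_unique.
Context {R : realType} {N : nat} (a : 'rV[R]_N) (mu : probability 'M[R]_N R).
Hypotheses (haar_mu : is_haar a mu) (N2 : (2 < N)%N) (a0 : a != 0).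
Variables (m : nat) (B : 'M[R]_(m.+2, N)).
Hypothesis HB : is_onb (hyperplane a) B.
Variable e : 'rV[R]_N.
Hypotheses (eH : e \in hyperplane a) (e1 : enorm e = 1).
Variables (n : nat) (tau0 : {vspace 'rV[R]_N}) (B0 : 'M[R]_(n.+1, N)).
Hypotheses (tauH : (tau0 <= hyperplane a)%VS) (tauB : is_onb tau0 B0) (etau : orth_to e tau0).
Variables (f : 'rV[R]_N -> R) (g : set 'rV[R]_N -> R).
Hypotheses (cf : csphere f)
  (gf : {in parallel_planes a n.+2, forall zeta, g zeta = section_integral f zeta}).
Local Notation lam := (leb_on (hyperplane a)).

(** Along t = 1/(k+1) the functions F t equal the spherical means almost everywhere; these converge
    to [slice_pot a f] almost everywhere and to psi in L^p. *)
Lemma radon_john_inv_unique p psi : 1 <= p -> is_radon_john_inv a mu tau0 e p (Phi a g) psi ->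
  {ae lam, forall y, psi y = slice_pot a f y}.
Proof.
move=> p1 [[mpsi _] [F [FLp aeF cF]]]; have p0 : 0 < p by rewrite (lt_le_trans ltr01).
have mf := measurable_slice_pot a cf.
have mM := @measurable_sphere_mean R N a mu e _ mf.
have mMt t : measurable_fun setT (fun y => sphere_mean a mu e (slice_pot a f) y t : measurableTypeR R).
  by apply: (measurable_fun_compr mM (h := fun y => (y, t))); apply/measurable_fun_pairP; split; meas.
pose u (k : nat) : R := harmonic k.
have u0 k : 0 < u k by rewrite invr_gt0.
have cu : u k @[k --> \oo] --> 0 by exact: cvg_harmonic.
have cFu : Lnorm lam p%:E (EFin \o (F (u k) \- psi)) @[k --> \oo] --> 0%E.
  by move/(cvge_at_rightP _ 0 0) : cF; apply.
apply: (@powint_limit_unique _ _ R lam p (fun k y => sphere_mean a mu e (slice_pot a f) y (u k))).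
- exact: p0.
- by move=> k; exact: mMt.
- exact: mpsi.
- exact: mf.
- exact: (ae_sphere_mean_cvg haar_mu a0 HB e1 cf cu).
have /(cvg_Lnorm lam (fun k y => F (u k) y - psi y) _ p0) := cFu.
apply: cvg_trans; apply: near_eq_cvg; apply: nearW => k.
have [mF _] := FLp _ (u0 k); have mMk := mMt (u k).
apply: ge0_ae_eq_integral => //.
- by meas.
- by meas.
have aeM := ae_inversion haar_mu N2 a0 HB eH e1 tauH tauB etau cf gf (u0 k).
have := aeF _ (u0 k); rewrite (is_onb_dim tauB) => aeFk.
by apply: filterS2 aeM aeFk => y E1 E2 _; rewrite E1 E2.
Qed.

(** Both potentials invert the same Phi, already with p = 1. *)
Lemma ae_slice_pot_unique f1 : csphere f1 ->
  {in parallel_planes a n.+2, forall zeta, section_integral f1 zeta = g zeta} ->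
  {ae lam, forall y, slice_pot a f y = slice_pot a f1 y}.
Proof.
move=> cf1 gf1.
have gf1' : {in parallel_planes a n.+2, forall zeta, g zeta = section_integral f1 zeta}.
  by move=> zeta /gf1 ->.
have p12 : 1 <= (1 : R) < 2 by rewrite lexx ltr1n.
have inv1 := radon_john_inv_slice_pot haar_mu N2 a0 HB eH e1 tauH tauB etau cf1 gf1' (lexx 1)
  (in_Lp_slice_pot HB a0 cf1 p12).
by apply: filterS (radon_john_inv_unique (lexx 1) inv1) => y ->.
Qed.

(** f itself witnesses that a preimage of g exists, so the choice is a genuine preimage; its even
    part is that of f. *)
Lemma section_integral_inv_sum x : usphere x ->
  section_integral_inv a n.+2 g x = 2^-1 * (f x + f (hrefl a x)).
Proof.
move=> x1; rewrite /section_integral_inv; set P := [set h | _].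
have [cf1 gf1] : P (xget (fun=> 0) P).
  by apply: xgetPex; exists f; split => // zeta /gf ->.
by rewrite (sum_hrefl_unique a0 cf cf1 (ae_slice_pot_unique cf1 gf1) x1).
Qed.

(** Excluding |y| = 1 removes the equator, where [slice_pot_sphere] does not apply; [ae_Qproj]
    carries null sets of a^perp to the sphere. *)
Lemma ae_radon_john_inv p psi : 1 <= p -> is_radon_john_inv a mu tau0 e p (Phi a g) psi ->
  {ae sphere_measure fullv, forall x,
    f x + f (hrefl a x) = `|dot x (unitv a)| * psi (Qproj a x)}.
Proof.
move=> p1 inv.
have aeP : {ae lam, forall y, psi y = slice_pot a f y /\ enorm y != 1}.
  by apply: filterS2 (radon_john_inv_unique p1 inv) (ae_enorm_neq 1 HB).
apply: filterS (ae_Qproj a0 aeP) => x [x1 [-> xn]].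
rewrite slice_pot_sphere//; apply: contra xn => xa.
rewrite /enorm dot_Qproj// -sqr_enorm x1 expr1n.
have /eqP -> : dot x (unitv a) == 0 by rewrite dot_unitv_eq0.
by rewrite expr0n subr0 sqrtr1.
Qed.

End radon_john_unique.

Lemma ex_is_onb (R : realType) N d (W : {vspace 'rV[R]_N}) :
  \dim W = d -> exists B : 'M[R]_(d, N), is_onb W B.
Proof. by move=> <-; exists (onb W); exact: is_onb_onb. Qed.

Theorem theorem3p3 (R : realType) (n k : nat) (a : 'rV[R]_n.+1)
    (f : 'rV[R]_n.+1 -> R) (g : set 'rV[R]_n.+1 -> R)
    (haar : probability 'M[R]_n.+1 R)
    (tau0 : {vspace 'rV[R]_n.+1}) (e : 'rV[R]_n.+1) :
  (1 < k <= n)%N ->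
  a != 0 ->
  csphere_even a f ->
  {in parallel_planes a k, forall zeta, g zeta = section_integral f zeta} ->
  is_haar a haar ->
  (tau0 <= hyperplane a)%VS -> \dim tau0 = k.-1 ->
  e \in hyperplane a -> enorm e = 1 -> orth_to e tau0 ->
  [/\ {in usphere, forall x, f x = section_integral_inv a k g x},
      exists psi : 'rV[R]_n.+1 -> R,
        [/\ forall p : R, 1 <= p < 2 -> in_Lp a p psi,
            forall p : R, 1 <= p < n%:R / k.-1%:R -> in_Lp a p psi ->
              is_radon_john_inv a haar tau0 e p (Phi a g) psi &
            forall x, usphere x -> dot x a != 0 ->
              f x = 2^-1 * `|dot x (unitv a)| * psi (Qproj a x)] &
      forall (p : R) (psi : 'rV[R]_n.+1 -> R),
        1 <= p < n%:R / k.-1%:R ->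
        is_radon_john_inv a haar tau0 e p (Phi a g) psi ->
        {ae sphere_measure fullv, forall x,
          f x = 2^-1 * `|dot x (unitv a)| * psi (Qproj a x)}].
Proof.
(* From here on the dimension of the planes is [k.+2], and d is [k.+1]. *)
case: k => [|[|k]]// /andP[_ kn] a0 [cf fR] gf haar_mu tauH dim_tau eH e1 etau.
have N2 : (2 < n.+1)%N by rewrite ltnS (leq_trans _ kn).
have [B0 tauB] := ex_is_onb dim_tau.
(* n is the dimension of a^perp; it is at least 2, as the zone estimates require. *)
have [m nm] : exists m, n = m.+2.
  by case: n kn {a f g haar tau0 e a0 cf fR gf haar_mu tauH dim_tau eH e1 etau N2 B0 tauB} => [|[|m]] // _; exists m.
have [B HB] : exists B : 'M[R]_(m.+2, n.+1), is_onb (hyperplane a) B.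
  by apply: ex_is_onb; apply: succn_inj; rewrite dim_hyperplane// nm.
have sumE x : usphere x -> 2^-1 * (f x + f (hrefl a x)) = f x.
  by move=> x1; rewrite -fR ?inE//; field.
split.
- move=> x /set_mem x1.
  by rewrite (section_integral_inv_sum haar_mu N2 a0 HB eH e1 tauH tauB etau cf gf x1) sumE.
- exists (slice_pot a f); split.
  + by move=> p; exact: (in_Lp_slice_pot HB a0 cf).
  + move=> p /andP[p1 _].
    exact: (radon_john_inv_slice_pot haar_mu N2 a0 HB eH e1 tauH tauB etau cf gf p1).
  + by move=> x x1 xa; rewrite -mulrA -slice_pot_sphere// sumE.
- move=> p psi /andP[p1 _] inv.
  have ae1 : {ae sphere_measure fullv, forall x : 'rV[R]_n.+1, usphere x}.
    by apply: filterS (ae_Qproj a0 (P := fun=> True) _) => [x []//|]; exact: aeW.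
  apply: filterS2 ae1 (ae_radon_john_inv haar_mu N2 a0 HB eH e1 tauH tauB etau cf gf p1 inv) => x x1 E.
  by rewrite -mulrA -E sumE.
Qed.
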